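(* Let $i,j\in I\setminus X$ be distinct with $\tau(i)=i$. Write $a=a_{ij}$. Then in $U_q(\mathfrak g')$ $$F_{ij}(B_i,B_j)=\sum_{m=0}^{-1-a}\ \sum_{m'=0}^{-1-a-m}\rho_{m,m'}\,\mathcal Z_i^{\frac{1-a-m-m'}{2}}B_i^mB_jB_i^{m'},$$ where the structure constants are given, for either choice of $s\in\{0,1\}$, by $$\rho_{m,m'}=(a+m+m')_p\,(-1)^{a+m}\,(-q_ic_i)^{\frac{1-a-m-m'}{2}}\,\Theta^{(s)}_{m,m'},$$ with $$\Theta^{(0)}_{m,m'}=\sum_{r=0}^{\frac{1-a-m-m'}{2}}\begin{bmatrix}1-a\\ m+2r\end{bmatrix}_{q_i}\alpha^{(0,i)}_{r,\,r+m_e+m_p-1}\ \alpha^{(a_p,i)}_{\frac{1-a-m-m'}{2}-r,\,-a_e-a_p-r-m_e-m_p},$$ $$\Theta^{(1)}_{m,m'}=\sum_{r=0}^{\frac{1-a-m-m'}{2}}\begin{bmatrix}1-a\\ m+2r\end{bmatrix}_{q_i}\alpha^{(1,i)}_{r,\,r+m_e-1}\ \alpha^{(1-a_p,i)}_{\frac{1-a-m-m'}{2}-r,\,-a_e-r-m_e-1}.$$ Terms with $a+m+m'$ even are zero.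
   Context: General conventions: $\mathbb N=\{0,1,2,\dots\}$; empty sums are $0$, empty products are $1$. For $d\in\mathbb Z$: $d_e=\lfloor d/2\rfloor$, $d_p=d-2d_e\in\{0,1\}$. Quantum group: $\mathbb K$ is an algebraically closed field of characteristic $0$, $q$ an indeterminate. $I=\{0,\dots,n-1\}$ and $A=(a_{ij})_{i,j\in I}$ is an indecomposable symmetrizable generalized Cartan matrix ($a_{ii}=2$; $a_{ij}\in\mathbb Z_{\le0}$ for $i\ne j$; $a_{ij}=0\Leftrightarrow a_{ji}=0$), with mutually coprime positive integers $\epsilon_i$ such that $(\epsilon_ia_{ij})$ is symmetric. $\mathfrak g=\mathfrak g(A)$ is the Kac–Moody algebra with simple roots $\alpha_i$, coroots $h_i$, $\alpha_j(h_i)=a_{ij}$, root lattice $Q=\bigoplus_i\mathbb Z\alpha_i$, and $(\alpha_i,\alpha_j)=\epsilon_ia_{ij}$. Put $q_i=q^{\epsilon_i}$, $[m]_{q_i}=\frac{q_i^m-q_i^{-m}}{q_i-q_i^{-1}}$, $[m]_{q_i}!=\prod_{\ell=1}^m[\ell]_{q_i}$, $\begin{bmatrix}N\\ m\end{bmatrix}_{q_i}=\frac{[N]_{q_i}!}{[m]_{q_i}![N-m]_{q_i}!}$, and $F_{ij}(x,y)=\sum_{\ell=0}^{1-a_{ij}}(-1)^\ell\begin{bmatrix}1-a_{ij}\\\ell\end{bmatrix}_{q_i}x^{1-a_{ij}-\ell}yx^\ell$. $U_q(\mathfrak g')$ is the $\mathbb K(q)$-algebra generated by $E_i,F_i,K_i^{\pm1}$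 ($i\in I$) with relations: $K_i^{\pm1}K_i^{\mp1}=1$, the $K_i$ commute, $K_iE_j=q_i^{a_{ij}}E_jK_i$, $K_iF_j=q_i^{-a_{ij}}F_jK_i$, $[E_i,F_j]=\delta_{ij}\frac{K_i-K_i^{-1}}{q_i-q_i^{-1}}$, $F_{ij}(E_i,E_j)=F_{ij}(F_i,F_j)=0$ ($i\ne j$). Hopf structure: $\Delta(E_i)=E_i\otimes1+K_i\otimes E_i$, $\Delta(F_i)=F_i\otimes K_i^{-1}+1\otimes F_i$, $\Delta(K_i)=K_i\otimes K_i$, $\epsilon(E_i)=\epsilon(F_i)=0$, $\epsilon(K_i)=1$, $S(E_i)=-K_i^{-1}E_i$, $S(F_i)=-F_iK_i$, $S(K_i)=K_i^{-1}$. The left adjoint action is $\mathrm{ad}(x)(u)=x_{(1)}uS(x_{(2)})$. For $\beta=\sum m_i\alpha_i\in Q$, $K_\beta=\prod K_i^{m_i}$. Admissible pair: $r_i$ are the fundamental reflections, $r_i(h)=h-\alpha_i(h)h_i$, $r_i(\alpha)=\alpha-\alpha(h_i)\alpha_i$. A fixed arbitrary admissible pair $(X,\tau)$ consists of $X\subseteq I$ of finite type and a permutation $\tau$ of $I$ with $\tau(X)=X$, $a_{\tau(i)\tau(j)}=a_{ij}$, such that $\tau^2=\mathrm{id}$; $h_{\tau(j)}=-w_X(h_j)$ and $\alpha_{\tau(j)}=-w_X(\alpha_j)$ for $j\in X$, where $w_X$ is the longest element of $W_X=\langle r_i:i\in X\rangle$; and $\alpha_i(\rho_X^\vee)\in\mathbb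 Z$ for all $i\in I\setminus X$ with $\tau(i)=i$, where $\rho_X^\vee$ is half the sum of the positive coroots of the root system generated by $X$. $\tau$ acts on $Q$ by $\tau(\alpha_i)=\alpha_{\tau(i)}$. The automorphism $\theta_q=\mathrm{Ad}(s(X,\tau))\circ T_{w_X}\circ\psi\circ\tau\circ\omega$ of $U_q(\mathfrak g')$: $\omega(E_i)=-F_i$, $\omega(F_i)=-E_i$, $\omega(K_i)=K_i^{-1}$; $\tau(E_i)=E_{\tau(i)}$, $\tau(F_i)=F_{\tau(i)}$, $\tau(K_i)=K_{\tau(i)}$; $\psi(E_i)=E_iK_i$, $\psi(F_i)=K_i^{-1}F_i$, $\psi(K_i)=K_i$; $T_{w_X}=T_{i_1}\cdots T_{i_k}$ for a reduced expression $w_X=r_{i_1}\cdots r_{i_k}$, $T_i$ being Lusztig's automorphism $T''_{i,1}$ ($T_i(E_i)=-F_iK_i$, $T_i(F_i)=-K_i^{-1}E_i$, $T_i(K_\beta)=K_{r_i(\beta)}$, and for $j\neq i$ $T_i(E_j)=\sum_{r+s=-a_{ij}}(-1)^rq_i^{-r}E_i^{(s)}E_jE_i^{(r)}$, $T_i(F_j)=\sum_{r+s=-a_{ij}}(-1)^rq_i^{r}F_i^{(r)}F_jF_i^{(s)}$ with $x^{(r)}=x^r/[r]_{q_i}!$); $\mathrm{Ad}(s(X,\tau))$ multiplies elements of weight $\alpha\in Q$ by $s(X,\tau)(\alpha)$, where $s(X,\tau):Q\to\mathbb K^\times$ is the group morphism with $s(X,\tau)(\alpha_j)=1$ if $j\in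 X$ or $\tau(j)=j$, $(\sqrt{-1})^{\alpha_j(2\rho_X^\vee)}$ if $j\notin X$ and $\tau(j)>j$, $(-\sqrt{-1})^{\alpha_j(2\rho_X^\vee)}$ if $j\notin X$ and $\tau(j)<j$. Parameters and generators: $\mathbf c=(c_i)\in(\mathbb K(q)^\times)^{I\setminus X}$ with $c_i=c_{\tau(i)}$ whenever $\tau(i)\neq i$ and $(\alpha_i,-w_X\tau(\alpha_i))=0$; $\mathbf s=(s_i)\in\mathbb K(q)^{I\setminus X}$ such that $s_i\ne0$ implies $i\in I_{ns}$ and $a_{ji}\in-2\mathbb N\setminus\{0\}$ for all $j\in I_{ns}\setminus\{i\}$, where $I_{ns}=\{i\in I\setminus X:\tau(i)=i,\ a_{ij}=0\ \forall j\in X\}$. For $i\in I\setminus X$, $B_i=F_i+c_i\theta_q(F_iK_i)K_i^{-1}+s_iK_i^{-1}$; for $i\in X$, $B_i=F_i$. (The quantum symmetric pair coideal subalgebra $B_{\mathbf c,\mathbf s}$ is generated by all $B_i$, by $E_i,K_i^{\pm1}$ with $i\in X$, and by $K_\beta$ with $-w_X\tau(\beta)=\beta$.) Definition of $\mathcal Z_i$: by a result of Kolb, for each $i\in I\setminus X$ there are a monomial $Z_i^+=E_{j_1}\cdots E_{j_r}$ ($j_1,\dots,j_r\in X$) and $a_i\in\mathbb K(q)$ with $T_{w_X}(E_i)=a_i\,\mathrm{ad}(Z_i^+)(E_i)$, and $v_i\in\mathbb K(q)^\times$ with $\theta_q(F_iK_i)=-v_i\,\mathrm{ad}(Z^+_{\tau(i)})(E_{\tau(i)})$.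 Then $\mathcal Z_i=-v_i\,\mathrm{ad}(Z^+_{\tau(i)})(K_{\tau(i)}^2)K_{\tau(i)}^{-1}K_i^{-1}$. The scalars $\alpha^{(s,i)}_{k,N}$ ($k\in\mathbb N$, $N\in\mathbb N\cup\{-1\}$, $s\in\{0,1\}$): $\alpha^{(s,i)}_{0,N}=1$; for $1\le k\le N+s$, $\alpha^{(s,i)}_{k,N}=\sum_{1-s\le\ell_1<\ell_2<\dots<\ell_k\le N}[2\ell_1+s]_{q_i}^2[2\ell_2+s]_{q_i}^2\cdots[2\ell_k+s]_{q_i}^2$; and $\alpha^{(s,i)}_{k,N}=0$ otherwise. *)

(* Defs.v *)
From HB Require Import structures.
From mathcomp Require Import all_boot all_order all_algebra perm.
From mathcomp Require Import boolp classical_sets fsbigop.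
From mathcomp Require Import monalg.

Set Implicit Arguments.
Unset Strict Implicit.
Unset Printing Implicit Defensive.

Import Order.TTheory GRing.Theory Num.Theory.

Local Open Scope ring_scope.
Local Open Scope quotient_scope.

(* The epsilon_i are coprime as a family; pairwise coprimality would exclude,
   for instance, type B_3. *)
Record symmetrizable_gcm n (A : 'M[int]_n) (eps : 'I_n -> nat) : Prop := {
  gcm_diag : forall i, A i i = 2;
  gcm_offdiag : forall i j, i != j -> A i j <= 0;
  gcm_zero : forall i j, A i j = 0 <-> A j i = 0;
  gcm_eps_gt0 : forall i, (0 < eps i)%N;
  gcm_eps_coprime : (\big[gcdn/0]_(i < n) eps i = 1)%N;
  gcm_sym : forall i j, (eps i)%:Z * A i j = (eps j)%:Z * A j i;
  gcm_indecomposable : forall S : {set 'I_n}, S != finset.set0 ->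
    S != [set: 'I_n]%SET -> exists i j, [/\ i \in S, j \notin S & A i j != 0]
}.

Section CartanData.
Context (n : nat) (A : 'M[int]_n) (eps : 'I_n -> nat).
Implicit Types (X : {set 'I_n}) (i j : 'I_n) (w : seq 'I_n).

(* A row vector of integers stands for an element of the root lattice Q, in
   the basis of the simple roots, or of the coroot lattice, in the basis of
   the h_i. *)
Definition simple i : 'rV[int]_n := delta_mx 0 i.

(* alpha_j(h_i) = a_ij *)
Definition root_at (b : 'rV[int]_n) i : int := \sum_j b 0 j * A i j.
Definition simple_at i (h : 'rV[int]_n) : int := \sum_j h 0 j * A j i.

Definition form (b g : 'rV[int]_n) : int :=
  \sum_i \sum_j b 0 i * g 0 j * ((eps i)%:Z * A i j).

Definition refl i (b : 'rV[int]_n) := b - root_at b i *: simple i.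
Definition corefl i (h : 'rV[int]_n) := h - simple_at i h *: simple i.

(* The word [:: i_1; ...; i_k] acts as r_{i_1} ... r_{i_k}. *)
Definition weyl w (b : 'rV[int]_n) := foldr refl b w.
Definition coweyl w (h : 'rV[int]_n) := foldr corefl h w.

(* The Weyl group acts faithfully on Q, so two words are equal in it as soon
   as they agree on Q. *)
Definition reduced w := forall w', weyl w' =1 weyl w -> (size w <= size w')%N.

Definition reduced_longest X w :=
  [/\ {subset w <= X}, reduced w
    & forall w', {subset w' <= X} -> reduced w' -> (size w' <= size w)%N].

Definition submatrix (J : {set 'I_n}) : 'M[int]_#|J| :=
  \matrix_(k, l) A (enum_val k) (enum_val l).

Definition finite_type X :=
  forall J : {set 'I_n}, J \subset X -> 0 < \det (submatrix J).

Definition positive_coroot X : set 'rV[int]_n :=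
  [set h | exists w i, [/\ {subset w <= X}, i \in X,
                          h = coweyl w (simple i) & forall j, 0 <= h 0 j]]%classic.

Definition two_rho_vee X : 'rV[int]_n := \sum_(h \in positive_coroot X) h.

Definition actQ (tau : {perm 'I_n}) (b : 'rV[int]_n) : 'rV[int]_n :=
  \sum_j b 0 j *: simple (tau j).

Record admissible_pair X (tau : {perm 'I_n}) (wX : seq 'I_n) : Prop := {
  adm_finite_type : finite_type X;
  adm_longest : reduced_longest X wX;
  adm_tauX : tau @: X = X;
  adm_tauA : forall i j, A (tau i) (tau j) = A i j;
  adm_tauK : involutive tau;
  adm_coroot : {in X, forall j, simple (tau j) = - coweyl wX (simple j)};
  adm_root : {in X, forall j, simple (tau j) = - weyl wX (simple j)};
  adm_rho : forall i, i \notin X -> tau i = i ->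
    (simple_at i (two_rho_vee X))%:~R / 2 \is a @Num.int rat
}.

(* The group morphism s(X, tau) : Q -> k^*, for a square root im of -1. *)
Definition s_simple (k : fieldType) (im : k) X (tau : {perm 'I_n}) j : k :=
  if (j \in X) || (tau j == j) then 1
  else if (j < tau j)%N then im ^ simple_at j (two_rho_vee X)
  else (- im) ^ simple_at j (two_rho_vee X).

Definition s_char (k : fieldType) (im : k) X (tau : {perm 'I_n})
    (b : 'rV[int]_n) : k :=
  \prod_j s_simple im X tau j ^ b 0 j.

Definition I_ns X (tau : {perm 'I_n}) : {set 'I_n} :=
  [set i | [&& i \notin X, tau i == i & [forall j in X, A i j == 0]]].

(* The families c and s are indexed by the complement of X; their values on X
   are irrelevant. *)
Definition c_parameter (F : fieldType) X (tau : {perm 'I_n}) (wX : seq 'I_n)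
    (c : 'I_n -> F) : Prop :=
  forall i, i \notin X -> c i != 0 /\
    (tau i != i -> form (simple i) (- weyl wX (actQ tau (simple i))) = 0 ->
     c i = c (tau i)).

Definition s_parameter (F : fieldType) X (tau : {perm 'I_n})
    (s : 'I_n -> F) : Prop :=
  forall i, i \notin X -> s i != 0 -> i \in I_ns X tau /\
    forall j, j \in I_ns X tau :\ i -> exists m : nat, A j i = - (2 * m.+1)%:Z.

End CartanData.

Section QuantumIntegers.
Context (F : fieldType).
Implicit Types (p : F) (m N : nat).

Definition qnum p m : F := (p ^+ m - p ^- m) / (p - p^-1).
Definition qfact p m : F := \prod_(1 <= l < m.+1) qnum p l.
Definition qbinom p N m : F := qfact p N / (qfact p m * qfact p (N - m)).

End QuantumIntegers.

(* d_e = floor(d / 2) and d_p = d - 2 d_e; %/ rounds towards -oo here. *)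
Definition ehalf (d : int) : int := (d %/ 2)%Z.
Definition eparity (d : int) : int := d - 2 * ehalf d.

Definition Fij (F : fieldType) (q : F) n (A : 'M[int]_n) (eps : 'I_n -> nat)
    (B : lalgType F) (i j : 'I_n) (x y : B) : B :=
  let N := `|1 - A i j|%N in
  \sum_(l < N.+1)
     ((-1) ^+ l * qbinom (q ^+ eps i) N l) *: (x ^+ (N - l) * y * x ^+ l).

Inductive gen (n : nat) :=
  GE of 'I_n | GF of 'I_n | GK of 'I_n | GKi of 'I_n.

Section GenChoice.
Context (n : nat).

Definition gen_encode (g : gen n) : 'I_4 * 'I_n :=
  match g with
  | GE i => (inord 0, i) | GF i => (inord 1, i)
  | GK i => (inord 2, i) | GKi i => (inord 3, i)
  end.

Definition gen_decode (p : 'I_4 * 'I_n) : gen n :=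
  match nat_of_ord p.1 with
  | 0 => GE p.2 | 1 => GF p.2 | 2 => GK p.2 | _ => GKi p.2
  end%N.

Lemma gen_encodeK : cancel gen_encode gen_decode.
Proof. by case=> i; rewrite /gen_decode /= inordK. Qed.

HB.instance Definition _ := Countable.copy (gen n) (can_type gen_encodeK).

End GenChoice.

Section QuantumGroup.
Context (F : fieldType) (q : F) (n : nat) (A : 'M[int]_n) (eps : 'I_n -> nat).

Definition freeA : Type := {malg F[{fmonom (gen n)}]}.
HB.instance Definition _ := GRing.Lalgebra.on freeA.

Definition fgen (g : gen n) : freeA := << fmu g >>.

Local Notation e i := (fgen (GE i)).
Local Notation f i := (fgen (GF i)).
Local Notation k i := (fgen (GK i)).
Local Notation k' i := (fgen (GKi i)).
Local Notation q_ i := (q ^+ eps i).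

Inductive relator : freeA -> Prop :=
| rel_KKi i : relator (k i * k' i - 1)
| rel_KiK i : relator (k' i * k i - 1)
| rel_KK i j : relator (k i * k j - k j * k i)
| rel_KE i j : relator (k i * e j - q_ i ^ A i j *: (e j * k i))
| rel_KF i j : relator (k i * f j - q_ i ^ (- A i j) *: (f j * k i))
| rel_EF i j : relator (e i * f j - f j * e i
    - (if i == j then (q_ i - (q_ i)^-1)^-1 *: (k i - k' i) else 0))
| rel_serreE i j : i != j -> relator (Fij q A eps i j (e i) (e j))
| rel_serreF i j : i != j -> relator (Fij q A eps i j (f i) (f j)).

(* The two-sided ideal generated by the relators. *)
Inductive ideal : freeA -> Prop :=
| ideal_rel x : relator x -> ideal x
| ideal0 : ideal 0
| idealD x y : ideal x -> ideal y -> ideal (x + y)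
| idealMl x y : ideal y -> ideal (x * y)
| idealMr x y : ideal x -> ideal (x * y).

Lemma idealN x : ideal x -> ideal (- x).
Proof. by move=> Ix; rewrite -mulN1r; apply: idealMl. Qed.

Lemma idealB x y : ideal x -> ideal y -> ideal (x - y).
Proof. by move=> Ix Iy; apply/idealD/idealN. Qed.

Definition ideal_eq (x y : freeA) := `[< ideal (x - y) >].

Lemma ideal_eq_refl : reflexive ideal_eq.
Proof. by move=> x; apply/asboolP; rewrite subrr; apply: ideal0. Qed.

Lemma ideal_eq_sym : symmetric ideal_eq.
Proof.
by move=> x y; apply/asboolP/asboolP => /idealN; rewrite opprB.
Qed.

Lemma ideal_eq_trans : transitive ideal_eq.
Proof.
move=> y x z /asboolP Ixy /asboolP Iyz; apply/asboolP.
by have := idealD Ixy Iyz; rewrite addrA subrK.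
Qed.

Canonical ideal_equiv :=
  EquivRel ideal_eq ideal_eq_refl ideal_eq_sym ideal_eq_trans.

Definition Uq : Type := {eq_quot ideal_equiv}.
HB.instance Definition _ := Choice.on Uq.
HB.instance Definition _ := Quotient.on Uq.

Definition Uq_pi (x : freeA) : Uq := \pi_Uq x.

Lemma Uq_piP x y : Uq_pi x = Uq_pi y <-> ideal (x - y).
Proof.
rewrite /Uq_pi; split=> [/eqmodP/asboolP //|Ixy].
by apply/eqmodP/asboolP.
Qed.

Lemma Uq_reprK x : Uq_pi (repr x) = x.
Proof. exact: reprK. Qed.

Lemma Uq_repr_pi x : ideal (repr (Uq_pi x) - x).
Proof. by apply/Uq_piP; rewrite Uq_reprK. Qed.

(* The operations and the generators are locked, for otherwise unification
   unfolds them down to {malg _[_]}. *)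
Definition Uq_add := locked (fun x y : Uq => Uq_pi (repr x + repr y)).
Definition Uq_opp := locked (fun x : Uq => Uq_pi (- repr x)).
Definition Uq_mul := locked (fun x y : Uq => Uq_pi (repr x * repr y)).
Definition Uq_scale := locked (fun (a : F) (x : Uq) => Uq_pi (a *: repr x)).

Lemma Uq_addE x y : Uq_add (Uq_pi x) (Uq_pi y) = Uq_pi (x + y).
Proof.
rewrite /Uq_add -lock; apply/Uq_piP; have := idealD (Uq_repr_pi x) (Uq_repr_pi y).
by rewrite opprD addrACA.
Qed.

Lemma Uq_oppE x : Uq_opp (Uq_pi x) = Uq_pi (- x).
Proof.
rewrite /Uq_opp -lock; apply/Uq_piP; rewrite -opprD.
exact/idealN/Uq_repr_pi.
Qed.

Lemma Uq_mulE x y : Uq_mul (Uq_pi x) (Uq_pi y) = Uq_pi (x * y).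
Proof.
rewrite /Uq_mul -lock; apply/Uq_piP; set x' := repr _; set y' := repr _.
have -> : x' * y' - x * y = (x' - x) * y' + x * (y' - y).
  by rewrite mulrBl mulrBr addrA subrK.
by apply: idealD; [apply/idealMr/Uq_repr_pi | apply/idealMl/Uq_repr_pi].
Qed.

Lemma Uq_scaleE a x : Uq_scale a (Uq_pi x) = Uq_pi (a *: x).
Proof.
rewrite /Uq_scale -lock; apply/Uq_piP; rewrite -scalerBr -[_ - _]mul1r scalerAl.
exact/idealMl/Uq_repr_pi.
Qed.

Lemma Uq_ind (P : Uq -> Prop) : (forall x, P (Uq_pi x)) -> forall x, P x.
Proof. by move=> Ppi x; rewrite -(Uq_reprK x); apply: Ppi. Qed.

Fact Uq_addA : associative Uq_add.
Proof.
by elim/Uq_ind=> x; elim/Uq_ind=> y; elim/Uq_ind=> z; rewrite !Uq_addE addrA.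
Qed.

Fact Uq_addC : commutative Uq_add.
Proof. by elim/Uq_ind=> x; elim/Uq_ind=> y; rewrite !Uq_addE addrC. Qed.

Fact Uq_add0 : left_id (Uq_pi 0) Uq_add.
Proof. by elim/Uq_ind=> x; rewrite Uq_addE add0r. Qed.

Fact Uq_addN : left_inverse (Uq_pi 0) Uq_opp Uq_add.
Proof. by elim/Uq_ind=> x; rewrite Uq_oppE Uq_addE addNr. Qed.

HB.instance Definition _ :=
  Algebra.isZmodule.Build Uq Uq_addA Uq_addC Uq_add0 Uq_addN.

Fact Uq_mulA : associative Uq_mul.
Proof.
by elim/Uq_ind=> x; elim/Uq_ind=> y; elim/Uq_ind=> z; rewrite !Uq_mulE mulrA.
Qed.

Fact Uq_mul1 : left_id (Uq_pi 1) Uq_mul.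
Proof. by elim/Uq_ind=> x; rewrite Uq_mulE mul1r. Qed.

Fact Uq_mulr1 : right_id (Uq_pi 1) Uq_mul.
Proof. by elim/Uq_ind=> x; rewrite Uq_mulE mulr1. Qed.

Fact Uq_mulDl : left_distributive Uq_mul +%R.
Proof.
elim/Uq_ind=> x; elim/Uq_ind=> y; elim/Uq_ind=> z.
by rewrite /+%R /= !(Uq_addE, Uq_mulE) mulrDl.
Qed.

Fact Uq_mulDr : right_distributive Uq_mul +%R.
Proof.
elim/Uq_ind=> x; elim/Uq_ind=> y; elim/Uq_ind=> z.
by rewrite /+%R /= !(Uq_addE, Uq_mulE) mulrDr.
Qed.

(* The counit kills the ideal but not 1, hence 1 != 0 in the quotient, as the
   nzRingType structure requires. *)
Definition counit_gen (g : gen n) : F :=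
  match g with GE _ | GF _ => 0 | GK _ | GKi _ => 1 end.

Definition counit_mon (m : {fmonom (gen n)}) : F := \prod_(g <- m) counit_gen g.

Fact counit_mon_morph : mmorphism counit_mon.
Proof.
split=> [x y|]; first by rewrite /counit_mon fmM big_cat.
by rewrite /counit_mon fm1 big_nil.
Qed.

HB.instance Definition _ :=
  monalg.isMultiplicative.Build {fmonom (gen n)} F counit_mon counit_mon_morph.

Definition counit (x : freeA) : F := mmap idfun counit_mon x.

Let counit0 : counit 0 = 0. Proof. exact: mmap0. Qed.
Let counit1 : counit 1 = 1. Proof. exact: mmap1. Qed.
Let counitD x y : counit (x + y) = counit x + counit y.
Proof. exact: mmapD. Qed.
Let counitB x y : counit (x - y) = counit x - counit y.
Proof. exact: mmapB. Qed.
Let counitZ a x : counit (a *: x) = a * counit x. Proof. exact: mmapZ. Qed.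
Let counitM x y : counit (x * y) = counit x * counit y.
Proof. exact: (mmap_is_multiplicative (f := idfun) (h := counit_mon)).1. Qed.

Let counitMB x y z t :
  counit (x * y - z * t) = counit x * counit y - counit z * counit t.
Proof. by rewrite counitB; congr (_ - _); apply: counitM. Qed.
Let counitMB1 x y : counit (x * y - 1) = counit x * counit y - 1.
Proof. by rewrite counitB counit1; congr (_ - _); apply: counitM. Qed.
Let counitMZB a x y z t :
  counit (x * y - a *: (z * t)) =
  counit x * counit y - a * (counit z * counit t).
Proof.
by rewrite counitB counitZ; congr (_ - _ * _); apply: counitM.
Qed.

Lemma counit_fgen g : counit (fgen g) = counit_gen g.
Proof. by rewrite /counit mmapU mul1r /counit_mon fmU big_seq1. Qed.

Lemma counit_Fij i j x y : counit y = 0 ->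
  counit (Fij q A eps i j x y) = 0.
Proof.
move=> y0; rewrite /Fij (big_morph counit counitD counit0) big1 //= => l _.
by rewrite counitZ !counitM y0 mulr0 mul0r mulr0.
Qed.

Lemma counit_ideal x : ideal x -> counit x = 0.
Proof.
elim=> {x}[x Rx||x y _ x0 _ y0|x y _ y0|x y _ x0]; last 4 first.
- exact: counit0.
- by rewrite counitD x0 y0 addr0.
- by rewrite counitM y0 mulr0.
- by rewrite counitM x0 mul0r.
case: Rx => [i|i|i j|i j|i j|i j|i j _|i j _].
- by rewrite counitMB1 !counit_fgen mulr1 subrr.
- by rewrite counitMB1 !counit_fgen mulr1 subrr.
- by rewrite counitMB !counit_fgen subrr.
- by rewrite counitMZB !counit_fgen mulr0 mul0r mulr0 subrr.
- by rewrite counitMZB !counit_fgen mulr0 mul0r mulr0 subrr.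
- rewrite counitB counitMB !counit_fgen mulr0 subrr sub0r.
  case: (i == j); last by rewrite counit0 oppr0.
  by rewrite counitZ counitB !counit_fgen subrr mulr0 oppr0.
- by apply: counit_Fij; rewrite counit_fgen.
- by apply: counit_Fij; rewrite counit_fgen.
Qed.

Fact Uq_1neq0 : Uq_pi 1 != 0.
Proof.
apply/eqP=> /Uq_piP/counit_ideal/eqP.
by rewrite subr0 counit1 oner_eq0.
Qed.

HB.instance Definition _ := GRing.Zmodule_isNzRing.Build Uq
  Uq_mulA Uq_mul1 Uq_mulr1 Uq_mulDl Uq_mulDr Uq_1neq0.

Fact Uq_scaleA a b x : Uq_scale a (Uq_scale b x) = Uq_scale (a * b) x.
Proof. by elim/Uq_ind: x => x; rewrite !Uq_scaleE scalerA. Qed.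

Fact Uq_scale1 : left_id 1 Uq_scale.
Proof. by elim/Uq_ind=> x; rewrite Uq_scaleE scale1r. Qed.

Fact Uq_scaleDr : right_distributive Uq_scale +%R.
Proof.
move=> a; elim/Uq_ind=> x; elim/Uq_ind=> y.
by rewrite /+%R /= !(Uq_addE, Uq_scaleE) scalerDr.
Qed.

Fact Uq_scaleDl x : {morph Uq_scale^~ x : a b / a + b}.
Proof.
elim/Uq_ind: x => x a b.
by rewrite [RHS]/+%R /= !(Uq_addE, Uq_scaleE) scalerDl.
Qed.

HB.instance Definition _ := GRing.Zmodule_isLmodule.Build F Uq
  Uq_scaleA Uq_scale1 Uq_scaleDr Uq_scaleDl.

Fact Uq_scaleAl (a : F) (x y : Uq) : a *: (x * y) = a *: x * y.
Proof.
elim/Uq_ind: x => x; elim/Uq_ind: y => y.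
by rewrite /*:%R /*%R /= !(Uq_mulE, Uq_scaleE) scalerAl.
Qed.

HB.instance Definition _ := GRing.Lmodule_isLalgebra.Build F Uq Uq_scaleAl.

Lemma freeA_scaleAr (a : F) (x y : freeA) : a *: (x * y) = x * (a *: y).
Proof.
suff xC : x * a%:MP = a *: x by rewrite -[a *: y]mul_malgC mulrA xC scalerAl.
rewrite malgM_def malgZ_def fgmulgU; apply: eq_bigr => k _.
by rewrite mulm1 mulrC.
Qed.

Fact Uq_scaleAr (a : F) (x y : Uq) : a *: (x * y) = x * (a *: y).
Proof.
elim/Uq_ind: x => x; elim/Uq_ind: y => y.
by rewrite /*:%R /*%R /= !(Uq_mulE, Uq_scaleE) freeA_scaleAr.
Qed.

HB.instance Definition _ := GRing.Lalgebra_isAlgebra.Build F Uq Uq_scaleAr.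

Fact Uq_pi_is_additive x y : Uq_pi (x - y) = Uq_pi x - Uq_pi y.
Proof. by symmetry; rewrite -[RHS]Uq_addE -Uq_oppE. Qed.

Fact Uq_pi_is_multiplicative :
  (forall x y, Uq_pi (x * y) = Uq_pi x * Uq_pi y) * (Uq_pi 1 = 1).
Proof. by split=> [x y|]; [symmetry; apply: Uq_mulE | reflexivity]. Qed.

Fact Uq_pi_is_scalable a x : Uq_pi (a *: x) = a *: Uq_pi x.
Proof. by symmetry; apply: Uq_scaleE. Qed.

HB.instance Definition _ :=
  GRing.isZmodMorphism.Build freeA Uq Uq_pi Uq_pi_is_additive.
HB.instance Definition _ := GRing.isMonoidMorphism.Build freeA Uq Uq_pi
  (Uq_pi_is_multiplicative.2, Uq_pi_is_multiplicative.1).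
HB.instance Definition _ :=
  GRing.isScalable.Build F freeA Uq *:%R Uq_pi Uq_pi_is_scalable.

Definition Ugen : gen n -> Uq := locked (fun g => Uq_pi (fgen g)).

Lemma UgenE g : Ugen g = Uq_pi (fgen g).
Proof. by rewrite /Ugen -lock. Qed.

(* The coproduct of a monomial in the generators, as the list of the terms
   x_(1) (x) x_(2), each of which is again a pair of monomials. *)
Definition coprod_gen (g : gen n) : seq (seq (gen n) * seq (gen n)) :=
  match g with
  | GE i => [:: ([:: GE i], [::]); ([:: GK i], [:: GE i])]
  | GF i => [:: ([:: GF i], [:: GKi i]); ([::], [:: GF i])]
  | GK i => [:: ([:: GK i], [:: GK i])]
  | GKi i => [:: ([:: GKi i], [:: GKi i])]
  end.

Definition coprod (w : seq (gen n)) : seq (seq (gen n) * seq (gen n)) :=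
  foldr (fun g t => [seq (x.1 ++ y.1, x.2 ++ y.2) | x <- coprod_gen g, y <- t])
        [:: ([::], [::])] w.

Definition antipode_gen (g : gen n) : Uq :=
  match g with
  | GE i => - (Ugen (GKi i) * Ugen (GE i))
  | GF i => - (Ugen (GF i) * Ugen (GK i))
  | GK i => Ugen (GKi i)
  | GKi i => Ugen (GK i)
  end.

Definition monomial (w : seq (gen n)) : Uq := \prod_(g <- w) Ugen g.
Definition antipode (w : seq (gen n)) : Uq := \prod_(g <- rev w) antipode_gen g.

(* ad(x)(u) = x_(1) u S(x_(2)) for x the monomial w *)
Definition ad (w : seq (gen n)) (u : Uq) : Uq :=
  \sum_(x <- coprod w) monomial x.1 * u * antipode x.2.

Local Notation E i := (Ugen (GE i)).
Local Notation F_ i := (Ugen (GF i)).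
Local Notation K i := (Ugen (GK i)).
Local Notation Ki i := (Ugen (GKi i)).

Definition Kpow i (m : int) : Uq :=
  match m with Posz k => K i ^+ k | Negz k => Ki i ^+ k.+1 end.

Definition Kmon (b : 'rV[int]_n) : Uq := \prod_i Kpow i (b 0 i).

(* The Q-grading of the presentation. It is not defined by the eigenvalues of
   the K_i, which do not separate weights when A is singular. *)
Inductive has_weight : 'rV[int]_n -> Uq -> Prop :=
| wt_E i : has_weight (simple i) (E i)
| wt_F i : has_weight (- simple i) (F_ i)
| wt_K i : has_weight 0 (K i)
| wt_Ki i : has_weight 0 (Ki i)
| wt_1 : has_weight 0 1
| wt_M a b u v : has_weight a u -> has_weight b v -> has_weight (a + b) (u * v)
| wt_0 a : has_weight a 0
| wt_D a u v : has_weight a u -> has_weight a v -> has_weight a (u + v)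
| wt_Z a (z : F) u : has_weight a u -> has_weight a (z *: u).

Definition divpow i (x : Uq) (r : nat) : Uq := (qfact (q_ i) r)^-1 *: x ^+ r.

(* The predicates is_omega, ..., is_Ad are meant for algebra endomorphisms:
   each of them then determines the map, the E_i, F_i, K_i and their inverses
   being generators. *)
Definition is_omega (f : Uq -> Uq) : Prop := forall i,
  [/\ f (E i) = - F_ i, f (F_ i) = - E i & f (K i) = Ki i].

Definition is_diagram_aut (tau : {perm 'I_n}) (f : Uq -> Uq) : Prop :=
  forall i, [/\ f (E i) = E (tau i), f (F_ i) = F_ (tau i)
              & f (K i) = K (tau i)].

Definition is_psi (f : Uq -> Uq) : Prop := forall i,
  [/\ f (E i) = E i * K i, f (F_ i) = Ki i * F_ i & f (K i) = K i].

(* Lusztig's T''_{i,1} *)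
Definition is_lusztig i (f : Uq -> Uq) : Prop :=
  [/\ f (E i) = - (F_ i * K i), f (F_ i) = - (Ki i * E i),
      forall b, f (Kmon b) = Kmon (refl A i b),
      forall j, j != i -> f (E j) =
        \sum_(r < `|A i j|.+1) ((-1) ^+ r * q_ i ^- r) *:
          (divpow i (E i) (`|A i j| - r) * E j * divpow i (E i) r)
    & forall j, j != i -> f (F_ j) =
        \sum_(r < `|A i j|.+1) ((-1) ^+ r * q_ i ^+ r) *:
          (divpow i (F_ i) r * F_ j * divpow i (F_ i) (`|A i j| - r))].

Definition is_Ad (s : 'rV[int]_n -> F) (f : Uq -> Uq) : Prop :=
  forall a u, has_weight a u -> f u = s a *: u.

Definition lusztig_word (T : 'I_n -> Uq -> Uq) (w : seq 'I_n) (u : Uq) : Uq :=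
  foldr T u w.

Definition theta_q (Ads : Uq -> Uq) (T : 'I_n -> Uq -> Uq) (wX : seq 'I_n)
    (psi tauU omega : Uq -> Uq) (u : Uq) : Uq :=
  Ads (lusztig_word T wX (psi (tauU (omega u)))).

Section Coideal.
Context (X : {set 'I_n}) (tau : {perm 'I_n}) (c s : 'I_n -> F).
Context (theta : Uq -> Uq).

Definition Bgen i : Uq :=
  if i \in X then F_ i
  else F_ i + c i *: (theta (F_ i * K i) * Ki i) + s i *: Ki i.

(* [Zp i] lists the indices j_1, ..., j_r of Z_i^+ = E_{j_1} ... E_{j_r}. *)
Definition Kolb_data (TwX : Uq -> Uq) (Zp : 'I_n -> seq 'I_n)
    (av v : 'I_n -> F) : Prop :=
  forall i, i \notin X ->
  [/\ {subset Zp i <= X},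
      TwX (E i) = av i *: ad (map (@GE n) (Zp i)) (E i),
      v i != 0
    & theta (F_ i * K i) =
        - (v i *: ad (map (@GE n) (Zp (tau i))) (E (tau i)))].

Definition calZ (Zp : 'I_n -> seq 'I_n) (v : 'I_n -> F) i : Uq :=
  - (v i *: (ad (map (@GE n) (Zp (tau i))) (K (tau i) ^+ 2)
             * Ki (tau i) * Ki i)).

End Coideal.

End QuantumGroup.

Section StructureConstants.
Context (F : fieldType).

(* alpha^(s,i)_{k,N} with p = q_i; a chain l_1 < ... < l_k is encoded by the
   set {l_1, ..., l_k}. *)
Definition alpha (p : F) (s k : nat) (N : int) : F :=
  if k == 0%N then 1
  else if k%:Z <= N + s%:Z then
    \sum_(L : {set 'I_`|N|.+1} | (#|L| == k) && [forall l in L, 1 - s <= l]%N)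
       \prod_(l in L) qnum p (2 * l + s) ^+ 2
  else 0.

(* The exponent (1 - a - m - m')/2, which is only used when it is an integer;
   otherwise the factor (a + m + m')_p of [rho] vanishes. *)
Definition halfexp (a : int) (m m' : nat) : nat :=
  `|ehalf (1 - a - m%:Z - m'%:Z)|%N.

Definition Theta0 (p : F) (a : int) (m m' : nat) : F :=
  let h := halfexp a m m' in
  \sum_(r < h.+1) qbinom p `|1 - a|%N (m + 2 * r)
     * alpha p 0 r (r%:Z + ehalf m + eparity m - 1)
     * alpha p `|eparity a|%N (h - r)
         (- ehalf a - eparity a - r%:Z - ehalf m - eparity m).

Definition Theta1 (p : F) (a : int) (m m' : nat) : F :=
  let h := halfexp a m m' in
  \sum_(r < h.+1) qbinom p `|1 - a|%N (m + 2 * r)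
     * alpha p 1 r (r%:Z + ehalf m - 1)
     * alpha p `|1 - eparity a|%N (h - r)
         (- ehalf a - r%:Z - ehalf m - 1).

(* [s = false] and [s = true] stand for s = 0 and s = 1. *)
Definition rho (s : bool) (p c : F) (a : int) (m m' : nat) : F :=
  (eparity (a + m%:Z + m'%:Z))%:~R * (-1) ^ (a + m%:Z)
  * (- (p * c)) ^+ halfexp a m m'
  * (if s then Theta1 p a m m' else Theta0 p a m m').

End StructureConstants.

(* Main.v *)
(* Left and right multiplication by B_i are commuting operators L and R, and
   kap = q_i c_i Z_i commutes with both.  With N = 1 - a, the recurrence
     D_{r+1} = (L - q_i^(1-N+2r) R) D_r - q_i^(2r-N) [r] [N-r] kap D_{r-1}
   gives D_N = F_ij(B_i, -) for kap = 0.  In general D_N is a product of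
   factors L^2 - (q_i^k + q_i^-k) L R + R^2 - [k]^2 kap (and L - R for N odd),
   and so is the alternating q-binomial sum of products of i-divided powers in
   L and in R, for either parity; expanding the latter shows that the theorem
   amounts to D_N(B_j) = 0.

   This is linear in B_j = F_j + W_j + s_j K_j^-1, where W_j is the part coming
   from theta_q.  As B_i = F_i + W_i + s_i K_i^-1 and F_i, W_i, K_i^-1 satisfy
   sl2-like relations in which kap is the central term, D_N collapses on F_j to
   the Serre polynomial in F_i and on W_j to the one in W_i; K_j^-1 is treated
   by induction on a, using the Casimir element of F_i, W_i, K_i^-1.

   That Z_i commutes with B_j rests on theta_q(F_j K_j) being a highest weight
   vector for the adjoint action of the E_l, l in X: its weight is the w_X-image
   of a lowest one.  That Z_i^+ is trivial exactly when i is in I_ns needs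
   E_i <> 0, which is seen on the irreducible module of highest weight rho. *)

Require Import Defs.
From HB Require Import structures.
From mathcomp Require Import all_boot all_order all_algebra perm.
From mathcomp Require Import fraction boolp functions monalg.
From mathcomp Require Import zify ring.

Set Implicit Arguments.
Unset Strict Implicit.
Unset Printing Implicit Defensive.

Import Order.TTheory GRing.Theory Num.Theory.
Local Open Scope ring_scope.

(** * Linear combinations *)

(** The coefficients of the recurrence are dictated by a lowest weight vector Y such as F_j:
    q_i^(1-N+2r) is the factor with which K_i^-1 passes D_r(Y), and the coefficient of kap is what
    remains when W_i is moved through r factors F_i. A highest weight vector such as W_j is reduced
    to this case by exchanging F_i with W_i and q_i with q_i^-1; of the D_r only D_N is invariant
    under the inversion, as its form through i-divided powers shows. K_j^-1 is of lowest type when i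
    is outside I_ns, since s_i K_i^-1 is then absent. For i in I_ns it is of neither type, and the
    evenness of a is what allows the descent from K_j^-1 to K_i^-1 K_j^-1, ending at N = 1. Two
    obstacles shape the part on theta_q. The word of Z_i^+ is arbitrary data and A may be singular,
    so weights can be recovered from eigenvalues of the K_l only up to combinations of roots in X,
    where the Cartan submatrix is invertible. And carrying the Serre relation of F_i and F_j over to
    W_i and W_j introduces twists by K_i and K_j, which are harmless only because (alpha_i, w_X
    alpha_tau(j)) = (alpha_j, w_X alpha_i). *)

Section LinearCombination.
Context (F : nzRingType) (V : lmodType F).

Inductive lexp :=
  LAtom of nat | LZero | LAdd of lexp & lexp | LOpp of lexp | LScale of F & lexp.

Fixpoint lval (env : seq V) e : V :=
  match e with
  | LAtom i => nth 0 env i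
  | LZero => 0
  | LAdd e1 e2 => lval env e1 + lval env e2
  | LOpp e1 => - lval env e1
  | LScale a e1 => a *: lval env e1
  end.

(** Indices are compared by [Nat.eqb] so that [cbn] alone turns the reflected goal into equations
    between coefficients. *)
Fixpoint lcoef e (i : nat) : F :=
  match e with
  | LAtom j => if Nat.eqb j i then 1 else 0
  | LZero => 0
  | LAdd e1 e2 => lcoef e1 i + lcoef e2 i
  | LOpp e1 => - lcoef e1 i
  | LScale a e1 => a * lcoef e1 i
  end.

Fixpoint lagree e1 e2 n : Prop :=
  if n is n'.+1 then lcoef e1 n' = lcoef e2 n' /\ lagree e1 e2 n' else True.

Lemma lvalE env e : lval env e = \sum_(i < size env) lcoef e i *: nth 0 env i.
Proof.
elim: e => /= [j||e1 -> e2 ->|e ->|a e ->].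
- have eqbE (i : nat) : Nat.eqb j i = (j == i) by apply/PeanoNat.Nat.eqb_spec/eqP.
  have [ltj|lej] := ltnP j (size env); last first.
    rewrite nth_default // big1 // => i _.
    by rewrite eqbE gtn_eqF ?scale0r // (leq_trans _ lej).
  rewrite (bigD1 (Ordinal ltj)) //= eqbE eqxx scale1r big1 ?addr0 // => i.
  by rewrite eqbE -val_eqE eq_sym /= => /negPf->; rewrite scale0r.
- by rewrite big1 // => i _; rewrite scale0r.
- by rewrite -big_split /=; apply: eq_bigr => i _; rewrite scalerDl.
- by rewrite -sumrN; apply: eq_bigr => i _; rewrite scaleNr.
- by rewrite scaler_sumr; apply: eq_bigr => i _; rewrite scalerA.
Qed.

Lemma lval_agree env e1 e2 : lagree e1 e2 (size env) -> lval env e1 = lval env e2.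
Proof.
move=> e12; rewrite !lvalE; apply: eq_bigr => i _; congr (_ *: _).
elim: (size env) i e12 => [[]//|n IHn] i [en e12]; case: (ltngtP i n) => lti.
- exact: (IHn (Ordinal lti)).
- by have := ltn_ord i; rewrite ltnS leqNgt lti.
- by rewrite lti.
Qed.

End LinearCombination.

(* Products are compared factor by factor, since equal products may be built
   from different but convertible ring structures. *)
Ltac lmod_eq x y :=
  match constr:(Datatypes.pair x y) with
  | _ => constr_eq x y
  | Datatypes.pair (GRing.mul ?a ?b) (GRing.mul ?c ?d) => lmod_eq a c; lmod_eq b d
  end.

Ltac lmod_index x env :=
  match env with
  | cons ?y ?env' =>
    match constr:(tt) with
    | _ => let _ := match constr:(tt) with _ => lmod_eq x y end in constr:(O)
    | _ => let k := lmod_index x env' in constr:(S k)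
    end
  end.

Ltac lmod_atoms t env :=
  match t with
  | GRing.add ?x ?y => let env1 := lmod_atoms x env in lmod_atoms y env1
  | GRing.opp ?x => lmod_atoms x env
  | GRing.scale _ ?x => lmod_atoms x env
  | GRing.zero => env
  | _ => match constr:(tt) with
         | _ => let _ := lmod_index t env in env
         | _ => constr:(cons t env)
         end
  end.

Ltac lmod_reify F t env :=
  match t with
  | GRing.add ?x ?y =>
    let e1 := lmod_reify F x env in let e2 := lmod_reify F y env in
    constr:(@LAdd F e1 e2)
  | GRing.opp ?x => let e1 := lmod_reify F x env in constr:(@LOpp F e1)
  | GRing.scale ?a ?x => let e1 := lmod_reify F x env in constr:(@LScale F a e1)
  | GRing.zero => constr:(@LZero F)
  | _ => let k := lmod_index t env in constr:(@LAtom F k)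
  end.

(* Reduces an equation between linear combinations of arbitrary atoms, over F
   in the F-module V, to the equations between their coefficients. *)
Ltac lmod F V :=
  match goal with
  | |- @eq _ ?x ?y =>
    let env0 := constr:(@nil V) in
    let env1 := lmod_atoms x env0 in
    let env := lmod_atoms y env1 in
    let e1 := lmod_reify F x env in
    let e2 := lmod_reify F y env in
    refine (@lval_agree F V env e1 e2 _);
    cbn [size lagree lcoef Nat.eqb]; repeat split
  end.

(** * The tridiagonal recurrence and its factorization *)

Section QNum.
Context (F : fieldType) (q : F).
Hypothesis q_neq0 : q != 0.
Hypothesis q_nroot : forall n, (0 < n)%N -> q ^+ n != 1.

Lemma qexp_neq0 n : q ^+ n != 0.
Proof. by rewrite expf_neq0. Qed.

Lemma qsqr_neq1 : q * q - 1 != 0.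
Proof. by rewrite subr_eq0 -expr2 q_nroot. Qed.

Lemma qsubV_neq0 : q - q^-1 != 0.
Proof.
apply: contra qsqr_neq1 => /eqP qV; apply/eqP.
have -> : q * q - 1 = q * (q - q^-1) by field.
by rewrite qV mulr0.
Qed.

Lemma qnum0 : qnum q 0 = 0.
Proof. by rewrite /qnum expr0 invr1 subrr mul0r. Qed.

Lemma qnum1 : qnum q 1 = 1.
Proof. by rewrite /qnum expr1 divff // qsubV_neq0. Qed.

Lemma qnum_neq0 n : (0 < n)%N -> qnum q n != 0.
Proof.
move=> n_gt0; rewrite mulf_neq0 ?invr_eq0 ?qsubV_neq0 // subr_eq0.
apply: contra (q_nroot (n := n + n) _); last by rewrite addn_gt0 n_gt0.
by move=> /eqP e; rewrite exprD {1}e mulVf // qexp_neq0.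
Qed.

Lemma qfactS n : qfact q n.+1 = qnum q n.+1 * qfact q n.
Proof. by rewrite /qfact big_nat_recr //= mulrC. Qed.

Lemma qfact0 : qfact q 0 = 1.
Proof. by rewrite /qfact big_geq. Qed.

Lemma qfact_neq0 n : qfact q n != 0.
Proof.
by elim: n => [|n IHn]; rewrite ?qfact0 ?oner_neq0 // qfactS mulf_neq0 ?qnum_neq0.
Qed.

Lemma qnumV n : qnum q^-1 n = qnum q n.
Proof.
rewrite /qnum invrK exprVn invrK -[q^-1 - q]opprB invrN mulrN -mulNr opprB //.
Qed.

Lemma qfactV n : qfact q^-1 n = qfact q n.
Proof. by apply: eq_bigr => i _; apply: qnumV. Qed.

Lemma qbinomV N m : qbinom q^-1 N m = qbinom q N m.
Proof. by rewrite /qbinom !qfactV. Qed.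

End QNum.

Section Chain.
Context (F : fieldType) (q : F).
Hypothesis q_neq0 : q != 0.
Hypothesis q_nroot : forall n, (0 < n)%N -> q ^+ n != 1.
Context (V : lmodType F) (L R Z : V -> V).
Hypotheses (linL : linear L) (linR : linear R) (linZ : linear Z).
Hypotheses (LR : forall y, L (R y) = R (L y)) (LZ : forall y, L (Z y) = Z (L y)).
Hypothesis RZ : forall y, R (Z y) = Z (R y).

HB.instance Definition _ := GRing.isLinear.Build F V V *:%R L linL.
HB.instance Definition _ := GRing.isLinear.Build F V V *:%R R linR.
HB.instance Definition _ := GRing.isLinear.Build F V V *:%R Z linZ.

Let LD x y : L (x + y) = L x + L y. Proof. exact: linearD. Qed.
Let LN x : L (- x) = - L x. Proof. exact: linearN. Qed.
Let LS a x : L (a *: x) = a *: L x. Proof. exact: linearZZ. Qed.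
Let L0 : L 0 = 0. Proof. exact: linear0. Qed.
Let RD x y : R (x + y) = R x + R y. Proof. exact: linearD. Qed.
Let RN x : R (- x) = - R x. Proof. exact: linearN. Qed.
Let RS a x : R (a *: x) = a *: R x. Proof. exact: linearZZ. Qed.
Let R0 : R 0 = 0. Proof. exact: linear0. Qed.
Let ZD x y : Z (x + y) = Z x + Z y. Proof. exact: linearD. Qed.
Let ZN x : Z (- x) = - Z x. Proof. exact: linearN. Qed.
Let ZS a x : Z (a *: x) = a *: Z x. Proof. exact: linearZZ. Qed.
Let Z0 : Z 0 = 0. Proof. exact: linear0. Qed.
Let linE := (LD, LN, LS, L0, RD, RN, RS, R0, ZD, ZN, ZS, Z0).
Let qq0 := qsqr_neq1 q_nroot.

(* [diag N r] is q^(1-N+2r) and [offdiag N r] is q^(2r-N) [r] [N-r], written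
   so that r may exceed N. *)
Definition diag N r : F := q * (q ^+ r) ^+ 2 / q ^+ N.
Definition offdiag N r : F :=
  (q ^+ r) ^+ 2 / q ^+ N * qnum q r
  * ((q ^+ N / q ^+ r - q ^+ r / q ^+ N) / (q - q^-1)).

Fixpoint chain_rec N r (y : V) : V :=
  if r is r1.+1 then
    L (chain_rec N r1 y) - diag N r1 *: R (chain_rec N r1 y)
    - offdiag N r1 *: (if r1 is r2.+1 then Z (chain_rec N r2 y) else 0)
  else y.

(** This is D_r, locked so that simplification does not unfold the recurrence. *)
Definition chain N r y := locked (chain_rec N r y).

Lemma chain0E N y : chain N 0 y = y.
Proof. by rewrite /chain -lock. Qed.

Lemma chain1E N y : chain N 1 y = L y - diag N 0 *: R y.
Proof. by rewrite /chain -lock /= scaler0 subr0. Qed.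

Lemma chainSS N r y :
  chain N r.+2 y = L (chain N r.+1 y) - diag N r.+1 *: R (chain N r.+1 y)
                   - offdiag N r.+1 *: Z (chain N r y).
Proof. by rewrite /chain -!lock. Qed.

Lemma chain_offdiag0 N r y :
  offdiag N r = 0 -> chain N r.+1 y = L (chain N r y) - diag N r *: R (chain N r y).
Proof.
by case: r => [|r] mu0; rewrite ?chain1E ?chain0E // chainSS mu0 scale0r subr0.
Qed.

Lemma chain_linear N r : linear (chain N r).
Proof.
move=> a x y; elim/ltn_ind: r => -[|[|r]] IHr; first by rewrite !chain0E.
  by rewrite !chain1E !linE; move: (diag _ _) => d; lmod F V; ring.
rewrite !chainSS !IHr // !linE.
by move: (diag _ _) (offdiag _ _) => d u; lmod F V; ring.
Qed.

Lemma L_chain N r y :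
  L (chain N r.+1 y) =
  chain N r.+2 y + diag N r.+1 *: R (chain N r.+1 y)
  + offdiag N r.+1 *: Z (chain N r y).
Proof. by rewrite chainSS; move: (diag _ _) (offdiag _ _) => d u; lmod F V; ring. Qed.

(** Comparison of the parameters N and N+2, used at r = N, where it lets a quadratic factor split
    off. The recurrence has three terms, hence two base cases. *)
Lemma chain_shift N r y :
  chain N.+2 r.+2 y = chain N r.+2 y
    + (q ^+ r.+1 / q ^+ N * (q - q^-1) * qnum q r.+2) *: R (chain N r.+1 y)
    - (q * (q ^+ r) ^+ 2 / (q ^+ N) ^+ 2 * qnum q r.+2 * qnum q r.+1)
        *: Z (chain N r y).
Proof.
have u0 : q ^+ N != 0 by rewrite expf_neq0.
elim/ltn_ind: r => -[|[|r]] IHr.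
- rewrite !(chainSS, chain1E, chain0E) !linE !LR /diag /offdiag /qnum !exprS expr0.
  by lmod F V; field; rewrite u0 q_neq0 qq0.
- rewrite !(chainSS, chain1E, chain0E) !linE !(LZ, RZ) !LR /diag /offdiag /qnum !exprS expr0.
  by lmod F V; field; rewrite u0 q_neq0 qq0.
- rewrite [LHS]chainSS !IHr // !linE !LR !LZ !L_chain !linE.
  rewrite !RZ /diag /offdiag /qnum !exprS.
  have t0 : q ^+ r != 0 by rewrite expf_neq0.
  by move: (q ^+ r) t0 (q ^+ N) u0 => t t0 u u0; lmod F V; field; rewrite ?u0 ?t0 ?q_neq0 ?qq0.
Qed.

(** For Z = 0 this is (L - q^k R)(L - q^-k R): the linear factors of the quantum Serre polynomial
    for r and N-1-r are paired. *)
Definition quad k (y : V) : V :=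
  L (L y) - (q ^+ k + q ^- k) *: R (L y) + R (R y) - qnum q k ^+ 2 *: Z y.

Lemma quad_linear k : linear (quad k).
Proof.
by move=> a x y; rewrite /quad !linE; lmod F V; ring.
Qed.

Fixpoint factored N (y : V) : V :=
  match N with
  | 0 => y
  | 1 => L y - R y
  | N1.+2 => quad N1.+1 (factored N1 y)
  end.

Lemma chain_factored N y : chain N N y = factored N y.
Proof.
elim/ltn_ind: N => -[|[|N]] IHN /=; first by rewrite chain0E.
  by rewrite chain1E /diag expr0 expr1 expr1n mulr1 mulfV // scale1r.
rewrite -IHN // chain_shift.
have t0 : q ^+ N != 0 by rewrite expf_neq0.
(* The factor [N-r] vanishes at r = N, so D_(N+1) is a linear factor applied to D_N, and the three
   terms of [chain_shift] combine into one quadratic factor. *)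
have mu0 : offdiag N N = 0 by rewrite /offdiag subrr mul0r mulr0.
have E1 := chain_offdiag0 y mu0.
rewrite chainSS E1 /quad !linE !LR /diag /offdiag /qnum !exprS.
by move: (q ^+ N) t0 => t t0; lmod F V; field; rewrite ?t0 ?q_neq0 ?qq0.
Qed.

End Chain.

(** * The polynomials of the i-divided powers *)

Section IDivided.
Context (F : fieldType) (q : F).
Hypothesis q_neq0 : q != 0.
Hypothesis q_nroot : forall n, (0 < n)%N -> q ^+ n != 1.
Context (V : lmodType F) (L R Z : V -> V).
Hypotheses (linL : linear L) (linR : linear R) (linZ : linear Z).
Hypotheses (LR : forall y, L (R y) = R (L y)) (LZ : forall y, L (Z y) = Z (L y)).
Hypothesis RZ : forall y, R (Z y) = Z (R y).

HB.instance Definition _ := GRing.isLinear.Build F V V *:%R L linL.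
HB.instance Definition _ := GRing.isLinear.Build F V V *:%R R linR.
HB.instance Definition _ := GRing.isLinear.Build F V V *:%R Z linZ.

Let LD x y : L (x + y) = L x + L y. Proof. exact: linearD. Qed.
Let LN x : L (- x) = - L x. Proof. exact: linearN. Qed.
Let LS a x : L (a *: x) = a *: L x. Proof. exact: linearZZ. Qed.
Let L0 : L 0 = 0. Proof. exact: linear0. Qed.
Let RD x y : R (x + y) = R x + R y. Proof. exact: linearD. Qed.
Let RN x : R (- x) = - R x. Proof. exact: linearN. Qed.
Let RS a x : R (a *: x) = a *: R x. Proof. exact: linearZZ. Qed.
Let R0 : R 0 = 0. Proof. exact: linear0. Qed.
Let ZD x y : Z (x + y) = Z x + Z y. Proof. exact: linearD. Qed.
Let ZN x : Z (- x) = - Z x. Proof. exact: linearN. Qed.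
Let ZS a x : Z (a *: x) = a *: Z x. Proof. exact: linearZZ. Qed.
Let Z0 : Z 0 = 0. Proof. exact: linear0. Qed.
Let linE := (LD, LN, LS, L0, RD, RN, RS, R0, ZD, ZN, ZS, Z0).
Let qq0 := qsqr_neq1 q_nroot.

Definition gap (s : bool) n : F := if odd n == s then qnum q n ^+ 2 else 0.

Lemma gap0 s : gap s 0 = 0.
Proof. by rewrite /gap qnum0 expr0n; case: ifP. Qed.

Lemma gap_gapS s n : gap s n * gap s n.-1 = 0.
Proof.
case: n => [|n]; first by rewrite gap0 mul0r.
by rewrite /gap /=; case: (odd n) s => -[] /=; rewrite ?mulr0 ?mul0r.
Qed.

(** [n]! times the n-th i-divided power: the product of f^2 - [k]^2 Z over the k of parity s with 0
    < k < n, times the power of f that completes the degree to n. *)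
Fixpoint ipow_rec (f : V -> V) s n v : V :=
  if n is n1.+1 then
    f (ipow_rec f s n1 v)
    - gap s n1 *: (if n1 is n2.+1 then Z (ipow_rec f s n2 v) else 0)
  else v.

Definition ipow f s n v := locked (ipow_rec f s n v).

Lemma ipow0 f s v : ipow f s 0 v = v.
Proof. by rewrite /ipow -lock. Qed.

Lemma ipowS f s n v :
  ipow f s n.+1 v = f (ipow f s n v) - gap s n *: Z (ipow f s n.-1 v).
Proof.
by rewrite /ipow -!lock; case: n => //=; rewrite gap0 !scale0r.
Qed.

Lemma op_ipow f s n v :
  f (ipow f s n v) = ipow f s n.+1 v + gap s n *: Z (ipow f s n.-1 v).
Proof. by rewrite ipowS subrK. Qed.

Lemma ipow_linear f s n : linear f -> linear (ipow f s n).
Proof.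
move=> linf a x y; elim/ltn_ind: n => -[|n] IHn; first by rewrite !ipow0.
rewrite !ipowS !IHn ?(leq_ltn_trans (leq_pred _)) // linf !linE.
by lmod F V; ring.
Qed.

Lemma ipow_comm (f g : V -> V) s n v :
  linear g -> (forall y, g (f y) = f (g y)) -> (forall y, g (Z y) = Z (g y)) ->
  g (ipow f s n v) = ipow f s n (g v).
Proof.
move=> ling gf gZ; have gS a x y : g (x - a *: y) = g x - a *: g y.
  by rewrite -!scaleNr [x + _]addrC ling addrC.
elim/ltn_ind: n => -[|n] IHn; first by rewrite !ipow0.
by rewrite !ipowS gS gf gZ !IHn // (leq_ltn_trans (leq_pred _)).
Qed.

(** When the [a+b]^2 of [quad] is compared with the squares produced by [gap], only a multiple of
    q^(a+b) + q^-(a+b) remains: the coefficient in [defect]. *)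
Lemma qnum_sqrD a b :
  qnum q (a + b) ^+ 2 = qnum q a ^+ 2 + qnum q b ^+ 2
    + (q ^+ (a + b) + q ^- (a + b)) * (qnum q a * qnum q b).
Proof.
have A0 : q ^+ a != 0 by rewrite expf_neq0.
have B0 : q ^+ b != 0 by rewrite expf_neq0.
rewrite /qnum exprD; move: (q ^+ a) (q ^+ b) A0 B0 => u v u0 v0.
by field; rewrite u0 v0 q_neq0 qq0.
Qed.

(** The coefficients of the three leading terms of [quad_dterm], collected on one common term, add
    up to the ratio of quantum factorials between N and N+2. *)
Lemma qnum_mulD a b :
  qnum q a * qnum q a.-1 + qnum q b * qnum q b.-1
    + (q ^+ (a + b).-1 + q ^- (a + b).-1) * (qnum q a * qnum q b)
  = qnum q (a + b) * qnum q (a + b).-1.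
Proof.
case: a => [|a]; first by rewrite (qnum0 q) !mul0r mulr0 addr0 add0r.
case: b => [|b]; first by rewrite (qnum0 q) !mul0r !mulr0 !addr0 addn0.
have A0 : q ^+ a != 0 by rewrite expf_neq0.
have B0 : q ^+ b != 0 by rewrite expf_neq0.
rewrite addnS addSn /= /qnum !exprS exprD.
move: (q ^+ a) (q ^+ b) A0 B0 => u v u0 v0.
by field; rewrite u0 v0 q_neq0 qq0.
Qed.

Let quad_lin k : linear (quad q L R Z k). Proof. exact: quad_linear. Qed.
HB.instance Definition _ k :=
  GRing.isLinear.Build F V V *:%R (quad q L R Z k) (quad_lin k).

Section Term.
Context (s : bool) (y : V).

Let term s' a b : V := ipow L s a (ipow R s' b y).

Definition dterm s' a b : V :=
  ((-1) ^+ b / (qfact q a * qfact q b)) *: ipow L s a (ipow R s' b y).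

Let L_term s' a b :
  L (term s' a b) = term s' a.+1 b + gap s a *: Z (term s' a.-1 b).
Proof. exact: op_ipow. Qed.

Let R_term s' a b :
  R (term s' a b) = term s' a b.+1 + gap s' b *: Z (term s' a b.-1).
Proof.
rewrite /term ipow_comm // op_ipow [X in ipow _ _ _ X]addrC.
by rewrite ipow_linear // addrC -(ipow_comm (g := Z)).
Qed.

Definition divided N : V :=
  \sum_(a < N.+1) ((-1) ^+ (N - a) * qbinom q N a)
     *: ipow L s a (ipow R (s (+) ~~ odd N) (N - a) y).

(** The Z-term left by [quad] on a single summand is a difference of consecutive values of this
    quantity. It vanishes at both ends of the summation, so the Z-terms telescope away. *)
Definition defect N a : V :=
  if odd a == s then
    ((q ^+ N.+1 + q ^- N.+1) * qnum q a * qnum q (N.+1 - a))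
      *: (dterm (s (+) ~~ odd N) a (N - a)
          - dterm (s (+) ~~ odd N) a.-1 (N.+1 - a))
  else 0.

Lemma quad_dterm a b (s' := s (+) ~~ odd (a + b)) :
  quad q L R Z (a + b).+1 (dterm s' a b) =
  (qnum q a.+1 * qnum q a.+2) *: dterm s' a.+2 b
  + (qnum q b.+1 * qnum q b.+2) *: dterm s' a b.+2
  + ((q ^+ (a + b).+1 + q ^- (a + b).+1) * (qnum q a.+1 * qnum q b.+1))
      *: dterm s' a.+1 b.+1
  + Z (defect (a + b) a.+1 - defect (a + b) a).
Proof.
have n0 n : qnum q n.+1 != 0 by apply: qnum_neq0.
have f0 n : qfact q n != 0 by apply: qfact_neq0.
have A0 : q ^+ a != 0 by rewrite expf_neq0.
have B0 : q ^+ b != 0 by rewrite expf_neq0.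
rewrite /quad /defect /= !subSS -/s'.
have -> : (a + b - a = b)%N by rewrite addKn.
have -> : ((a + b).+1 - a = b.+1)%N by rewrite -addnS addKn.
have -> : (a + b - a.+1 = b.-1)%N by rewrite subnS addKn.
rewrite /dterm -!/(term _ _ _) !LS !RS.
(* The parity s' is such that the gaps contribute either at a and b+1 or at a+1 and b; in both cases
   the arguments of the two squares add up to a+b+1. *)
have [sa|sa] := eqVneq (odd a) s.
- have eN : (~~ odd a == s) = false by rewrite -sa; case: (odd a).
  have gaS : gap s a.+1 = 0 by rewrite /gap /= eN.
  have ga : gap s a = qnum q a ^+ 2 by rewrite /gap sa eqxx.
  have gb : gap s' b = 0 by rewrite /gap /s' oddD -sa; case: (odd a) (odd b) => -[].
  have gbS : gap s' b.+1 = qnum q b.+1 ^+ 2.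
    by rewrite /gap /s' /= oddD -sa; case: (odd a) (odd b) => -[].
  have := qnum_sqrD a b.+1; rewrite addnS.
  move: (q ^+ _ + _) (qnum q (a + b).+1) => th nab key.
  rewrite eN !(L_term, R_term) !linE !R_term ?gaS ?gb ?gbS ?ga !(LZ, RZ) ?L_term ?R_term ?linE ?gaS ?gb ?gbS ?ga.
  rewrite key !(qfactS q) !exprS /= {key gaS ga gb gbS}; clearbody s'; move: (term s') => t.
  move: ((-1) ^+ b) (qfact q b) (f0 b) (n0 b) (n0 b.+1) => e fb fb0 nb nb1.
  have := gap_gapS s a.
  case: a sa A0 {eN} => [|a] sa A0 /=; rewrite ?gap0 ?(qnum0 q) ?(qfactS q) ?qfact0 => ga.
    have := n0 0; have := n0 1.
    move: (qnum q 1) (qnum q 2) (qnum q b.+1) (qnum q b.+2) nb nb1 => n1 n2 m1 m2 nb nb1 n20 n10.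
    by lmod F V; field; rewrite ?n10 ?n20 ?nb ?nb1 ?fb0.
  have ga0 : gap s a = 0 by rewrite /gap -sa /=; case: (odd a).
  rewrite ga0.
  move: (qfact q a) (f0 a) (n0 a) (n0 a.+1) (n0 a.+2) => fa fa0.
  move: (qnum q a.+1) (qnum q a.+2) (qnum q a.+3) (qnum q b.+1) (qnum q b.+2) nb nb1.
  move=> n1 n2 n3 m1 m2 nb nb1 n10 n20 n30.
  by lmod F V; field; rewrite ?n10 ?n20 ?n30 ?nb ?nb1 ?fb0 ?fa0.
- have eN : (~~ odd a == s) by move: sa; case: (odd a) (s) => -[].
  have gaS : gap s a.+1 = qnum q a.+1 ^+ 2 by rewrite /gap /= eN.
  have ga : gap s a = 0 by rewrite /gap (negPf sa).
  have e' : s' = odd b by move: sa; rewrite /s' oddD; case: (odd a) (s) (odd b) => -[] [].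
  have gb : gap s' b = qnum q b ^+ 2 by rewrite /gap e' eqxx.
  have gbS : gap s' b.+1 = 0 by rewrite /gap /= e'; case: (odd b).
  have := qnum_sqrD a.+1 b; rewrite addSn.
  move: (q ^+ _ + _) (qnum q (a + b).+1) => th nab key.
  rewrite eN !(L_term, R_term) !linE !R_term ?gaS ?gb ?gbS ?ga !(LZ, RZ) ?L_term ?R_term ?linE ?gaS ?gb ?gbS ?ga.
  rewrite key !(qfactS q) !exprS /= {key gaS ga gb gbS}; clearbody s'; move: (term s') => t.
  move: (qfact q a) (f0 a) (n0 a) (n0 a.+1) => fa fa0 na na1.
  case: b B0 e' => [|b] B0 e' /=; rewrite ?(qnum0 q) ?(qfactS q) ?qfact0 ?exprS.
    have := n0 0; have := n0 1; move: ((-1) ^+ 0) => e.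
    move: (qnum q 1) (qnum q 2) (qnum q a.+1) (qnum q a.+2) na na1 => n1 n2 m1 m2 na na1 n20 n10.
    by lmod F V; field; rewrite ?n10 ?n20 ?na ?na1 ?fa0.
  have gb0 : gap s' b = 0 by rewrite /gap e' /=; case: (odd b).
  rewrite gb0; move: ((-1) ^+ b) (qfact q b) (f0 b) (n0 b) (n0 b.+1) (n0 b.+2) => e fb fb0.
  move: (qnum q b.+1) (qnum q b.+2) (qnum q b.+3) (qnum q a.+1) (qnum q a.+2) na na1.
  move=> n1 n2 n3 m1 m2 na na1 n10 n20 n30.
  by lmod F V; field; rewrite ?n10 ?n20 ?n30 ?na ?na1 ?fb0 ?fa0.
Qed.

Lemma defect0 N : defect N 0 = 0.
Proof. by rewrite /defect; case: ifP => // _; rewrite qnum0 mulr0 mul0r scale0r. Qed.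

Lemma defect_max N : defect N N.+1 = 0.
Proof. by rewrite /defect; case: ifP => // _; rewrite subnn qnum0 mulr0 scale0r. Qed.

Lemma dividedE N :
  divided N = qfact q N *: \sum_(0 <= a < N.+1) dterm (s (+) ~~ odd N) a (N - a).
Proof.
rewrite big_mkord scaler_sumr; apply: eq_bigr => a _.
rewrite /dterm scalerA; congr (_ *: _).
by rewrite /qbinom mulrCA mulrA mulrC.
Qed.

Lemma quad_divided N : quad q L R Z N.+1 (divided N) = divided N.+2.
Proof.
have [n0 [n00 fS]] : (forall n, qnum q n.+1 != 0) /\ qnum q 0 = 0 /\
    forall n, qfact q n.+1 = qnum q n.+1 * qfact q n.
  by split=> [n|]; [apply: qnum_neq0 | split; [apply: qnum0 | apply: qfactS]].
rewrite !dividedE linearZZ linear_sum /= negbK; set s' := s (+) ~~ odd N.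
have quadE a : (0 <= a < N.+1)%N -> quad q L R Z N.+1 (dterm s' a (N - a)) =
    (qnum q a.+1 * qnum q a.+2) *: dterm s' a.+2 (N - a)
    + (qnum q (N - a).+1 * qnum q (N - a).+2) *: dterm s' a (N - a).+2
    + ((q ^+ N.+1 + q ^- N.+1) * (qnum q a.+1 * qnum q (N - a).+1))
        *: dterm s' a.+1 (N - a).+1
    + Z (defect N a.+1 - defect N a).
  rewrite ltnS /= => aN; have := quad_dterm a (N - a).
  by rewrite subnKC.
rewrite (eq_big_nat _ _ quadE) !big_split /= -linear_sum telescope_sumr // {quadE}.
rewrite defect_max defect0 subrr linear0 addr0 2!fS.
set S := (X in qfact q N *: X).
suff -> : S = (qnum q N.+2 * qnum q N.+1) *: \sum_(0 <= a < N.+3) dterm s' a (N.+2 - a).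
  by rewrite scalerA; congr (_ *: _); ring.
have -> : S =
    \sum_(0 <= a < N.+3) (qnum q a * qnum q a.-1) *: dterm s' a (N.+2 - a)
  + \sum_(0 <= a < N.+3) (qnum q (N.+2 - a) * qnum q (N.+2 - a).-1)
      *: dterm s' a (N.+2 - a)
  + \sum_(0 <= a < N.+3) ((q ^+ N.+1 + q ^- N.+1) * (qnum q a * qnum q (N.+2 - a)))
      *: dterm s' a (N.+2 - a).
  congr (_ + _ + _).
  - rewrite 2?[in RHS]big_nat_recl // n00 ?mulr0 ?mul0r !scale0r !add0r.
    by apply: eq_bigr => a _; rewrite mulrC !subSS.
  - rewrite 2?[in RHS]big_nat_recr //= subnn subSnn n00 ?mulr0 ?mul0r !scale0r !addr0.
    by apply: eq_big_nat => a /andP[_ aN]; rewrite mulrC !subSn // ltnW.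
  - rewrite [in RHS]big_nat_recl // [in RHS]big_nat_recr //= subSS subnn n00 ?mul0r ?mulr0 ?mulr0.
    rewrite !scale0r addr0 add0r.
    by apply: eq_big_nat => a /andP[_ aN]; rewrite subSS subSn.
rewrite scaler_sumr -!big_split /=; apply: eq_big_nat => a /andP[_ aN].
rewrite -!scalerDl; congr (_ *: _).
have := qnum_mulD a (N.+2 - a); rewrite subnKC //= => <-.
Qed.

(** Since the product of factors does not involve s, the two parities give the same polynomial,
    which is the source of the two forms of the structure constants. *)
Lemma divided_factored N : divided N = factored q L R Z N y.
Proof.
have b1 : qbinom q 1 0 = 1 /\ qbinom q 1 1 = 1.
  by rewrite /qbinom !qfactS !qfact0 !qnum1 // !mulr1 divff // oner_neq0.
elim/ltn_ind: N => -[|[|N]] IHN /=; last by rewrite -IHN // quad_divided.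
  have b0 : qbinom q 0 0 = 1 by rewrite /qbinom qfact0 mulr1 divff ?oner_neq0.
  by rewrite /divided big_ord1 /= !ipow0 b0 expr0 mulr1 scale1r.
rewrite /divided 2!big_ord_recl big_ord0 /= !ipowS !ipow0 b1.1 b1.2 !gap0 !scale0r.
by rewrite !subr0 !mulr1 expr1 expr0 scaleN1r scale1r addr0 addrC.
Qed.

End Term.
End IDivided.

(** * Elementary symmetric functions and the structure constants *)

Section Reindexing.
Context (V : nmodType).

Lemma sum_even (K : nat) (T : nat -> V) :
  \sum_(j < K.+1) (if odd j then 0 else T j./2) = \sum_(h < K./2.+1) T h.
Proof.
elim: K => [|K IHK]; first by rewrite !big_ord1.
rewrite big_ord_recr IHK /= uphalf_half; case oK: (odd K); last by rewrite addr0.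
by rewrite add1n [in RHS]big_ord_recr.
Qed.

Lemma sum_triangle (D : nat) (H : nat -> nat -> V) :
  \sum_(r < D.+1) \sum_(r' < (D - r).+1) H r r' =
  \sum_(h < D.+1) \sum_(r < h.+1) H r (h - r)%N.
Proof.
elim: D => [|D IHD]; first by rewrite !big_ord1.
rewrite [RHS]big_ord_recr -IHD big_ord_recr /= subnn big_ord1.
rewrite [X in _ = _ + X]big_ord_recr /= subnn addrA; congr (_ + _).
rewrite -big_split /=; apply: eq_bigr => r _.
by rewrite subSn ?big_ord_recr // -ltnS.
Qed.

Lemma sum_shift (N : nat) (g : nat -> nat -> V) :
  \sum_(n < N.+1) \sum_(r < n./2.+1) g n r =
  \sum_(m < N.+1) \sum_(r < (N - m)./2.+1) g (m + 2 * r)%N r.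
Proof.
rewrite [RHS](reindex_inj rev_ord_inj) /=.
under [RHS]eq_bigr => j _ do rewrite subSS subKn -1?ltnS //.
elim: N => [|N IHN]; first by rewrite !big_ord1.
rewrite big_ord_recr IHN /= -(sum_even N.+1 (fun r => g N.+1 r)).
rewrite [RHS]big_ord_recl [X in _ + X = _]big_ord_recl /= big_ord1 addrCA muln0 addn0.
congr (_ + _); rewrite -big_split /=.
apply: eq_bigr => m _; rewrite /bump /= add1n subSS uphalf_half.
case om: (odd m) => /=; last by rewrite addr0.
rewrite add0n [RHS]big_ord_recr /=; congr (_ + g _ _).
have := odd_double_half m; rewrite om => /= em.
by have := ltn_ord m; lia.
Qed.

End Reindexing.

Section Expansion.
Context (F : fieldType) (q : F).
Hypothesis q_neq0 : q != 0.
Hypothesis q_nroot : forall n, (0 < n)%N -> q ^+ n != 1.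

(* The squares [2l+s]^2 are numbered from 0, the l-th one being [node s l]. *)
Definition node (s : bool) l := (l.*2.+1 + ~~ s)%N.

(** The generating polynomial gives the recurrence in c at once and, by distributivity, the sum over
    chains that defines [alpha]. *)
Definition elem_sym (s : bool) k c : F :=
  (\prod_(l < c) (1 + (qnum q (node s l) ^+ 2) *: 'X : {poly F}))`_k.

Lemma elem_sym0 s c : elem_sym s 0 c = 1.
Proof.
elim: c => [|c IHc]; first by rewrite /elem_sym big_ord0 coef1.
by rewrite /elem_sym big_ord_recr /= mulrDr mulr1 -scalerAr coefD coefZ coefMX mulr0 addr0.
Qed.

Lemma elem_symS s k c :
  elem_sym s k.+1 c.+1 = elem_sym s k.+1 c + qnum q (node s c) ^+ 2 * elem_sym s k c.
Proof.
by rewrite /elem_sym big_ord_recr /= mulrDr mulr1 -scalerAr coefD coefZ coefMX.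
Qed.

Lemma elem_sym_gt s k c : (c < k)%N -> elem_sym s k c = 0.
Proof.
elim: c k => [|c IHc] [|k] // lck; first by rewrite /elem_sym big_ord0 coef1.
by rewrite elem_symS !IHc ?mulr0 ?addr0 // ltnW.
Qed.

Lemma alphaE (s : bool) k c : alpha q s k (c%:Z - s%:Z) = elem_sym s k c.
Proof.
rewrite /alpha; case: k => [|k] /=; first by rewrite elem_sym0.
rewrite subrK; case: ifP => lekc; last first.
  by rewrite elem_sym_gt // ltnNge; move: lekc; rewrite lez_nat => ->.
rewrite lez_nat in lekc.
(* As 0 < k <= c, also s <= c, so the upper bound c - s of the chains is a natural number. *)
have [N cE] : exists N, c = (N + s)%N.
  by exists (c - s)%N; rewrite subnK //; case: (s) => //; apply: leq_trans lekc.
have -> : (`|c%:Z - s%:Z|)%N = N by rewrite cE PoszD addrK.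
(* For s = 0 the index l = 0 is excluded from the chains; giving it the value 0 lets the product run
   over the whole range. *)
pose y (l : 'I_N.+1) := if (1 - s <= l)%N then qnum q (2 * l + s) ^+ 2 else 0.
have -> : elem_sym s k.+1 c = (\prod_(l < N.+1) (y l *: 'X + 1 : {poly F}))`_k.+1.
  rewrite /elem_sym; congr (polyseq _)`_ _; rewrite cE /y; case: (s) => /=.
    rewrite addn1; apply: eq_bigr => l _.
    by rewrite addrC /node addn0 mul2n addn1.
  rewrite addn0 big_ord_recl /= scale0r add0r mul1r; apply: eq_bigr => l _.
  by rewrite addrC /node /bump /= mul2n addn0 addn1.
rewrite (bigA_distr 1 _ (fun l => y l *: 'X)) coef_sum.
have coefJ (J : {set 'I_N.+1}) :
    (\prod_l (if l \in J then y l *: 'X else 1 : {poly F}))`_k.+1 =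
    if #|J| == k.+1 then \prod_(l in J) y l else 0.
  rewrite -big_mkcond /= scaler_prod prodr_const coefZ coefXn eq_sym.
  by case: ifP => _; rewrite ?mulr1 ?mulr0.
under [RHS]eq_bigr do rewrite coefJ.
rewrite -big_mkcond /= [RHS](bigID (fun J : {set 'I_N.+1} => [forall l in J, 1 - s <= l]%N)) /=.
rewrite [X in _ + X]big1 ?addr0 => [|J /andP[_ /forall_inPn[l lJ nl]]]; last first.
  by rewrite (bigD1 l) //= /y (negPf nl) mul0r.
apply: eq_bigr => J /andP[_ /forall_inP Js]; apply: eq_bigr => l lJ.
by rewrite /y Js.
Qed.

End Expansion.

(** The number of quadratic factors f^2 - [k]^2 Z in [ipow]. *)
Definition npairs (s : bool) n := (n - ~~ s)./2.

Lemma npairs_gap s n : (0 < n)%N -> odd n = s ->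
  [/\ npairs s n.+1 = (npairs s n).+1, npairs s n.-1 = npairs s n
    & node s (npairs s n) = n].
Proof.
case: n => // n _ <-; rewrite /npairs /node /=.
have := odd_double_half n; case on: (odd n) => /= en.
  by rewrite uphalf_half on !subn1 /=; split=> //; rewrite -?doubleS; lia.
by rewrite !subn0 uphalf_half on; split=> //=; lia.
Qed.

Lemma npairs_nogap s n : (n == 0)%N || (odd n != s) ->
  npairs s n.+1 = npairs s n /\ ((npairs s n).*2 <= n)%N.
Proof.
case: n => [_|n]; first by rewrite /npairs; case: s.
rewrite /npairs /=; have := odd_double_half n.
by case: s; case on: (odd n) => //= en; rewrite ?subn0 ?subn1 /= ?uphalf_half ?on; split; lia.
Qed.

Lemma npairs_le s n : ((npairs s n).*2 <= n)%N.
Proof. by rewrite /npairs; have := odd_double_half (n - ~~ s); lia. Qed.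

Section StructureSum.
Context (F : fieldType) (q : F) (V : lmodType F).

Context (Z : V -> V) (linZ : linear Z).

Lemma linear_iter (f : V -> V) k : linear f -> linear (iter k f).
Proof. by move=> linf; elim: k => //= k IHk a x y; rewrite -linf -IHk. Qed.

Lemma iter_comm (f g : V -> V) k v :
  (forall y, g (f y) = f (g y)) -> g (iter k f v) = iter k f (g v).
Proof. by move=> gf; elim: k => //= k IHk; rewrite gf IHk. Qed.

Lemma linear0E (f : V -> V) : linear f -> f 0 = 0.
Proof.
move=> /(_ 1 0 0); rewrite !scale1r addr0 => /(congr1 (fun x => x - f 0)).
by rewrite subrr addrK.
Qed.

Lemma linear_sumE (f : V -> V) (I : Type) (r : seq I) (P : pred I) (G : I -> V) :
  linear f -> f (\sum_(i <- r | P i) G i) = \sum_(i <- r | P i) f (G i).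
Proof.
move=> linf; have f0 := linear0E linf.
by apply: big_morph => // x y; have := linf 1 x y; rewrite !scale1r.
Qed.

Lemma linear_scaleE (f : V -> V) a v : linear f -> f (a *: v) = a *: f v.
Proof.
move=> linf; have f0 := linear0E linf.
by have := linf a v 0; rewrite f0 !addr0.
Qed.

(** The bound M is left free because the induction uses the expansions at n and n-1 with different
    ranges. The terms with 2r > n vanish, which makes the truncated subtraction harmless. *)
Lemma ipow_expand (f : V -> V) s n v M :
  linear f -> (forall y, f (Z y) = Z (f y)) -> (n < M)%N ->
  ipow q Z f s n v =
  \sum_(r < M) ((-1) ^+ r * elem_sym q s r (npairs s n))
     *: iter r Z (iter (n - 2 * r) f v).
Proof.
move=> linf fZ; elim/ltn_ind: n M => -[|n] IHn [|M] // nM.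
  rewrite ipow0 big_ord_recl elem_sym0 !mulr1 scale1r big1 ?addr0 // => r _.
  by rewrite elem_sym_gt ?mulr0 ?scale0r // /npairs sub0n.
have fE m M' (k : nat) : (npairs s m == k)%N ->
    f (\sum_(r < M') ((-1) ^+ r * elem_sym q s r k) *: iter r Z (iter (m - 2 * r) f v))
    = \sum_(r < M') ((-1) ^+ r * elem_sym q s r k) *: iter r Z (iter (m.+1 - 2 * r) f v).
  move=> /eqP mk; rewrite linear_sumE //; apply: eq_bigr => r _.
  rewrite linear_scaleE // iter_comm //.
  have [ler|ltr] := leqP (2 * r)%N m; first by rewrite -iterS subSn.
  by rewrite elem_sym_gt ?mulr0 ?scale0r // -mk; have := npairs_le s m; lia.
rewrite ipowS (IHn n _ M.+1) // ?(ltnW nM) // fE //.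
have [nn|] := boolP ((n == 0)%N || (odd n != s)).
  have -> : gap q s n = 0.
    by move: nn; case: (n) => [|m] /=; [rewrite gap0 | rewrite /gap /= => /negPf->].
  by rewrite scale0r subr0; have [-> _] := npairs_nogap nn.
rewrite negb_or negbK -lt0n => /andP[n_gt0 /eqP sn].
have [nS nP nE] := npairs_gap n_gt0 sn.
rewrite (IHn n.-1 _ M); [|by lia..].
rewrite nS nP big_ord_recl [in RHS]big_ord_recl !elem_sym0 -addrA; congr (_ + _).
rewrite linear_sumE // scaler_sumr -sumrB; apply: eq_bigr => r _.
rewrite (linear_scaleE _ _ linZ) !lift0 elem_symS nE /gap sn eqxx exprS.
have -> : (n.+1 - 2 * r.+1 = n.-1 - 2 * r)%N by lia.
by rewrite -(iterS r Z); lmod F V; ring.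
Qed.

Lemma ipow_expand_half (f : V -> V) s n v :
  linear f -> (forall y, f (Z y) = Z (f y)) ->
  ipow q Z f s n v =
  \sum_(r < n./2.+1) ((-1) ^+ r * elem_sym q s r (npairs s n))
     *: iter r Z (iter (n - 2 * r) f v).
Proof.
move=> linf fZ; rewrite (ipow_expand _ _ linf fZ (ltnSn n)).
pose G r := ((-1) ^+ r * elem_sym q s r (npairs s n)) *: iter r Z (iter (n - 2 * r) f v).
have wid : (n./2.+1 <= n.+1)%N by rewrite -divn2; lia.
rewrite [RHS](big_ord_widen _ G wid).
rewrite [LHS](bigID (fun r : 'I_n.+1 => (r < n./2.+1)%N)) /= [X in _ + X]big1 ?addr0 // => r.
by rewrite -leqNgt => nr; rewrite elem_sym_gt ?mulr0 ?scale0r //; have := npairs_le s n; rewrite -divn2 in nr; lia.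
Qed.

(** Theta^(s) for N = 1 - a, written with natural numbers: the two symmetric functions are
    coefficients of the i-divided polynomials of degree m+2r in L and N-m-2r in R. *)
Definition structure_sum (s : bool) N m h : F :=
  \sum_(r < h.+1) qbinom q N (m + 2 * r) * elem_sym q s r (npairs s (m + 2 * r))
    * elem_sym q (s (+) ~~ odd N) (h - r) (npairs (s (+) ~~ odd N) (N - (m + 2 * r))).

Lemma divided_expand (L R : V -> V) s y N :
  linear L -> linear R -> (forall y, L (Z y) = Z (L y)) ->
  (forall y, R (Z y) = Z (R y)) ->
  divided q L R Z s y N =
  \sum_(m < N.+1) \sum_(m' < (N - m).+1)
    if odd (N - m - m') then 0 else
    ((-1) ^+ (N - m) * (-1) ^+ (N - m - m')./2
       * structure_sum s N m (N - m - m')./2)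
     *: iter (N - m - m')./2 Z (iter m L (iter m' R y)).
Proof.
move=> linL linR LZ RZ; set s' := s (+) ~~ odd N.
pose c n r r' := (-1) ^+ (N - n) * (-1) ^+ (r + r') *
  (qbinom q N n * elem_sym q s r (npairs s n) * elem_sym q s' r' (npairs s' (N - n))).
pose g n r := \sum_(r' < (N - n)./2.+1) c n r r'
     *: iter (r + r') Z (iter (n - 2 * r) L (iter (N - n - 2 * r') R y)).
have -> : divided q L R Z s y N = \sum_(n < N.+1) \sum_(r < n./2.+1) g n r.
  apply: eq_bigr => n _; rewrite ipow_expand_half // scaler_sumr.
  apply: eq_bigr => r _; rewrite -/s' (ipow_expand_half _ _ _ linR RZ).
  rewrite (linear_sumE _ _ _ (linear_iter _ linL)) (linear_sumE _ _ _ (linear_iter _ linZ)).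
  rewrite !scaler_sumr; apply: eq_bigr => r' _.
  rewrite (linear_scaleE _ _ (linear_iter _ linL)) (linear_scaleE _ _ (linear_iter _ linZ)).
  have ZL x : iter (n - 2 * r) L (iter r' Z x) = iter r' Z (iter (n - 2 * r) L x).
    by apply: iter_comm => z; rewrite -iter_comm.
  by rewrite ZL iterD /c exprD !scalerA; congr (_ *: _); ring.
(* Here m = n - 2r is the exponent of L. For fixed m, the sum over r and r' is regrouped by the
   exponent h = r + r' of Z, and N - m - 2h is the exponent of R. *)
rewrite (sum_shift _ g); apply: eq_bigr => m _.
set D := (N - m)./2.
pose H r r' := c (m + 2 * r)%N r r'
   *: iter (r + r') Z (iter m L (iter (N - m - 2 * (r + r')) R y)).
transitivity (\sum_(r < D.+1) \sum_(r' < (D - r).+1) H r r').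
  apply: eq_bigr => r _; rewrite /g; have -> : ((N - (m + 2 * r))./2 = D - r)%N by rewrite /D -!divn2; lia.
  apply: eq_bigr => r' _; rewrite /H addnK; congr (_ *: iter _ _ (iter _ _ (iter _ _ _))).
  by lia.
rewrite sum_triangle -(sum_even (N - m) (fun h => \sum_(r < h.+1) H r (h - r)%N)).
rewrite (reindex_inj rev_ord_inj); apply: eq_bigr => m' _.
rewrite /= subSS; case: ifP => // /negbT oj; rewrite /structure_sum -/s' mulr_sumr scaler_suml.
apply: eq_bigr => r _; rewrite /H /c subnKC -1?ltnS //.
have mm' := ltn_ord m'; have mN := ltn_ord m.
have -> : (N - m - 2 * (N - m - m')./2 = m')%N.
  have := odd_double_half (N - m - m'); rewrite (negPf oj); lia.
congr (_ *: _); congr (_ * _ * _).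
have NmE : (N - m = N - (m + 2 * r) + 2 * r)%N.
  by have := ltn_ord r; have := odd_double_half (N - m - m'); move: (nat_of_ord r) => r1; lia.
by rewrite [in RHS]NmE exprD exprM sqrrN expr1n expr1n mulr1.
Qed.

End StructureSum.

Section StructureConstants.
Context (F : fieldType) (q : F).
Hypothesis q_neq0 : q != 0.
Hypothesis q_nroot : forall n, (0 < n)%N -> q ^+ n != 1.

(* The two forms of the sum have the same generating polynomial; it is read off
   in one variable, with 'X for L and 'X^(N+1) for R. *)
Lemma structure_sum_indep (N m m' : nat) :
  (m + m' <= N)%N -> ~~ odd (N - m - m') ->
  structure_sum q true N m (N - m - m')./2 = structure_sum q false N m (N - m - m')./2.
Proof.
move=> mm'N odd_mm'; pose L (p : {poly F}) := 'X * p; pose R (p : {poly F}) := 'X^(N.+1) * p.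
have linL : linear L by move=> a x y; rewrite /L mulrDr scalerAr.
have linR : linear R by move=> a x y; rewrite /R mulrDr scalerAr.
(* Z may be the identity, as its exponent is determined by those of L and R. The latter are at most
   N and are recovered from m + (N+1) m' as digits in base N+1. *)
have linZ : linear (id : {poly F} -> {poly F}) by [].
have LR y : L (R y) = R (L y) by rewrite /L /R mulrCA.
have dE s := divided_expand q linZ s 1 N linL linR (fun=> erefl) (fun=> erefl).
have : divided q L R id true 1 N = divided q L R id false 1 N.
  by rewrite !divided_factored.
rewrite !dE => /(congr1 (fun p : {poly F} => p`_(m + N.+1 * m'))).
have coefsE s : (\sum_(m0 < N.+1) \sum_(m'0 < (N - m0).+1)
    if odd (N - m0 - m'0) then 0 else
    ((-1) ^+ (N - m0) * (-1) ^+ (N - m0 - m'0)./2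
       * structure_sum q s N m0 (N - m0 - m'0)./2)
     *: iter (N - m0 - m'0)./2 id (iter m0 L (iter m'0 R 1)))`_(m + N.+1 * m')
   = (-1) ^+ (N - m) * (-1) ^+ (N - m - m')./2 * structure_sum q s N m (N - m - m')./2.
  have mN : (m < N.+1)%N by lia.
  have m'N : (m' < (N - m).+1)%N by lia.
  have term0 k l j : iter k id (iter l L (iter j R 1)) = 'X^(l + N.+1 * j) :> {poly F}.
    have -> : iter k id (iter l L (iter j R 1)) = iter l L (iter j R 1) by elim: k.
    rewrite exprD exprM; elim: l => [|l IHl] /=.
      by rewrite mul1r; elim: j => //= j ->; rewrite /R -exprS.
    by rewrite IHl /L (exprS _ l) mulrA.
  rewrite coef_sum (bigD1 (Ordinal mN)) //= [X in _ + X]big1 ?addr0.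
    rewrite coef_sum (bigD1 (Ordinal m'N)) //= [X in _ + X]big1 ?addr0.
      by rewrite (negPf odd_mm') term0 coefZ coefXn eqxx mulr1.
    move=> k km'; case: ifP; rewrite ?coef0 // term0 coefZ coefXn.
    case: eqP => [e|]; last by rewrite mulr0.
    by case/eqP: km'; apply: val_inj => /=; nia.
  move=> l lm; rewrite coef_sum big1 // => k _.
  case: ifP; rewrite ?coef0 // term0 coefZ coefXn.
  case: eqP => [e|]; last by rewrite mulr0.
  case/eqP: lm; apply: val_inj => /=; have lN := ltn_ord l.
  have := congr1 (fun x : nat => x %% N.+1)%N e; rewrite !(mulnC N.+1) ![(_ + _ * N.+1)%N]addnC !modnMDl !modn_small // => ->.
rewrite /= !coefsE => /mulfI; apply; rewrite mulf_neq0 ?signr_eq0 //.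
Qed.

End StructureConstants.

(* Minus the coefficient of kap^h L^m R^m' in [divided], where N = 1 - a and
   kap stands for q c Z. *)
Lemma rhoE (F : fieldType) (q : F) (s : bool) (c : F) (N m m' : nat) :
  (m + m' <= N)%N ->
  rho s q c (1 - N%:Z) m m' =
  if odd (N - m - m') then 0 else
  - ((-1) ^+ (N - m) * (- (q * c)) ^+ (N - m - m')./2
     * structure_sum q s N m (N - m - m')./2).
Proof.
move=> mm'N; have oN := odd_double_half (N - m - m').
have hE : halfexp (1 - N%:Z) m m' = (N - m - m')./2 by rewrite /halfexp /ehalf; lia.
rewrite /rho hE; have -> : eparity (1 - N%:Z + m%:Z + m'%:Z) = ~~ odd (N - m - m').
  by rewrite /eparity /ehalf; case: (odd _) oN => /=; lia.
case: (odd (N - m - m')) oN => oN; first by rewrite /= mulr0z !mul0r.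
have -> : (-1) ^ (1 - N%:Z + m%:Z) = - (-1) ^+ (N - m) :> F.
  have -> : 1 - N%:Z + m%:Z = 1 - (N - m)%:Z by lia.
  by rewrite expfzDr ?oppr_eq0 ?oner_eq0 // expr1z -exprz_inv invrN1 mulN1r.
rewrite /= mulr1z mul1r !mulNr; congr (- (_ * _)); set h := (N - m - m')./2.
have oNN := odd_double_half N; have omm := odd_double_half m.
have n1 : `|1 - (1 - N%:Z)%R|%N = N by lia.
case: s; rewrite /Theta1 /Theta0 hE -/h n1; apply: eq_bigr => -[r /= rh] _; rewrite ltnS in rh;
  congr (_ * _ * _).
- rewrite -alphaE; congr (alpha _ _ _ _); rewrite /npairs /ehalf /=.
  by rewrite -divn2; lia.
- have -> : `|1 - eparity (1 - N%:Z)%R|%N = odd N.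
    by rewrite /eparity /ehalf; case: (odd N) oNN => /=; lia.
  (* At index 0 both sides are 1. The case is split off because the truncated subtraction in
     [npairs] need not match the integer argument of [alpha] there. *)
  rewrite /= negbK; have [->|k0] := posnP (h - r); first by rewrite elem_sym0.
  rewrite -alphaE; congr (alpha _ _ _ _); rewrite /npairs /ehalf -divn2.
  by case: (odd N) oNN => /= oNN; lia.
- have [->|r0] := posnP r; first by rewrite elem_sym0.
  rewrite -alphaE; congr (alpha _ _ _ _); rewrite /npairs /ehalf /eparity /ehalf -divn2 /=.
  by lia.
- have -> : `|eparity (1 - N%:Z)%R|%N = ~~ odd N.
    by rewrite /eparity /ehalf; case: (odd N) oNN => /=; lia.
  have [->|k0] := posnP (h - r); first by rewrite elem_sym0.
  rewrite -alphaE; congr (alpha _ _ _ _); rewrite /npairs /eparity /ehalf -divn2.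
  by case: (odd N) oNN => /= oNN; lia.
Qed.

(** * The relation in an abstract algebra *)

Section Algebra.
Context (F : fieldType) (q : F).
Hypothesis q_neq0 : q != 0.
Hypothesis q_nroot : forall n, (0 < n)%N -> q ^+ n != 1.
Context (R : algType F).
Implicit Types (x y B Y kap : R).

Definition lmul x : R -> R := fun y => x * y.
Definition rmul x : R -> R := fun y => y * x.

Lemma lmul_linear x : linear (lmul x).
Proof. by move=> a u v; rewrite /lmul mulrDr scalerAr. Qed.

Lemma rmul_linear x : linear (rmul x).
Proof. by move=> a u v; rewrite /rmul mulrDl scalerAl. Qed.

Definition serre N x y : R :=
  \sum_(l < N.+1) ((-1) ^+ l * qbinom q N l) *: (x ^+ (N - l) * y * x ^+ l).

Definition bchain B kap N r Y : R := chain q (lmul B) (rmul B) (lmul kap) N r Y.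

Lemma bchain_linear B kap N r : linear (bchain B kap N r).
Proof.
by apply: chain_linear; [apply: lmul_linear|apply: rmul_linear|apply: lmul_linear].
Qed.

Lemma bchain_divided (s : bool) B kap N Y : kap * B = B * kap ->
  bchain B kap N N Y = divided q (lmul B) (rmul B) (lmul kap) s Y N.
Proof.
move=> kB; have [[lB rB] lk] := (lmul_linear B, rmul_linear B, lmul_linear kap).
have LR y : lmul B (rmul B y) = rmul B (lmul B y) by rewrite /lmul /rmul mulrA.
have LZ y : lmul B (lmul kap y) = lmul kap (lmul B y).
  by rewrite /lmul !mulrA kB.
have RZ y : rmul B (lmul kap y) = lmul kap (rmul B y) by rewrite /lmul /rmul mulrA.
by rewrite /bchain chain_factored // divided_factored.
Qed.

Lemma qbinom_sub N m : (m <= N)%N -> qbinom q N (N - m) = qbinom q N m.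
Proof. by move=> mN; rewrite /qbinom subKn // [X in _ / X]mulrC. Qed.

Lemma iter_lmul k x y : iter k (lmul x) y = x ^+ k * y.
Proof. by elim: k => [|k IHk] /=; rewrite ?mul1r // IHk /lmul exprS mulrA. Qed.

Lemma iter_rmul k x y : iter k (rmul x) y = y * x ^+ k.
Proof. by elim: k => [|k IHk] /=; rewrite ?mulr1 // IHk /rmul exprSr mulrA. Qed.

(** The terms with m + m' = N carry no kap and form the Serre polynomial; those with m + m' = N - 1
    vanish by parity. What remains is the index range of the theorem. *)
Lemma bchainE (s : bool) B kap N Y : kap * B = B * kap ->
  bchain B kap N N Y = serre N B Y +
  \sum_(0 <= m < N.-1) \sum_(0 <= m' < N.-1 - m)
    (if odd (N - m - m') then 0 else
     (-1) ^+ (N - m) * (-1) ^+ (N - m - m')./2 * structure_sum q s N m (N - m - m')./2)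
     *: (kap ^+ (N - m - m')./2 * B ^+ m * Y * B ^+ m').
Proof.
move=> kB; have [[lB rB] lk] := (lmul_linear B, rmul_linear B, lmul_linear kap).
have LZ y : lmul B (lmul kap y) = lmul kap (lmul B y).
  by rewrite /lmul !mulrA kB.
have RZ y : rmul B (lmul kap y) = lmul kap (rmul B y) by rewrite /lmul /rmul mulrA.
rewrite (bchain_divided s) // (divided_expand _ lk) //.
pose t m m' := (if odd (N - m - m') then 0 else
     (-1) ^+ (N - m) * (-1) ^+ (N - m - m')./2 * structure_sum q s N m (N - m - m')./2)
     *: (kap ^+ (N - m - m')./2 * B ^+ m * Y * B ^+ m').
transitivity (\sum_(m < N.+1) (t m (N - m)%N + \sum_(0 <= m' < N - m) t m m')).
  apply: eq_bigr => m _; rewrite big_ord_recr [RHS]addrC; congr (_ + _).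
    rewrite big_mkord; apply: eq_bigr => m' _.
    by rewrite /t /=; case: (odd _); rewrite ?scale0r // iter_rmul !iter_lmul !mulrA.
  by rewrite /t /=; case: (odd _); rewrite ?scale0r // iter_rmul !iter_lmul !mulrA.
rewrite big_split /=; congr (_ + _).
  rewrite (reindex_inj rev_ord_inj); apply: eq_bigr => l _ /=.
  have lN : (l <= N)%N by rewrite -ltnS.
  rewrite /t subSS subKn // subnn /= mul1r /structure_sum big_ord1 !elem_sym0.
  by rewrite expr0 muln0 addn0 !mulr1 qbinom_sub.
rewrite -(big_mkord xpredT (fun m => \sum_(0 <= m' < N - m) t m m')).
case: N @t {LZ RZ} => [|N] t; first by rewrite big_nat1 !big_geq.
rewrite 2?big_nat_recr //= subnn (big_geq (leqnn 0)) addr0 subSnn big_nat1.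
rewrite {2}/t subSnn subn0 /= scale0r addr0; apply: eq_big_nat => m /andP[_ mN].
rewrite subSn 1?ltnW // big_nat_recr //= [X in _ + X]/t.
have -> : (N.+1 - m - (N - m))%N = 1%N by rewrite subSn 1?ltnW // subSnn.
rewrite /= scale0r addr0; apply: eq_bigr => m' _.
by rewrite /t subSn // ltnW.
Qed.

(** Every correction term in [bchainE] carries a positive power of kap. *)
Lemma serre_bchain N x y : bchain x 0 N N y = serre N x y.
Proof.
rewrite (bchainE true) ?mul0r ?mulr0 //.
rewrite big_nat_cond big1 ?addr0 // => m /andP[/andP[_ mN] _].
rewrite big_nat_cond big1 // => m' /andP[/andP[_ mm'] _].
have [h hE] : exists h, ((N - m - m')./2 = h.+1)%N.
  by exists (N - m - m')./2.-1; rewrite prednK // half_gt0; lia.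
by rewrite hE expr0n !mul0r scaler0.
Qed.

Lemma relation_of_bchain (s : bool) (c : F) N B Y Zc : Zc * B = B * Zc ->
  bchain B ((q * c) *: Zc) N N Y = 0 ->
  serre N B Y =
  \sum_(0 <= m < N.-1) \sum_(0 <= m' < N.-1 - m)
     rho s q c (1 - N%:Z) m m'
     *: (Zc ^+ halfexp (1 - N%:Z) m m' * B ^+ m * Y * B ^+ m').
Proof.
move=> ZB; rewrite (bchainE s) => [|]; last by rewrite -scalerAl ZB scalerAr.
move/eqP; rewrite addr_eq0 => /eqP ->; rewrite -sumrN; apply: eq_big_nat => m /andP[_ mN].
rewrite -sumrN; apply: eq_big_nat => m' /andP[_ m'N].
have -> : halfexp (1 - N%:Z) m m' = (N - m - m')./2.
  by rewrite /halfexp /ehalf; have := odd_double_half (N - m - m'); lia.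
rewrite rhoE; last by lia.
case: ifP => _; first by rewrite !scale0r oppr0.
rewrite -scaleNr exprZn -!scalerAl scalerA; congr (_ *: _).
rewrite [(- (q * c)) ^+ _]exprNn; ring.
Qed.

End Algebra.

(** * Collapse of the recurrence on lowest weight vectors *)

Section TensorOperators.
Context (F : fieldType) (q : F).
Hypothesis q_neq0 : q != 0.
Hypothesis q_nroot : forall n, (0 < n)%N -> q ^+ n != 1.
Context (R : algType F).
Implicit Types (x y : R).

Let qq0 := qsqr_neq1 q_nroot.

Let sAl a x y : (a *: x) * y = a *: (x * y). Proof. by rewrite scalerAl. Qed.
Let sAr a x y : x * (a *: y) = a *: (x * y). Proof. by rewrite scalerAr. Qed.
Let ncE := (@mulrDl R, @mulrDr R, @mulrN R, @mulNr R, sAl, sAr).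

Context (f w k z : R) (del sig : F) (N : nat) (Y : R).
Let p : F := q ^+ N / q.
Hypothesis kf : k * f = q ^+ 2 *: (f * k).
Hypothesis kw : k * w = q ^- 2 *: (w * k).
Hypothesis wf : w * f = q ^+ 2 *: (f * w) + z + del *: (k * k).
Hypotheses (zf : z * f = f * z) (zw : z * w = w * z) (zk : z * k = k * z)
  (zY : z * Y = Y * z).
Let kap : R := (q^-1 * (q - q^-1)) *: z.

Section LowestWeight.
Hypotheses (Yw : Y * w = p *: (w * Y)) (Yk : Y * k = p *: (k * Y)).

Let y r : R := bchain q f 0 N r Y.

Let y0 : y 0 = Y. Proof. exact: chain0E. Qed.

Let yS r : y r.+1 = f * y r - diag q N r *: (y r * f).
Proof.
case: r => [|r]; first by rewrite /y /bchain chain1E chain0E.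
by rewrite /y /bchain chainSS /lmul mul0r scaler0 subr0.
Qed.

Let diagS r : diag q N r.+1 = q ^+ 2 * diag q N r.
Proof. by rewrite /diag (exprS q r); ring. Qed.

Let diag0 : diag q N 0 = p^-1.
Proof. by rewrite /diag expr0 expr1n mulr1 /p invf_div. Qed.

Let p0 : p != 0. Proof. by rewrite mulf_neq0 ?invr_eq0 ?expf_neq0. Qed.

Let kyE r : k * y r = diag q N r *: (y r * k).
Proof.
elim: r => [|r IHr]; first by rewrite y0 diag0 Yk scalerA mulVf // scale1r.
rewrite yS diagS !ncE; move: (diag q N r) IHr => d IHr.
rewrite [k * (f * _)]mulrA kf [k * (y r * f)]mulrA IHr !ncE.
have -> : f * k * y r = d *: (f * (y r * k)) by rewrite -mulrA IHr -scalerAr.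
have -> : y r * k * f = q ^+ 2 *: (y r * f * k) by rewrite -!mulrA kf -scalerAr.
by rewrite !mulrA; lmod F R; ring.
Qed.

Let zyE r : z * y r = y r * z.
Proof.
elim: r => [|r IHr]; first by rewrite y0.
by rewrite yS !ncE mulrA zf -mulrA IHr [z * (_ * _)]mulrA IHr -[_ * f * z]mulrA -zf !mulrA.
Qed.

(** Moving w through f produces z and del k k. The z-terms accumulate into [offdiag]; the del-terms
    cancel because k k passes y r with the square of [diag]. The term f x is eliminated by the
    recurrence for y r, and at r = 0 its coefficient is 0. *)
Let wyS r (x := if r is r1.+1 then kap * y r1 else 0) :
  w * y r = diag q N r *: (y r * w) + offdiag q N r *: x ->
  w * y r.+1 = diag q N r.+1 *: (y r.+1 * w) + offdiag q N r.+1 *: (kap * y r).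
Proof.
move=> IHr; have dE : diag q N r = q * (q ^+ r) ^+ 2 / q ^+ N by [].
have muE : offdiag q N r = (q ^+ r) ^+ 2 / q ^+ N * qnum q r
   * ((q ^+ N / q ^+ r - q ^+ r / q ^+ N) / (q - q^-1)) by [].
have muSE : offdiag q N r.+1 = (q ^+ r.+1) ^+ 2 / q ^+ N * qnum q r.+1
   * ((q ^+ N / q ^+ r.+1 - q ^+ r.+1 / q ^+ N) / (q - q^-1)) by [].
have xE : offdiag q N r *: (q ^+ 2 *: (f * x)) =
    offdiag q N r *: (diag q N r *: (x * f)) + (offdiag q N r * q ^+ 2) *: (kap * y r).
  rewrite /x; case: (r) => [|r1].
    by rewrite /offdiag (qnum0 q) !(mulr0, mul0r, scale0r) addr0.
  rewrite [y r1.+1]yS diagS; move: (diag _ _ _) (offdiag _ _ _) => d1 mu1.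
  by rewrite /kap !ncE [f * (z * _)]mulrA -zf !mulrA; lmod F R; ring.
rewrite diagS; move: (diag q N r) (offdiag q N r) (offdiag q N r.+1) dE muE muSE xE (kyE r) IHr (yS r).
move=> d mu mu1 dE muE muSE xE ky IHr ySr.
have kky : k * k * y r = (d * d) *: (y r * k * k).
  by rewrite -mulrA ky sAr mulrA ky -!mulrA sAl scalerA mulrA.
rewrite ySr !ncE [w * (f * _)]mulrA wf [w * (y _ * f)]mulrA IHr !ncE kky.
rewrite -(mulrA f w) -(mulrA (y r) w) wf IHr !ncE zyE !mulrA.
have -> : mu *: (f * x) = (mu / q ^+ 2 * d) *: (x * f) + mu *: (kap * y r).
  apply: (can_inj (scalerK (expf_neq0 2 q_neq0))); rewrite !scalerDr !scalerA.
  have := xE; rewrite !scalerA [q ^+ 2 * mu]mulrC => ->.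
  by congr (_ *: _ + _ *: _); field.
rewrite /kap sAl zyE; rewrite muSE muE dE /qnum !(exprS q r).
have t0 : q ^+ r != 0 by rewrite expf_neq0.
have u0 : q ^+ N != 0 by rewrite expf_neq0.
move: (q ^+ r) (q ^+ N) t0 u0 => t u t0 u0.
by lmod F R; field; rewrite ?t0 ?u0 ?q_neq0 ?qq0.
Qed.

Let wyE r : w * y r = diag q N r *: (y r * w)
   + offdiag q N r *: (if r is r1.+1 then kap * y r1 else 0).
Proof.
elim: r => [|r IHr]; last exact: wyS.
rewrite scaler0 addr0 y0 diag0 Yw scalerA mulVf // scale1r //.
Qed.

(** Both w and k pass y r with the factor [diag], hence cancel in L - diag R, except for the
    kap-term of [wyE], which [offdiag] is there to remove. *)
Lemma bchain_lowest r : bchain q (f + w + sig *: k) kap N r Y = bchain q f 0 N r Y.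
Proof.
rewrite -/(y r); elim/ltn_ind: r => -[|[|r]] IHr.
- by rewrite /bchain chain0E y0.
- have [wY kY] := (wyE 0, kyE 0); rewrite y0 scaler0 addr0 in wY kY.
  rewrite /bchain chain1E /lmul /rmul yS y0 !ncE wY kY.
  by move: (diag _ _ _) => d; lmod F R; ring.
rewrite /bchain chainSS -!/(bchain _ _ _ _ _ _) !IHr // /lmul /rmul [RHS]yS !ncE.
rewrite wyE kyE /= /kap !sAl; move: (diag _ _ _) (offdiag _ _ _) => d mu.
by lmod F R; ring.
Qed.

End LowestWeight.
End TensorOperators.

(** * Inversion of q *)

Section InverseParameter.
Context (F : fieldType) (q : F).
Hypothesis q_neq0 : q != 0.
Hypothesis q_nroot : forall n, (0 < n)%N -> q ^+ n != 1.

Lemma qV_nroot n : (0 < n)%N -> q^-1 ^+ n != 1.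
Proof. by move=> n0; rewrite exprVn invr_eq1 q_nroot. Qed.

Lemma ipowV (V : lmodType F) (Z f : V -> V) s n v :
  ipow q^-1 Z f s n v = ipow q Z f s n v.
Proof.
elim/ltn_ind: n => -[|n] IHn; first by rewrite !ipow0 ?invr_eq0 ?qV_nroot.
rewrite !ipowS !IHn ?(leq_ltn_trans (leq_pred _)) //.
by rewrite /gap qnumV.
Qed.

(** The recurrence itself is not invariant, but at r = N it equals the i-divided form, whose
    coefficients are built from quantum integers. *)
Lemma bchainV (R : algType F) (B kap Y : R) N : kap * B = B * kap ->
  bchain q^-1 B kap N N Y = bchain q B kap N N Y.
Proof.
move=> kB; have qV0 : q^-1 != 0 by rewrite invr_eq0.
rewrite (bchain_divided qV0 qV_nroot true) // (bchain_divided q_neq0 q_nroot true) //.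
apply: eq_bigr => a _; rewrite qbinomV !ipowV //.
Qed.

Lemma serreV (R : algType F) N (x y : R) : serre q^-1 N x y = serre q N x y.
Proof. by apply: eq_bigr => l _; rewrite qbinomV. Qed.

End InverseParameter.

(** * The relation on lowest and on highest weight vectors *)

Section TensorOperatorRelations.
Context (F : fieldType) (q : F).
Hypothesis q_neq0 : q != 0.
Hypothesis q_nroot : forall n, (0 < n)%N -> q ^+ n != 1.
Context (R : algType F).
Context (f w k z : R) (del sig : F).
Hypothesis kf : k * f = q ^+ 2 *: (f * k).
Hypothesis kw : k * w = q ^- 2 *: (w * k).
Hypothesis wf : w * f = q ^+ 2 *: (f * w) + z + del *: (k * k).
Hypotheses (zf : z * f = f * z) (zw : z * w = w * z) (zk : z * k = k * z).
Let kap : R := (q^-1 * (q - q^-1)) *: z.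
Let B : R := f + w + sig *: k.

Let sAl a (x y : R) : (a *: x) * y = a *: (x * y). Proof. by rewrite scalerAl. Qed.
Let sAr a (x y : R) : x * (a *: y) = a *: (x * y). Proof. by rewrite scalerAr. Qed.
Let ncE := (@mulrDl R, @mulrDr R, @mulrN R, @mulNr R, sAl, sAr).

Lemma kapB : kap * B = B * kap.
Proof. by rewrite /kap /B !ncE zf zw zk; lmod F R; ring. Qed.

Lemma lowest_relation N Y : z * Y = Y * z ->
  Y * w = (q ^+ N / q) *: (w * Y) -> Y * k = (q ^+ N / q) *: (k * Y) ->
  serre q N f Y = 0 -> bchain q B kap N N Y = 0.
Proof.
move=> zY Yw Yk fY; rewrite /B /kap (bchain_lowest q_neq0 q_nroot sig kf wf) //.
by rewrite serre_bchain.
Qed.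

(** Exchanging f with w and q with q^-1 preserves the relations if z and del are multiplied by
    -q^-2, and this leaves kap unchanged. *)
Lemma highest_relation N Y : z * Y = Y * z ->
  Y * f = (q / q ^+ N) *: (f * Y) -> Y * k = (q / q ^+ N) *: (k * Y) ->
  serre q N w Y = 0 -> bchain q B kap N N Y = 0.
Proof.
move=> zY Yf Yk wY; rewrite -(bchainV q_neq0 q_nroot) ?kapB //.
have qV0 : q^-1 != 0 by rewrite invr_eq0.
have qVn := qV_nroot q_nroot.
have pE : q^-1 ^+ N / q^-1 = q / q ^+ N by rewrite exprVn invrK mulrC.
have -> : kap = (q^-1^-1 * (q^-1 - q^-1^-1)) *: ((- q ^- 2) *: z).
  by rewrite /kap scalerA; congr (_ *: _); field; rewrite q_neq0 oner_eq0.
have -> : B = w + f + sig *: k by rewrite /B [f + w]addrC.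
rewrite (@bchain_lowest _ _ qV0 qVn _ w f k ((- q ^- 2) *: z) (- q ^- 2 * del)) ?pE //.
- by rewrite serre_bchain // serreV.
- by rewrite exprVn kw.
- rewrite wf; rewrite !scalerDr exprVn !scalerA mulVf ?expf_neq0 // scale1r.
  by lmod F R; field; rewrite ?oner_eq0 q_neq0.
- by rewrite !ncE zw.
- by rewrite !ncE zY.
Qed.

End TensorOperatorRelations.

(** * The relation on vectors commuting with k *)

Section WeightZero.
Context (F : fieldType) (q : F).
Hypothesis q_neq0 : q != 0.
Hypothesis q_nroot : forall n, (0 < n)%N -> q ^+ n != 1.
Hypothesis two_neq0 : (2 : F) != 0.
Context (R : algType F).
Context (f w k z C : R) (del sig : F).
Hypothesis kf : k * f = q ^+ 2 *: (f * k).
Hypothesis kw : k * w = q ^- 2 *: (w * k).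
Hypothesis wf : w * f = q ^+ 2 *: (f * w) + z + del *: (k * k).
Hypotheses (zf : z * f = f * z) (zw : z * w = w * z) (zk : z * k = k * z).
Let kap : R := (q^-1 * (q - q^-1)) *: z.
Let B : R := f + w + sig *: k.
Hypothesis fw : f * w =
  C * k + (1 - q ^+ 2)^-1 *: z + (del / (q ^+ 2 * (q ^+ 2 - 1))) *: (k * k).
Hypotheses (Cf : C * f = f * C) (Cw : C * w = w * C) (Ck : C * k = k * C)
  (Cz : C * z = z * C).

Let sAl a (x y : R) : (a *: x) * y = a *: (x * y). Proof. by rewrite scalerAl. Qed.
Let sAr a (x y : R) : x * (a *: y) = a *: (x * y). Proof. by rewrite scalerAr. Qed.
Let ncE := (@mulrDl R, @mulrDr R, @mulrN R, @mulNr R, sAl, sAr).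
Let qq0 := qsqr_neq1 q_nroot.

Let al (u : F) := sig * ((1 - u) * (u ^+ 2 - q ^+ 2) / (u * (u + q ^+ 2))).
Let ga (u : F) := 1 - u ^+ 2 + q ^+ 2 * (1 - u ^- 2).
Let ep (u : F) := sig ^+ 2 * (2 - u - u^-1) - 2 * sig * al u
  + del / (q ^+ 2 * (q ^+ 2 - 1)) * (1 - u ^+ 2 + q ^+ 4 - q ^+ 4 / u ^+ 2).

(** In the application Y B = B' Y, so the left side times Y is a quadratic factor applied to Y. The
    terms f f and w w cancel; [al] is solved for from the coefficient of f k, the same value serving
    for w k; [ga] and [ep] are what remains once w f and f w are replaced. *)
Lemma quad_weight_zero u (B' := u^-1 *: f + u *: w + sig *: k) :
  u != 0 -> u + q ^+ 2 != 0 ->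
  B * B - (u + u^-1) *: (B * B') + B' * B'
    - ((u - u^-1) / (q - q^-1)) ^+ 2 *: kap =
  al u *: (B * k + k * B') + ga u *: (C * k) + ep u *: (k * k).
Proof.
move=> u0 uq0; rewrite /B /B' /kap /ep /al /ga !ncE wf kf kw !scalerDr fw !scalerDr.
have q21 : 1 - q ^+ 2 != 0 by rewrite subr_eq0 eq_sym q_nroot.
have q21' : q ^+ 2 - 1 != 0 by rewrite subr_eq0 q_nroot.
by lmod F R; field; rewrite ?q21 ?q21' ?u0 ?uq0 ?q_neq0 ?qq0.
Qed.

Let kapB : kap * B = B * kap.
Proof. exact: kapB. Qed.

Let LR (y : R) : lmul B (rmul B y) = rmul B (lmul B y).
Proof. by rewrite /lmul /rmul mulrA. Qed.
Let LZ (y : R) : lmul B (lmul kap y) = lmul kap (lmul B y).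
Proof. by rewrite /lmul !mulrA kapB. Qed.
Let RZ (y : R) : rmul B (lmul kap y) = lmul kap (rmul B y).
Proof. by rewrite /lmul /rmul mulrA. Qed.

Let CB : C * B = B * C.
Proof. by rewrite /B !ncE Cf Cw Ck. Qed.

Let P N y : R := factored q (lmul B) (rmul B) (lmul kap) N y.
Let Q n y : R := quad q (lmul B) (rmul B) (lmul kap) n y.

Let QE n y : Q n y = B * (B * y) - (q ^+ n + q ^- n) *: (B * y * B) + y * B * B
  - qnum q n ^+ 2 *: (kap * y).
Proof. by []. Qed.

Let PS N y : P N.+2 y = Q N.+1 (P N y). Proof. by []. Qed.

Let Q_lin n a x y : Q n (a *: x + y) = a *: Q n x + Q n y.
Proof.
by apply: quad_linear; [apply: lmul_linear|apply: rmul_linear|apply: lmul_linear].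
Qed.

Let QL n y : Q n (B * y) = B * Q n y.
Proof.
rewrite !QE; move: (q ^+ n + _) (_ ^+ 2) (kap) (B) kapB => a c kp b kb.
by rewrite !ncE !mulrA kb.
Qed.

Let QR n y : Q n (y * B) = Q n y * B.
Proof.
rewrite !QE; move: (q ^+ n + _) (_ ^+ 2) (kap) (B) => a c kp b.
by rewrite !ncE !mulrA.
Qed.

Let QZ n y : Q n (kap * y) = kap * Q n y.
Proof.
rewrite !QE; move: (q ^+ n + _) (_ ^+ 2) (kap) (B) kapB => a c kp b kb.
have kbb : kp * b * b = b * b * kp by rewrite kb -mulrA kb mulrA.
by rewrite !ncE !mulrA kbb kb.
Qed.

Let P_comm N (g : R -> R) y : linear g -> (forall y, g (B * y) = B * g y) ->
  (forall y, g (y * B) = g y * B) -> (forall y, g (kap * y) = kap * g y) ->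
  g (P N y) = P N (g y).
Proof.
move=> ling gL gR gZ.
have gE (a b c x : R) (d n : F) : g (a + n *: b + c + d *: x) = g a + n *: g b + g c + d *: g x.
  have gD u v : g (u + v) = g u + g v by have := ling 1 u v; rewrite !scale1r.
  by rewrite !gD !(linear_scaleE _ _ ling).
elim/ltn_ind: N => -[|[|N]] IHN //; last first.
  by rewrite !PS !QE -!scaleNr gE !(gL, gR, gZ) IHN.
rewrite /P /= /lmul /rmul -scaleN1r -gR -gL addrC ling addrC.
by rewrite scaleN1r.
Qed.

Let P_lin N a x y : P N (a *: x + y) = a *: P N x + P N y.
Proof.
elim/ltn_ind: N => -[|[|N]] IHN //; last by rewrite !PS IHN // Q_lin.
by rewrite /P /= /lmul /rmul !ncE; lmod F R; ring.
Qed.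

(** For n > 0 a zero would make q a root of unity; for n = 0 the value is 2. *)
Lemma qexp_addsqr_neq0 n : q ^+ n.*2 + 1 != 0.
Proof.
case: n => [|n]; first by rewrite expr0 -[1 + 1]/(2%:R).
apply: contra (q_nroot (n := 4 * n.+1) _) => // /eqP e; apply/eqP.
have -> : (4 * n.+1 = n.+1.*2 * 2)%N by lia.
have -> : q ^+ (n.+1.*2 * 2) = (q ^+ n.+1.*2 + 1) * (q ^+ n.+1.*2 - 1) + 1.
  by rewrite exprM; ring.
by rewrite e mul0r add0r.
Qed.

(** The outermost quadratic factor turns Y into a combination of k Y, multiplied by B or by C, and
    of k k Y. These satisfy the same hypotheses with b lowered by 1 and by 2, and multiplications by
    B and C commute with the other factors. *)
Lemma weight_zero_relation b Y : C * Y = Y * C -> z * Y = Y * z ->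
  Y * f = q ^- b.*2 *: (f * Y) -> Y * w = q ^+ b.*2 *: (w * Y) -> Y * k = k * Y ->
  bchain q B kap b.*2.+1 b.*2.+1 Y = 0.
Proof.
move=> CY zY Yf Yw Yk.
rewrite /bchain (chain_factored q_neq0 q_nroot (lmul_linear B) (rmul_linear B)
  (lmul_linear kap) LR LZ RZ) -/(P _ _).
elim/ltn_ind: b Y CY zY Yf Yw Yk => -[_|b IHb] Y CY zY Yf Yw Yk.
  rewrite /P /= /lmul /rmul /B !ncE Yf Yw Yk expr0 invr1 !scale1r.
  by lmod F R; ring.
have bu0 : q ^+ b.+1.*2 != 0 by rewrite expf_neq0.
have buq0 : q ^+ b.+1.*2 + q ^+ 2 != 0.
  rewrite doubleS -addn2 exprD -{2}[q ^+ 2]mul1r -mulrDl mulf_neq0 ?expf_neq0 //.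
  exact: qexp_addsqr_neq0.
set u := q ^+ b.+1.*2 in Yf Yw bu0 buq0.
pose B' := u^-1 *: f + u *: w + sig *: k.
have YB : Y * B = B' * Y by rewrite /B /B' !ncE Yf Yw Yk.
have kY1 : C * (k * Y) = k * Y * C by rewrite mulrA Ck -!mulrA CY.
have kYz : z * (k * Y) = k * Y * z by rewrite mulrA zk -!mulrA zY.
have qk0 n : q ^+ n != 0 by rewrite expf_neq0.
have kYf n y : y * f = q ^- n.+2 *: (f * y) -> k * y * f = q ^- n *: (f * (k * y)).
  move=> yf; rewrite -mulrA yf !ncE mulrA kf !ncE !mulrA scalerA.
  by congr (_ *: _); rewrite -addn2 exprD; field; rewrite ?q_neq0 ?qk0.
have kYw n y : y * w = q ^+ n.+2 *: (w * y) -> k * y * w = q ^+ n *: (w * (k * y)).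
  move=> yw; rewrite -mulrA yw !ncE mulrA kw !ncE !mulrA scalerA.
  by congr (_ *: _); rewrite -addn2 exprD; field; rewrite ?q_neq0 ?qk0.
have kYk y : y * k = k * y -> k * y * k = k * (k * y) by move=> yk; rewrite -mulrA yk.
have P1 : P b.*2.+1 (k * Y) = 0.
  by apply: IHb => //; [apply: kYf|apply: kYw|apply: kYk].
have PC y : P b.*2.+1 (C * y) = C * P b.*2.+1 y.
  rewrite -(@P_comm _ (lmul C)) //; first exact: lmul_linear.
  - by move=> x; rewrite /lmul mulrA CB mulrA.
  - by move=> x; rewrite /lmul mulrA.
  - by move=> x; rewrite /lmul /kap !ncE mulrA Cz mulrA.
have PL y : P b.*2.+1 (B * y) = B * P b.*2.+1 y.
  by rewrite -(@P_comm _ (lmul B)) //; exact: lmul_linear.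
have PR y : P b.*2.+1 (y * B) = P b.*2.+1 y * B.
  by rewrite -(@P_comm _ (rmul B)) // => [|x]; [exact: rmul_linear | rewrite /rmul mulrA].
have QP : P b.+1.*2.+1 Y = P b.*2.+1 (Q b.+1.*2 Y).
  by rewrite doubleS PS -(@P_comm _ (Q b.*2.+2)) // => a x y; apply: Q_lin.
have QY : Q b.+1.*2 Y = al u *: (B * (k * Y)) + (al u *: (k * Y * B)
    + (ga u *: (C * (k * Y)) + ep u *: (k * (k * Y)))).
  have BYB : B * Y * B = B * B' * Y by rewrite -(mulrA B Y B) YB mulrA.
  have kYB : k * Y * B = k * B' * Y by rewrite -(mulrA k Y B) YB mulrA.
  have YBB : Y * B * B = B' * B' * Y by rewrite YB -(mulrA B' Y B) YB mulrA.
  rewrite QE BYB YBB kYB {BYB YBB kYB} [qnum _ _]/(_ / _) -/u.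
  have := quad_weight_zero bu0 buq0; rewrite -/B'.
  move: (al u) (ga u) (ep u) (_ ^+ 2) (u + _) (kap) (B) (B') => a1 a2 a3 n2 th kp x x' e.
  transitivity ((x * x - th *: (x * x') + x' * x' - n2 *: kp) * Y).
    by rewrite !mulrDl !mulNr !sAl !mulrA.
  by rewrite e !mulrDl !sAl mulrDl scalerDr !mulrA !addrA.
have P0 : P b.*2.+1 0 = 0.
  have := P_lin b.*2.+1 (-1) 0 0.
  by rewrite !scaler0 addr0 scaleN1r addNr.
rewrite QP QY P_lin PL P1 mulr0 scaler0 add0r P_lin PR P1 mul0r scaler0 add0r.
rewrite P_lin PC P1 mulr0 scaler0 add0r.
have -> : ep u *: (k * (k * Y)) = ep u *: (k * (k * Y)) + 0 by rewrite addr0.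
rewrite P_lin P0 addr0.
(* For b = 0 no smaller case is left for k k Y, but then u = q^2 and [ep] vanishes. *)
have [b0|b_gt0] := posnP b.
  suff -> : ep u = 0 by rewrite scale0r.
  rewrite /ep /al /u b0 /=; field.
  have q21' : q ^+ 2 - 1 != 0 by rewrite subr_eq0 q_nroot.
  by move: buq0; rewrite /u b0 => ->; rewrite q_neq0 q21'.
suff -> : P b.*2.+1 (k * (k * Y)) = 0 by rewrite scaler0.
case: b b_gt0 IHb {QY QP PC PL PR P0 P1 bu0 buq0} @u B' YB Yf Yw => // b _ IHb u B' YB Yf Yw.
rewrite doubleS PS IHb //.
- have := Q_lin b.*2.+2 (-1) 0 0; by rewrite !scaler0 addr0 scaleN1r addNr.
- by rewrite mulrA Ck -!mulrA kY1 !mulrA.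
- by rewrite mulrA zk -!mulrA kYz !mulrA.
- by apply/kYf/kYf.
- by apply/kYw/kYw.
- by apply/kYk/kYk.
Qed.

End WeightZero.

(** * Quantum group relations *)

(** The Serre relations are left out: the record is also used for operators on a module where they
    are still to be proved, and with E and F exchanged. *)
Record quantum_relations (F : fieldType) (q : F) n (A : 'M[int]_n)
    (eps : 'I_n -> nat) (R : algType F) (E F_ K Ki : 'I_n -> R) : Prop := {
  K_Ki : forall i, K i * Ki i = 1;
  Ki_K : forall i, Ki i * K i = 1;
  K_K : forall i j, K i * K j = K j * K i;
  K_E : forall i j, K i * E j = (q ^+ eps i) ^ A i j *: (E j * K i);
  K_F : forall i j, K i * F_ j = (q ^+ eps i) ^ (- A i j) *: (F_ j * K i);
  E_F_neq : forall i j, i != j -> E i * F_ j = F_ j * E i;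
  E_F : forall i, E i * F_ i = F_ i * E i
    + (q ^+ eps i - (q ^+ eps i)^-1)^-1 *: (K i - Ki i)
}.

Section QuantumRelations.
Context (F : fieldType) (q : F) (n : nat) (A : 'M[int]_n) (eps : 'I_n -> nat).
Hypothesis q_neq0 : q != 0.
Hypothesis q_nroot : forall m, (0 < m)%N -> q ^+ m != 1.
Hypothesis symA : forall i j, (eps i)%:Z * A i j = (eps j)%:Z * A j i.
Hypothesis eps_gt0 : forall i, (0 < eps i)%N.
Context (R : algType F) (E F_ K Ki : 'I_n -> R).
Hypothesis rels : quantum_relations q A eps E F_ K Ki.
Implicit Types (x y u : R) (a : F).

Local Notation q_ i := (q ^+ eps i).
Local Notation K_Ki := (K_Ki rels).
Local Notation Ki_K := (Ki_K rels).
Local Notation K_K := (K_K rels).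
Local Notation K_E := (K_E rels).
Local Notation K_F := (K_F rels).
Local Notation E_F_neq := (E_F_neq rels).

Let sAl a x y : (a *: x) * y = a *: (x * y). Proof. by rewrite scalerAl. Qed.
Let sAr a x y : x * (a *: y) = a *: (x * y). Proof. by rewrite scalerAr. Qed.

Lemma qi_neq0 i : q_ i != 0. Proof. by rewrite expf_neq0. Qed.

Lemma qi_nroot i m : (0 < m)%N -> q_ i ^+ m != 1.
Proof. by move=> m0; rewrite -exprM q_nroot // muln_gt0 eps_gt0. Qed.

(** Only the eigenvalues of the K_i are recorded; they need not determine b, since A may be
    singular. *)
Definition kwt (b : 'rV[int]_n) x := forall i,
  K i * x = q_ i ^ root_at A b i *: (x * K i).

Lemma root_atD b c i : root_at A (b + c) i = root_at A b i + root_at A c i.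
Proof.
by rewrite /root_at -big_split; apply: eq_bigr => j _; rewrite mxE mulrDl.
Qed.

Lemma root_atN b i : root_at A (- b) i = - root_at A b i.
Proof.
by rewrite /root_at -sumrN; apply: eq_bigr => j _; rewrite mxE mulNr.
Qed.

Lemma root_at0 i : root_at A 0 i = 0.
Proof. by rewrite /root_at big1 // => j _; rewrite mxE mul0r. Qed.

Lemma root_at_simple i j : root_at A (simple j) i = A i j.
Proof.
rewrite /root_at (bigD1 j) //= mxE !eqxx mul1r big1 ?addr0 // => k kj.
by rewrite mxE (negPf kj) andbF mul0r.
Qed.

Lemma kwtM b c x y : kwt b x -> kwt c y -> kwt (b + c) (x * y).
Proof.
move=> bx cy i; rewrite mulrA bx sAl -mulrA cy sAr mulrA scalerA.
by rewrite root_atD expfzDr ?qi_neq0.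
Qed.

Lemma kwtD b x y : kwt b x -> kwt b y -> kwt b (x + y).
Proof. by move=> bx cy i; rewrite mulrDr mulrDl bx cy scalerDr. Qed.

Lemma kwtZ a b x : kwt b x -> kwt b (a *: x).
Proof. by move=> bx i; rewrite sAr bx sAl scalerA mulrC -scalerA. Qed.

Lemma kwt0 b : kwt b 0.
Proof. by move=> i; rewrite mulr0 mul0r scaler0. Qed.

Lemma kwtN b x : kwt b x -> kwt b (- x).
Proof. by move=> bx; rewrite -scaleN1r; apply: kwtZ. Qed.

Lemma kwt_E j : kwt (simple j) (E j).
Proof. by move=> i; rewrite root_at_simple K_E. Qed.

Lemma kwt_F j : kwt (- simple j) (F_ j).
Proof. by move=> i; rewrite root_atN root_at_simple K_F. Qed.

Lemma kwt_K j : kwt 0 (K j).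
Proof. by move=> i; rewrite root_at0 scale1r K_K. Qed.

Lemma K_mulr_inj i x y : x * K i = y * K i -> x = y.
Proof. by move=> /(congr1 (fun u => u * Ki i)); rewrite -!mulrA K_Ki !mulr1. Qed.

Lemma kwt_Ki j : kwt 0 (Ki j).
Proof.
move=> i; rewrite root_at0 scale1r; apply: (@K_mulr_inj j).
by rewrite -!mulrA Ki_K mulr1 -K_K [RHS]mulrA Ki_K mul1r.
Qed.

Lemma Ki_kwt b x i : kwt b x -> Ki i * x = q_ i ^ (- root_at A b i) *: (x * Ki i).
Proof.
move=> bx; have := bx i => /(congr1 (fun u => Ki i * u * Ki i)).
rewrite mulrA Ki_K mul1r sAr sAl -!mulrA K_Ki mulr1 => ->.
by rewrite scalerA -expfzDr ?qi_neq0 // addNr expr0z scale1r.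
Qed.

Lemma qi_pairing i j : q_ i ^ A i j = q_ j ^ A j i.
Proof. by rewrite !exprnP !exprz_exp symA. Qed.

Lemma qi_expz_inj i (a b : int) : q_ i ^ a = q_ i ^ b -> a = b.
Proof.
wlog ab : a b / a <= b.
  by move=> W e; case: (lerP a b) => [/W|/ltW /W] W'; [exact: W'|rewrite W'].
move=> e; have : q_ i ^ (b - a) = 1.
  by rewrite expfzDr ?qi_neq0 // -e -expfzDr ?qi_neq0 // subrr.
have [m bam] : exists m : nat, b - a = m%:Z.
  by exists `|b - a|%N; rewrite gez0_abs // subr_ge0.
rewrite bam -exprnP -exprM => /eqP; case: m bam => [|m] bam.
  by move/eqP: bam; rewrite subr_eq0 => /eqP.
by rewrite (negPf (q_nroot _)) // muln_gt0 eps_gt0.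
Qed.

(** The adjoint action of E_l, with coproduct and antipode written out. *)
Definition adE l u := E l * u - K l * u * Ki l * E l.

Lemma adE_linear l : linear (adE l).
Proof.
move=> a x y; rewrite /adE !(mulrDr, mulrDl, sAr, sAl).
by lmod F R; ring.
Qed.

Lemma adED l x y : adE l (x + y) = adE l x + adE l y.
Proof. by have := adE_linear l 1 x y; rewrite !scale1r. Qed.

Lemma adEZ l a x : adE l (a *: x) = a *: adE l x.
Proof. exact: (linear_scaleE _ _ (adE_linear l)). Qed.

Lemma adE0 l : adE l 0 = 0.
Proof. exact: (linear0E (adE_linear l)). Qed.

Lemma adEB l x y : adE l (x - y) = adE l x - adE l y.
Proof. by rewrite -scaleN1r adED adEZ scaleN1r. Qed.

Lemma adE1 l : adE l 1 = 0.
Proof. by rewrite /adE !mulr1 K_Ki mul1r subrr. Qed.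

Lemma K_conj b u l : kwt b u -> K l * u * Ki l = q_ l ^ root_at A b l *: u.
Proof. by move=> bu; rewrite bu sAl -mulrA K_Ki mulr1. Qed.

Lemma adE_kwt b u l : kwt b u -> adE l u = E l * u - q_ l ^ root_at A b l *: (u * E l).
Proof. by move=> bu; rewrite /adE (K_conj _ bu) sAl. Qed.

Lemma kwt_adE b u l : kwt b u -> kwt (simple l + b) (adE l u).
Proof.
move=> bu; rewrite (adE_kwt _ bu); apply: kwtD; first exact/kwtM/bu/kwt_E.
by apply/kwtN/kwtZ; rewrite addrC; apply/kwtM/kwt_E.
Qed.

Lemma adEM b x y l : kwt b x ->
  adE l (x * y) = adE l x * y + q_ l ^ root_at A b l *: (x * adE l y).
Proof.
move=> bx; rewrite (adE_kwt _ bx) /adE [K l * (x * y)]mulrA bx !sAl mulrBl mulrBr !sAl !mulrA.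
by move: (q_ l ^ _) => c; lmod F R; ring.
Qed.

(** Up to sign, u |-> (u F_m - F_m u) K_m is the adjoint action of F_m, and E_l commutes with
    F_m. *)
Lemma adE_F l m u : l != m ->
  adE l ((u * F_ m - F_ m * u) * K m) = (adE l u * F_ m - F_ m * adE l u) * K m.
Proof.
move=> lm; set c := q_ m ^ A m l.
have EK : E l * K m = c^-1 *: (K m * E l).
  by rewrite K_E scalerA mulVf ?expfz_neq0 ?qi_neq0 // scale1r.
have KF : Ki l * F_ m = c *: (F_ m * Ki l).
  by rewrite (Ki_kwt _ (kwt_F m)) root_atN opprK root_at_simple qi_pairing.
have FK : F_ m * K l = c *: (K l * F_ m).
  rewrite K_F scalerA /c [q_ m ^ _]qi_pairing -expfzDr ?qi_neq0 //.
  by rewrite subrr expr0z scale1r.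
have EF := E_F_neq lm.
have KiK : Ki l * K m = K m * Ki l.
  by have := kwt_Ki l m; rewrite /kwt root_at0 scale1r => ->.
have c0 : c != 0 by rewrite expfz_neq0 ?qi_neq0.
rewrite /adE !mulrBl !mulrBr !mulrBl.
have -> : K l * u * Ki l * E l * F_ m * K m = K l * (u * F_ m * K m) * Ki l * E l.
  rewrite -(mulrA _ (E l) (F_ m)) EF !mulrA -(mulrA _ (Ki l) (F_ m)) KF !(sAr, sAl) !mulrA.
  rewrite -(mulrA _ (E l) (K m)) EK !(sAr, sAl) scalerA mulfV // scale1r !mulrA.
  by rewrite -(mulrA _ (Ki l) (K m)) KiK !mulrA.
have -> : F_ m * (K l * u * Ki l * E l) * K m = K l * (F_ m * u * K m) * Ki l * E l.
  rewrite !mulrA FK !(sAl, sAr) -(mulrA _ (E l) (K m)) EK !(sAl, sAr) scalerA mulfV //.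
  by rewrite scale1r !mulrA -(mulrA _ (Ki l) (K m)) KiK !mulrA.
have -> : E l * (F_ m * u * K m) = F_ m * (E l * u) * K m by rewrite !mulrA EF.
by rewrite !mulrA; move: (_ * K m) => v; lmod F R; ring.
Qed.

End QuantumRelations.

(** * The sl2 relation for the adjoint action *)

Section AdjointAction.
Context (F : fieldType) (q : F) (n : nat) (A : 'M[int]_n) (eps : 'I_n -> nat).
Hypothesis q_neq0 : q != 0.
Hypothesis q_nroot : forall m, (0 < m)%N -> q ^+ m != 1.
Hypothesis symA : forall i j, (eps i)%:Z * A i j = (eps j)%:Z * A j i.
Hypothesis eps_gt0 : forall i, (0 < eps i)%N.
Hypothesis diagA : forall i, A i i = 2.
Context (R : algType F) (E F_ K Ki : 'I_n -> R).
Hypothesis rels : quantum_relations q A eps E F_ K Ki.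
Implicit Types (x y u : R) (a : F).

Local Notation q_ i := (q ^+ eps i).
Local Notation K_Ki := (K_Ki rels).
Local Notation Ki_K := (Ki_K rels).
Local Notation K_E := (K_E rels).
Local Notation K_F := (K_F rels).
Local Notation E_F := (E_F rels).
Local Notation kwt := (kwt q A eps K).
Local Notation adE := (adE E K Ki).

Let sAl a x y : (a *: x) * y = a *: (x * y). Proof. by rewrite scalerAl. Qed.
Let sAr a x y : x * (a *: y) = a *: (x * y). Proof. by rewrite scalerAr. Qed.

Definition adF l u := (F_ l * u - u * F_ l) * K l.

Definition qint (p : F) (m : int) : F := (p ^ m - p ^ (- m)) / (p - p^-1).

Lemma adF_linear l : linear (adF l).
Proof.
move=> a x y; rewrite /adF !(mulrBl, mulrDr, mulrDl, sAr, sAl).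
by lmod F R; ring.
Qed.

Lemma adF0 l : adF l 0 = 0.
Proof. exact: (linear0E (adF_linear l)). Qed.

Lemma adF_opp l u : (u * F_ l - F_ l * u) * K l = - adF l u.
Proof. by rewrite /adF -[RHS]mulNr opprB. Qed.

Lemma adE_adF_neq l m u : l != m -> adE l (adF m u) = adF m (adE l u).
Proof.
move=> lm; apply: oppr_inj; rewrite -adF_opp -(adE_F q_neq0 symA rels) // adF_opp.
by rewrite -[- adF m u]scaleN1r adEZ scaleN1r.
Qed.

Lemma adE_adF b l u : kwt b u ->
  adE l (adF l u) - adF l (adE l u) = qint (q_ l) (root_at A b l) *: u.
Proof.
move=> bu; set p := q_ l; set m := root_at A b l.
have p0 : p != 0 by rewrite qi_neq0.
have p2 : p - p^-1 != 0 by apply: qsubV_neq0 => // k; apply: qi_nroot.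
have KE2 : K l * E l = p ^+ 2 *: (E l * K l) by rewrite K_E diagA.
have KF2 : K l * F_ l = p ^- 2 *: (F_ l * K l) by rewrite K_F diagA.
have Ku : K l * u = p ^ m *: (u * K l) := bu l.
have Kiu : Ki l * u = p ^ (- m) *: (u * Ki l) := Ki_kwt q_neq0 rels l bu.
have KuKi : K l * u * Ki l = p ^ m *: u := K_conj rels l bu.
have pm0 : p ^ m != 0 by rewrite expfz_neq0.
have p20 : p ^+ 2 != 0 by rewrite expf_neq0.
have adEF : adE l (adF l u) = E l * F_ l * u * K l - E l * u * F_ l * K l
    - p ^ m *: (F_ l * u * E l * K l) + p ^ m *: (u * F_ l * E l * K l).
  have KKi v : v * K l * Ki l = v by rewrite -mulrA K_Ki mulr1.
  rewrite /adE /adF !mulrA KKi [K l * (_ - _)]mulrBr mulrBl !mulrA KF2 Ku !sAl.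
  rewrite -(mulrA (F_ l) (K l) u) Ku -(mulrA u (K l) (F_ l)) KF2 !(sAr, sAl) !mulrA.
  rewrite -(mulrA (F_ l * u) (K l)) -(mulrA (u * F_ l) (K l)) KE2 !sAr !mulrA.
  rewrite mulrBr mulrBl !mulrA; move: (p ^ m) (p ^+ 2) p20 => c d d0.
  by lmod F R; field.
have adFE : adF l (adE l u) = F_ l * E l * u * K l - p ^ m *: (F_ l * u * E l * K l)
    - E l * u * F_ l * K l + p ^ m *: (u * E l * F_ l * K l).
  rewrite (adE_kwt rels l bu) -/p -/m /adF !(mulrBr, mulrBl, sAr, sAl) !mulrA.
  by move: (p ^ m) => c; lmod F R; ring.
rewrite adEF adFE -(mulrA u (E l)) E_F -/p !(mulrDl, mulrDr, sAl, sAr) !mulrA.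
rewrite !(mulNr, mulrN) Ku Kiu !sAl -!(mulrA u (Ki l)) Ki_K !mulr1 /qint.
by rewrite -invr_expz; move: (p ^ m) pm0 (p - p^-1) p2 => c c0 d d0; lmod F R; field; rewrite ?c0 ?d0.
Qed.

End AdjointAction.

(** * Injectivity in locally nilpotent sl2-modules *)

Section SL2.
Context (F : fieldType) (p : F).
Hypothesis p_neq0 : p != 0.
Hypothesis p_nroot : forall m, (0 < m)%N -> p ^+ m != 1.
Context (V : lmodType F).

Lemma qintN (m : int) : qint p (- m) = - qint p m.
Proof. by rewrite /qint opprK -mulNr opprB. Qed.

(** Induction on N reduces to e x = 0, since e x has weight m + 2 and is killed by f^(k+1). Then e
    recovers f^j x from f^(j+1) x for j < k, up to a factor that is nonzero because k <= m. *)
Lemma sl2_inj (e f : V -> V) (wt : int -> V -> Prop) N (m k : nat) x :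
  linear e -> linear f ->
  (forall a y, wt a y -> wt (a + 2) (e y)) -> (forall a y, wt a y -> wt (a - 2) (f y)) ->
  (forall a y, wt a y -> e (f y) - f (e y) = qint p a *: y) ->
  wt m x -> iter N e x = 0 -> (k <= m)%N -> iter k f x = 0 -> x = 0.
Proof.
move=> line linf wte wtf efE.
have linf_add y y' : f (y + y') = f y + f y' by have := linf 1 y y'; rewrite !scale1r.
(* This is [j+1] [M-j], written so that j may exceed M. *)
pose c (M j : nat) := qnum p j.+1 * ((p ^+ M / p ^+ j - p ^+ j / p ^+ M) / (p - p^-1)).
have efS (M j : nat) y : wt M%:Z y ->
    e (iter j.+1 f y) = iter j.+1 f (e y) + c M j *: iter j f y.
  move=> wty; have wtj i : wt (M%:Z - 2 * i%:Z) (iter i f y).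
    elim: i => [|i IHi]; first by rewrite mulr0 subr0.
    have := wtf _ _ IHi; rewrite iterS; congr (wt _ _); lia.
  have M0 : p ^+ M != 0 by rewrite expf_neq0.
  have d0 := qsubV_neq0 p_neq0 p_nroot; have q0 := qsqr_neq1 p_nroot.
  have qE i : qint p (M%:Z - 2 * i%:Z) =
      (p ^+ M / (p ^+ i * p ^+ i) - (p ^+ i * p ^+ i) / p ^+ M) / (p - p^-1).
    have e2 : 2 * i%:Z = (i + i)%N :> int by lia.
    have pE : p ^ (M%:Z - 2 * i%:Z) = p ^+ M / (p ^+ i * p ^+ i).
      by rewrite e2 expfzDr // -invr_expz -!exprnP exprD.
    by rewrite /qint -invr_expz pE invf_div.
  have cE : forall j, e (iter j.+1 f y) = f (e (iter j f y)) + qint p (M%:Z - 2 * j%:Z) *: iter j f y.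
    by move=> i; have := efE _ _ (wtj i) => /eqP; rewrite subr_eq addrC => /eqP.
  elim: j => [|j IHj].
    rewrite cE /= qE expr0 /c expr0 qnum1 // mul1r; congr (_ + _ *: _).
    by rewrite !mul1r.
  rewrite cE IHj linf_add (linear_scaleE _ _ linf) -addrA -(iterS j f) -scalerDl.
  congr (_ + _ *: _); rewrite qE /c /qnum !exprS.
  have j0 : p ^+ j != 0 by rewrite expf_neq0.
  by field; rewrite M0 p_neq0 q0 j0.
have c_neq0 (M j : nat) : (j < M)%N -> c M j != 0.
  move=> jM; have M0 : p ^+ M != 0 by rewrite expf_neq0.
  have j0 : p ^+ j != 0 by rewrite expf_neq0.
  rewrite mulf_neq0 ?qnum_neq0 // mulf_neq0 ?invr_eq0 ?qsubV_neq0 // subr_eq0.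
  apply: contra (p_nroot (m := (M - j) * 2) _) => [/eqP eM|]; last by lia.
  have -> : p ^+ ((M - j) * 2) = (p ^+ M / p ^+ j) ^+ 2.
    by rewrite exprM -{2}(subnK (ltnW jM)) exprD mulfK.
  by rewrite expr2 {1}eM mulrA divfK // divff.
elim: N m k x => [|N IHN] m k x wtx eN km fk; first exact: eN.
have ex0 : e x = 0.
  have wtex : wt m.+2 (e x) by have := wte _ _ wtx; congr (wt _ _); lia.
  have eNex : iter N e (e x) = 0 by rewrite -iterSr.
  have fkex : iter k.+1 f (e x) = 0.
    have := efS m k x wtx; rewrite iterS fk (linear0E linf) (linear0E line).
    by rewrite scaler0 addr0 => <-.
  by apply: (IHN m.+2 k.+1 (e x) wtex eNex _ fkex); lia.
elim: k km fk => [|k IHk] km fk //.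
apply: IHk; first exact: ltnW.
have := efS m k x wtx; rewrite fk (linear0E line) ex0.
have -> : iter k.+1 f 0 = 0 by apply: (linear0E (linear_iter _ linf)).
by rewrite add0r => /esym/eqP; rewrite scaler_eq0 (negPf (c_neq0 _ _ km)) => /eqP.
Qed.

End SL2.

(** * Extremal weights *)
Section Extremal.
Context (F : fieldType) (q : F) (n : nat) (A : 'M[int]_n) (eps : 'I_n -> nat).
Hypothesis q_neq0 : q != 0.
Hypothesis q_nroot : forall m, (0 < m)%N -> q ^+ m != 1.
Hypothesis symA : forall i j, (eps i)%:Z * A i j = (eps j)%:Z * A j i.
Hypothesis eps_gt0 : forall i, (0 < eps i)%N.
Hypothesis diagA : forall i, A i i = 2.
Context (R : algType F) (E F_ K Ki : 'I_n -> R).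
Hypothesis rels : quantum_relations q A eps E F_ K Ki.
Implicit Types (x y u : R) (a : F).

Local Notation q_ i := (q ^+ eps i).
Local Notation E_F_neq := (E_F_neq rels).
Local Notation kwt := (kwt q A eps K).
Local Notation adE := (adE E K Ki).

Hypothesis offdiagA : forall i j, i != j -> A i j <= 0.
Context (X : {set 'I_n}) (j0 : 'I_n).
Hypothesis j0X : j0 \notin X.
Local Notation adF := (adF F_ K).

Definition adw (w : seq 'I_n) u := foldr adE u w.
Definition wsum (w : seq 'I_n) : 'rV[int]_n := \sum_(l <- w) simple l.

Lemma wsum_cons l w : wsum (l :: w) = simple l + wsum w.
Proof. by rewrite /wsum big_cons. Qed.

Lemma wsum_ge0 w l : 0 <= wsum w 0 l.
Proof.
by rewrite /wsum summxE; apply: sumr_ge0 => i _; rewrite mxE ler0n.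
Qed.

Lemma kwt_adw w b u : kwt b u -> kwt (wsum w + b) (adw w u).
Proof.
move=> bu; elim: w => [|l w IHw] /=; first by rewrite /wsum big_nil add0r.
by rewrite wsum_cons -addrA; apply: (kwt_adE q_neq0 rels).
Qed.

(* The ad-span of E_{j0} under the E_l, l in X, in weight b + alpha_{j0} *)
Inductive in_span : 'rV[int]_n -> R -> Prop :=
| span_word w : {subset w <= X} -> in_span (wsum w) (adw w (E j0))
| span_0 b : in_span b 0
| span_add b x y : in_span b x -> in_span b y -> in_span b (x + y)
| span_scale b a x : in_span b x -> in_span b (a *: x).

Lemma span_kwt b x : in_span b x -> kwt (b + simple j0) x.
Proof.
elim=> {b x}[w _|b|b x y _ IHx _ IHy|b a x _ IHx].
- by apply: kwt_adw; apply: (kwt_E rels).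
- exact: kwt0.
- exact: kwtD.
- exact: kwtZ.
Qed.

Lemma span_adE b x l : l \in X -> in_span b x -> in_span (simple l + b) (adE l x).
Proof.
move=> lX; elim=> {b x}[w wX|b|b x y _ IHx _ IHy|b a x _ IHx].
- rewrite -wsum_cons; apply: (span_word (w := l :: w)) => k.
  by rewrite in_cons => /orP[/eqP->|/wX].
- by rewrite adE0; apply: span_0.
- by rewrite adED; apply: span_add.
- by rewrite adEZ; apply: span_scale.
Qed.

(** As j0 is not in X, F_l commutes with E_{j0}, which is thus a lowest weight vector; the sl2
    relation moves ad F_l through a word. *)
Lemma span_adF b x l : l \in X -> in_span b x -> in_span (b - simple l) (adF l x).
Proof.
move=> lX; elim=> {b x}[w wX|b|b x y _ IHx _ IHy|b a x _ IHx].
- elim: w wX => [|m w IHw] wX.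
    rewrite /adw /= /adF.
    have -> : F_ l * E j0 = E j0 * F_ l.
      by rewrite (E_F_neq _) //; apply: contra j0X => /eqP->.
    by rewrite subrr mul0r; apply: span_0.
  have {}IHw : in_span (wsum w - simple l) (adF l (adw w (E j0))).
    by apply: IHw => k kw; apply: wX; rewrite in_cons kw orbT.
  have mX : m \in X by apply: wX; rewrite mem_head.
  rewrite wsum_cons -addrA /=; have [eml|ml] := eqVneq m l; last first.
    by rewrite -(adE_adF_neq q_neq0 symA rels) //; apply: span_adE.
  have -> : adF l (adE m (adw w (E j0))) = adE m (adF l (adw w (E j0)))
      - qint (q_ l) (root_at A (wsum w + simple j0) l) *: adw w (E j0).
    have := adE_adF q_neq0 q_nroot eps_gt0 diagA rels l (kwt_adw w (kwt_E rels j0)).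
    by rewrite eml => <-; rewrite opprB addrCA subrr addr0.
  apply: span_add; first exact: span_adE.
  rewrite -scaleNr eml addrC subrK; apply/span_scale/span_word => k kw.
  by apply: wX; rewrite in_cons kw orbT.
- by rewrite adF0; apply: span_0.
- have adFD u v : adF l (u + v) = adF l u + adF l v.
    by have := adF_linear F_ K l 1 u v; rewrite !scale1r.
  by rewrite adFD; apply: span_add.
- by rewrite (linear_scaleE _ _ (adF_linear F_ K l)); apply: span_scale.
Qed.

Lemma span_neg b x l : in_span b x -> b 0 l < 0 -> x = 0.
Proof.
elim=> {b x}[w _|b|b x y _ IHx _ IHy|b a x _ IHx] bl //.
- by have := wsum_ge0 w l; rewrite leNgt bl.
- by rewrite IHx // IHy // addr0.
- by rewrite IHx // scaler0.
Qed.

Definition ad_nilpotent l x := exists N, iter N (adE l) x = 0.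

Lemma iter_adE0 l N : iter N (adE l) 0 = 0.
Proof. exact: (linear0E (linear_iter N (adE_linear E K Ki l))). Qed.

Lemma iter_adED l N x y : iter N (adE l) (x + y) = iter N (adE l) x + iter N (adE l) y.
Proof. by have := linear_iter N (adE_linear E K Ki l) 1 x y; rewrite !scale1r. Qed.

Lemma iter_adEZ l N a x : iter N (adE l) (a *: x) = a *: iter N (adE l) x.
Proof. exact: (linear_scaleE _ _ (linear_iter N (adE_linear E K Ki l))). Qed.

Lemma ad_nilpotentD l x y : ad_nilpotent l x -> ad_nilpotent l y -> ad_nilpotent l (x + y).
Proof.
move=> [N xN] [M yM]; exists (N + M)%N.
by rewrite iter_adED {1}addnC !iterD xN yM !iter_adE0 addr0.
Qed.

Lemma ad_nilpotentZ l a x : ad_nilpotent l x -> ad_nilpotent l (a *: x).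
Proof. by move=> [N xN]; exists N; rewrite iter_adEZ xN scaler0. Qed.

(** The twisted Leibniz rule [adEM] splits the N+M applications between the two factors. *)
Lemma ad_nilpotentM l b x y : kwt b x ->
  ad_nilpotent l x -> ad_nilpotent l y -> ad_nilpotent l (x * y).
Proof.
move=> bx [N xN] [M yM]; exists (N + M)%N.
elim: N M b x y bx xN yM => [|N IHN] M b x y bx; first by rewrite /= => -> _; rewrite mul0r iter_adE0.
elim: M b x y bx => [|M IHM] b x y bx xN; first by move=> /= ->; rewrite mulr0 -(iterS _ (adE l)) iter_adE0.
move=> yM; rewrite addSn iterSr (adEM rels _ _ bx).
rewrite iter_adED iter_adEZ (IHN M.+1 (simple l + b)) //; first last.
- by rewrite -iterSr.
- exact: (kwt_adE q_neq0 rels).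
by rewrite add0r addnS -addSn (IHM b) ?scaler0 // -iterSr.
Qed.

(** For kap = 0 the recurrence is the iterated adjoint action, [diag] being the K_l-eigenvalue of
    its r-th term. *)
Lemma iter_adE_serre l m : l != m ->
  let N := `|1 - A l m|%N in
  iter N (adE l) (E m) = serre (q_ l) N (E l) (E m).
Proof.
move=> lm N; have NE : A l m = 1 - N%:Z by have := offdiagA lm; rewrite /N; clear; lia.
pose y r := bchain (q_ l) (E l) 0 N r (E m).
have iterE r : iter r (adE l) (E m) = y r /\ kwt (wsum (nseq r l) + simple m) (y r).
  elim: r => [|r [IHr ky]].
    rewrite /y /bchain chain0E /=; split=> //; rewrite /wsum big_nil add0r.
    exact: (kwt_E rels).
  have yS : adE l (y r) = y r.+1.
    rewrite (adE_kwt rels l ky) root_atD root_at_simple NE.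
    have -> : root_at A (wsum (nseq r l)) l = 2 * r%:Z.
      elim: {ky IHr} r => [|r IHr]; first by rewrite /wsum big_nil root_at0 mulr0.
      by rewrite /= wsum_cons root_atD root_at_simple IHr diagA; clear; lia.
    have -> : q_ l ^ (2 * r%:Z + (1 - N%:Z)) = diag (q_ l) N r.
      have e2 : 2 * r%:Z = (r + r)%N :> int by clear; lia.
      rewrite e2 !expfzDr ?qi_neq0 // -invr_expz -!exprnP exprD /diag ?expr1.
      by rewrite expr2; ring.
    case: (r) => [|r']; first by rewrite /y /bchain chain1E chain0E.
    by rewrite /y /bchain chainSS /(lmul 0) mul0r scaler0 subr0.
  rewrite iterS IHr yS; split=> //; rewrite /= wsum_cons -addrA -yS.
  exact: (kwt_adE q_neq0 rels).
rewrite (iterE N).1 /y serre_bchain ?qi_neq0 //.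
by move=> k; apply: qi_nroot.
Qed.

Hypothesis serre_E : forall l m, l != m ->
  serre (q_ l) `|1 - A l m|%N (E l) (E m) = 0.

Lemma ad_nilpotent_E l m : l != m -> ad_nilpotent l (E m).
Proof.
by move=> lm; exists `|1 - A l m|%N; rewrite iter_adE_serre // serre_E.
Qed.

(** The Serre relation handles each E_m with m != l. A letter m != l of a word is written as a
    q-commutator, to which the Leibniz rule applies; a letter l only shortens the iteration. *)
Lemma span_nilpotent b x l : l \in X -> in_span b x -> ad_nilpotent l x.
Proof.
move=> lX; elim=> {b x}[w|b|b x y _ IHx _ IHy|b a x _ IHx].
- elim: w => [|m w IHw] wX /=.
    by apply: ad_nilpotent_E; apply: contra j0X => /eqP<-.
  have {IHw}IHw : ad_nilpotent l (adw w (E j0)).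
    by apply: IHw => k kw; apply: wX; rewrite in_cons kw orbT.
  have [eml|ml] := eqVneq m l.
    by rewrite eml; have [N xN] := IHw; exists N; rewrite -iterSr iterS xN adE0.
  have kw := kwt_adw w (kwt_E rels j0).
  rewrite (adE_kwt rels m kw) -scaleNr; apply: ad_nilpotentD.
    by apply: (ad_nilpotentM (kwt_E rels m)) => //; apply: ad_nilpotent_E; rewrite eq_sym.
  apply/ad_nilpotentZ/(ad_nilpotentM kw) => //.
  by apply: ad_nilpotent_E; rewrite eq_sym.
- by exists 0%N.
- exact: ad_nilpotentD.
- exact: ad_nilpotentZ.
Qed.

Lemma iter_span_adE b x l k : l \in X -> in_span b x ->
  in_span (b + k%:Z *: simple l) (iter k (adE l) x).
Proof.
move=> lX bx; elim: k => [|k IHk]; first by rewrite scale0r addr0.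
rewrite iterS intS scalerDl scale1r addrCA.
exact: span_adE.
Qed.

Lemma iter_span_adF b x l k : l \in X -> in_span b x ->
  in_span (b - k%:Z *: simple l) (iter k (adF l) x).
Proof.
move=> lX bx; elim: k => [|k IHk]; first by rewrite scale0r subr0.
by rewrite iterS intS [_ + k%:Z]addrC scalerDl scale1r opprD addrA; apply: span_adF.
Qed.

Lemma adF_nilpotent b x l : l \in X -> in_span b x ->
  exists N, iter N (adF l) x = 0.
Proof.
move=> lX bx; exists `|b 0 l|.+1.
apply: (span_neg (l := l)) (iter_span_adF _ lX bx) _.
rewrite !mxE !eqxx mulr1 intS; have := lez_abs (b 0 l).
by move: (b 0 l) => t; rewrite ?absz_nat; clear; lia.
Qed.

(** Reflection symmetry of the weights of an integrable module: |m| applications of ad F_l or ad E_l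
    do not kill x, by [sl2_inj]. *)
Lemma span_refl b x l : l \in X -> in_span b x -> x != 0 ->
  exists b' x', [/\ in_span b' x', x' != 0 & b' + simple j0 = refl A l (b + simple j0)].
Proof.
move=> lX bx x0; have p0 := qi_neq0 eps q_neq0 l.
have pr k : (0 < k)%N -> q_ l ^+ k != 1 by apply: qi_nroot.
(* The sign makes [sl2_inj] applicable to negative m as well, with ad E_l and ad F_l exchanged. *)
pose wt (sg : int) (a : int) y :=
  exists b, in_span b y /\ root_at A (b + simple j0) l = sg * a.
have atl : root_at A (simple l) l = 2 by rewrite root_at_simple diagA.
set m := root_at A (b + simple j0) l; rewrite /refl -/m.
have [m0|m0] := lerP 0 m.
- have [N xN] := span_nilpotent lX bx.
  have em : m = `|m|%N by rewrite gez0_abs.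
  exists (b - `|m|%N%:Z *: simple l), (iter `|m| (adF l) x); split.
  + exact: iter_span_adF.
  + apply: contraNneq x0 => fx; apply/eqP.
    apply: (sl2_inj p0 pr (wt := wt 1) (adE_linear E K Ki l) (adF_linear F_ K l)
             _ _ _ _ xN (leqnn `|m|) fx) => [a y [b1 [b1y e1]]|a y [b1 [b1y e1]]|a y [b1 [b1y e1]]|].
    * exists (simple l + b1); split; first exact: span_adE.
      by rewrite -addrA root_atD atl e1 !mul1r addrC.
    * exists (b1 - simple l); split; first exact: span_adF.
      by rewrite addrAC root_atD root_atN atl e1 !mul1r.
    * rewrite (adE_adF q_neq0 q_nroot eps_gt0 diagA rels l (span_kwt b1y)).
      by rewrite e1 mul1r.
    * by exists b; split=> //; rewrite mul1r -em.
  + by rewrite -em addrAC.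
- have [N xN] := adF_nilpotent lX bx.
  have em : m = - `|m|%N%:Z by rewrite ltz0_abs ?opprK.
  exists (b + `|m|%N%:Z *: simple l), (iter `|m| (adE l) x); split.
  + exact: iter_span_adE.
  + apply: contraNneq x0 => fx; apply/eqP.
    apply: (sl2_inj p0 pr (wt := wt (-1)) (adF_linear F_ K l) (adE_linear E K Ki l)
             _ _ _ _ xN (leqnn `|m|) fx) => [a y [b1 [b1y e1]]|a y [b1 [b1y e1]]|a y [b1 [b1y e1]]|].
    * exists (b1 - simple l); split; first exact: span_adF.
      by rewrite addrAC root_atD root_atN atl e1; clear; lia.
    * exists (simple l + b1); split; first exact: span_adE.
      by rewrite -addrA root_atD atl e1; clear; lia.
    * have := adE_adF q_neq0 q_nroot eps_gt0 diagA rels l (span_kwt b1y).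
      move/(congr1 -%R); rewrite opprB => ->.
      by rewrite e1 mulN1r qintN scaleNr opprK.
    * by exists b; split=> //; rewrite mulN1r -em.
  + by rewrite {2}em scaleNr opprK addrAC.
Qed.

Lemma span_weyl w b x : {subset w <= X} -> in_span b x -> x != 0 ->
  exists b' x', [/\ in_span b' x', x' != 0 & b' + simple j0 = weyl A w (b + simple j0)].
Proof.
move=> wX bx x0; elim: w wX => [|l w IHw] wX; first by exists b, x.
have [|b' [x' [bx' x0' eb']]] := IHw.
  by move=> k kw; apply: wX; rewrite in_cons kw orbT.
rewrite /= -eb'; apply: (span_refl _ bx' x0').
by apply: wX; rewrite mem_head.
Qed.

(* Reflected by w, a nonzero [adE l x] would have weight simple j0 - simple m,
   and the weights of the span lie above simple j0. *)
Lemma span_highest w b x l m : {subset w <= X} -> l \in X -> m \in X ->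
  in_span b x -> weyl A w (b + simple j0) = simple j0 ->
  weyl A w (simple l) = - simple m -> adE l x = 0.
Proof.
move=> wX lX mX bx wb wl; apply/eqP/negPn/negP => x0.
have [b' [x' [bx' x0' eb']]] := span_weyl wX (span_adE lX bx) x0.
have weylD (u v : 'rV[int]_n) : weyl A w (u + v) = weyl A w u + weyl A w v.
  elim: (w) => //= k w' ->; rewrite /refl root_atD scalerDl opprD.
  by rewrite addrACA.
move: eb'; rewrite -addrA weylD wb wl => /(canRL (addrK _)); rewrite addrK => eb'.
move/eqP: x0'; apply; apply: (span_neg (l := m) bx').
by rewrite eb' !mxE !eqxx.
Qed.

End Extremal.

(** * The quantum group *)
Section QuantumGroup.
Context (F : fieldType) (q : F) (n : nat) (A : 'M[int]_n) (eps : 'I_n -> nat).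

Local Notation U := (Uq q A eps).
Local Notation E i := (Ugen q A eps (GE i)).
Local Notation F_ i := (Ugen q A eps (GF i)).
Local Notation K i := (Ugen q A eps (GK i)).
Local Notation Ki i := (Ugen q A eps (GKi i)).
Local Notation q_ i := (q ^+ eps i).
Local Notation adE := (adE (fun l => E l) (fun l => K l) (fun l => Ki l)).
Local Notation adw := (adw (fun l => E l) (fun l => K l) (fun l => Ki l)).
Local Notation pi := (@Uq_pi F q n A eps).
Implicit Types (x y u : U) (a : F).

Lemma relatorE (x : freeA F n) : relator q A eps x -> pi x = 0.
Proof. by move=> rx; rewrite -(rmorph0 pi); apply/Uq_piP; rewrite subr0; apply: ideal_rel. Qed.

Let UK_Ki i : K i * Ki i = 1.
Proof.
apply/eqP; rewrite -subr_eq0; apply/eqP.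
by rewrite !UgenE -rmorphM -(rmorph1 pi) -rmorphB; apply/relatorE/rel_KKi.
Qed.

Let UKi_K i : Ki i * K i = 1.
Proof.
apply/eqP; rewrite -subr_eq0; apply/eqP.
by rewrite !UgenE -rmorphM -(rmorph1 pi) -rmorphB; apply/relatorE/rel_KiK.
Qed.

Let UK_K i j : K i * K j = K j * K i.
Proof.
apply/eqP; rewrite -subr_eq0; apply/eqP.
by rewrite !UgenE -!rmorphM -rmorphB; apply/relatorE/rel_KK.
Qed.

Let UK_E i j : K i * E j = q_ i ^ A i j *: (E j * K i).
Proof.
apply/eqP; rewrite -subr_eq0; apply/eqP.
by rewrite !UgenE -!rmorphM -linearZZ -rmorphB; apply/relatorE/rel_KE.
Qed.

Let UK_F i j : K i * F_ j = q_ i ^ (- A i j) *: (F_ j * K i).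
Proof.
apply/eqP; rewrite -subr_eq0; apply/eqP.
by rewrite !UgenE -!rmorphM -linearZZ -rmorphB; apply/relatorE/rel_KF.
Qed.

Let UE_F_neq i j : i != j -> E i * F_ j = F_ j * E i.
Proof.
move=> ij; apply/eqP; rewrite -subr_eq0; apply/eqP.
rewrite !UgenE -!rmorphM -rmorphB; apply: relatorE.
by have := rel_EF q A eps i j; rewrite (negPf ij) subr0.
Qed.

Let UE_F i : E i * F_ i = F_ i * E i + (q_ i - (q_ i)^-1)^-1 *: (K i - Ki i).
Proof.
apply/eqP; rewrite -subr_eq0 opprD addrA; apply/eqP.
rewrite !UgenE -!rmorphM -!rmorphB -linearZZ -rmorphB; apply: relatorE.
by have := rel_EF q A eps i i; rewrite eqxx.
Qed.

Lemma pi_Fij i j (x y : freeA F n) :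
  pi (Fij q A eps i j x y) = Fij q A eps i j (pi x) (pi y).
Proof.
rewrite /Fij (rmorph_sum pi); apply: eq_bigr => l _.
by rewrite -!rmorphXn -!rmorphM; apply: Uq_pi_is_scalable.
Qed.

Lemma Uq_serre_E i j : i != j ->
  serre (q_ i) `|1 - A i j|%N (E i) (E j) = 0.
Proof. by move=> ij; rewrite -[LHS]/(Fij _ _ _ _ _ _ _) !UgenE -pi_Fij; apply/relatorE/rel_serreE. Qed.

Lemma Uq_serre_F i j : i != j ->
  serre (q_ i) `|1 - A i j|%N (F_ i) (F_ j) = 0.
Proof. by move=> ij; rewrite -[LHS]/(Fij _ _ _ _ _ _ _) !UgenE -pi_Fij; apply/relatorE/rel_serreF. Qed.

Lemma Uq_relations : quantum_relations q A eps
  (fun l => E l) (fun l => F_ l) (fun l => K l) (fun l => Ki l).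
Proof.
by split; [exact: UK_Ki|exact: UKi_K|exact: UK_K|exact: UK_E|exact: UK_F
  |exact: UE_F_neq|exact: UE_F].
Qed.

Lemma ad_nil u : ad [::] u = u.
Proof.
by rewrite /ad big_seq1 /monomial /antipode !big_nil mul1r mulr1.
Qed.

Lemma ad_cons l (w : seq (gen n)) u : ad (GE l :: w) u = adE l (ad w u).
Proof.
have adEE v : adE l v = E l * v - K l * v * Ki l * E l by [].
rewrite adEE /ad /= cats0 big_cat !big_map /= mulr_sumr !mulr_sumr !mulr_suml.
rewrite -sumrN; congr (_ + _); apply: eq_bigr => x _.
  by rewrite /monomial big_cons !mulrA.
rewrite /monomial big_cons [antipode _ _ _ (_ :: _)]/antipode rev_cons big_rcons /=.
by rewrite !mulrN !mulrA.
Qed.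

Lemma ad_wordE (w : seq 'I_n) u : ad (map (@GE n) w) u = adw w u.
Proof. by elim: w => [|l w IHw] /=; rewrite ?ad_nil // ad_cons IHw. Qed.

End QuantumGroup.

(** * The generators are nonzero *)
Section SerreCommutes.
Context (F : fieldType) (q : F) (n : nat) (A : 'M[int]_n) (eps : 'I_n -> nat).
Hypothesis q_neq0 : q != 0.
Hypothesis q_nroot : forall m, (0 < m)%N -> q ^+ m != 1.
Hypothesis two_neq0 : 2 != 0 :> F.
Hypothesis symA : forall i j, (eps i)%:Z * A i j = (eps j)%:Z * A j i.
Hypothesis eps_gt0 : forall i, (0 < eps i)%N.
Hypothesis diagA : forall i, A i i = 2.
Hypothesis offdiagA : forall i j, i != j -> A i j <= 0.
Context (R : algType F) (E F_ K Ki : 'I_n -> R).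
Hypothesis rels : quantum_relations q A eps E F_ K Ki.
Implicit Types (x y u : R) (a : F).

Local Notation q_ i := (q ^+ eps i).
Local Notation adE := (adE E K Ki).
Local Notation adF := (adF F_ K).

Let sAl a x y : (a *: x) * y = a *: (x * y). Proof. by rewrite scalerAl. Qed.
Let sAr a x y : x * (a *: y) = a *: (x * y). Proof. by rewrite scalerAr. Qed.

Lemma quantum_relations_swap : quantum_relations q A eps F_ E Ki K.
Proof.
split=> [i|i|i j|i j|i j|i j ij|i].
- exact: (Ki_K rels).
- exact: (K_Ki rels).
- by have := kwt_Ki rels j i; have := Ki_kwt q_neq0 rels i (kwt_Ki rels j); rewrite root_at0 oppr0 expr0z scale1r.
- by rewrite (Ki_kwt q_neq0 rels i (kwt_F rels j)) root_atN root_at_simple opprK.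
- by rewrite (Ki_kwt q_neq0 rels i (kwt_E rels j)) root_at_simple.
- by rewrite (E_F_neq rels) // eq_sym.
- rewrite (E_F rels) -addrA -scalerDr; set k := K i; set k' := Ki i.
  by rewrite [k - k' + _]addrC subrKA subrr scaler0 addr0.
Qed.

Lemma kwt_iter_adE l m r : kwt q A eps K (wsum (nseq r l) + simple m) (iter r (adE l) (E m)).
Proof.
elim: r => [|r IHr] /=; first by rewrite /wsum big_nil add0r; apply: (kwt_E rels).
by rewrite wsum_cons -addrA; apply: (kwt_adE q_neq0 rels).
Qed.

Lemma root_at_nseq l r : root_at A (wsum (nseq r l)) l = 2 * r%:Z.
Proof.
elim: r => [|r IHr]; first by rewrite /wsum big_nil root_at0 mulr0.
by rewrite /= wsum_cons root_atD root_at_simple IHr diagA intS mulrDr mulr1.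
Qed.

Let commF k x : (x * F_ k - F_ k * x) * K k = 0 -> x * F_ k = F_ k * x.
Proof.
by rewrite -(mul0r (K k)) => /(K_mulr_inj rels)/eqP; rewrite subr_eq0 => /eqP.
Qed.

Lemma iter_adE_F l k x r : l != k ->
  (iter r (adE l) x * F_ k - F_ k * iter r (adE l) x) * K k =
  iter r (adE l) ((x * F_ k - F_ k * x) * K k).
Proof.
by move=> lk; elim: r => //= r <-; rewrite -(adE_F q_neq0 symA rels).
Qed.

Lemma iter_adE_KK l m r :
  iter r (adE l) (K m * K m) =
  (\prod_(s < r) (1 - (q_ l) ^ (2 * s%:Z + 2 * A l m))) *: (E l ^+ r * (K m * K m)).
Proof.
elim: r => [|r IHr]; first by rewrite big_ord0 scale1r expr0 mul1r.
have kr : kwt q A eps K (wsum (nseq r l) + 0) (E l ^+ r * (K m * K m)).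
  apply: (kwtM q_neq0).
    elim: {IHr} r => [|r IHr].
      by rewrite expr0 /wsum big_nil => i; rewrite root_at0 scale1r mulr1 mul1r.
    by rewrite exprS wsum_cons; apply: (kwtM q_neq0) => //; apply: (kwt_E rels).
  by rewrite -[0]addr0; apply: (kwtM q_neq0); apply: (kwt_K rels).
rewrite iterS IHr adEZ (adE_kwt rels l kr) addr0 root_at_nseq big_ord_recr /=.
have -> : E l ^+ r * (K m * K m) * E l = q_ l ^ (2 * A l m) *: (E l ^+ r.+1 * (K m * K m)).
  rewrite -!mulrA (K_E rels) !sAr (mulrA (K m)) (K_E rels) !sAl sAr scalerA.
  have -> : q_ m ^ A m l * q_ m ^ A m l = q_ l ^ (2 * A l m).
    by rewrite -(qi_pairing q symA l m) -expfzDr ?qi_neq0 //; congr (_ ^ _); clear; lia.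
  by rewrite exprSr -!mulrA.
by rewrite mulrA -exprS scalerA -expfzDr ?qi_neq0 // -{1}[E l ^+ _ * _]scale1r -scalerBl scalerA.
Qed.

Lemma adF_iter_adE l m r : l != m ->
  adF l (iter r (adE l) (E m)) =
  - (\sum_(s < r) qint (q_ l) (2 * s%:Z + A l m)) *: iter r.-1 (adE l) (E m).
Proof.
move=> lm; have ml : m != l by rewrite eq_sym.
elim: r => [|r IHr].
  by rewrite /= big_ord0 oppr0 scale0r /adF (E_F_neq rels) // subrr mul0r.
have := adE_adF q_neq0 q_nroot eps_gt0 diagA rels l (kwt_iter_adE l m r).
rewrite root_atD root_at_nseq root_at_simple big_ord_recr /=.
move/(canRL (subrK _))/esym; rewrite addrC => /(canRL (addKr _)) ->.
rewrite IHr adEZ; case: r {IHr} => [|r] /=.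
  by rewrite !big_ord0 addr0 oppr0 scale0r addr0 scaleNr.
by rewrite -scaleNr -scalerDl -opprD.
Qed.

(** This precedes the Serre relations and serves to establish them on a module. For k != l, ad F_k
    commutes with ad E_l, so only its effect on E_m matters; for k = l the sl2 relation gives a
    scalar multiple of the previous iterate. *)
Lemma serre_E_comm_F l m k : l != m ->
  let S := serre (q_ l) `|1 - A l m|%N (E l) (E m) in S * F_ k = F_ k * S.
Proof.
move=> lm S; set N := `|1 - A l m|%N.
have NE : A l m = 1 - N%:Z by have := offdiagA lm; rewrite /N; clear; lia.
have N0 : (0 < N)%N by have := offdiagA lm; rewrite /N; clear; lia.
have SE : S = iter N (adE l) (E m).
  by rewrite (iter_adE_serre q_neq0 q_nroot eps_gt0 diagA rels offdiagA lm).
have [->|kl] := eqVneq k l.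
  have SF : adF l S = 0.
    rewrite SE adF_iter_adE //; set g := \sum_(s < N) _.
    suff -> : g = 0 by rewrite oppr0 scale0r.
    (* The summands are [2s+1-N], which change sign under s -> N-1-s. *)
    have gN : g = - g.
      rewrite {1}/g (reindex_inj rev_ord_inj) /= /g -sumrN; apply: eq_bigr => s _.
      rewrite -qintN NE; congr qint; have := ltn_ord s; clear; lia.
    have /eqP : 2 * g = 0 by rewrite mulrDl mul1r {1}gN addNr.
    by rewrite mulf_eq0 (negPf two_neq0) => /eqP.
  apply: commF; move: SF; rewrite /adF => SF.
  by rewrite -opprB mulNr SF oppr0.
have lk : l != k by rewrite eq_sym.
apply: commF; rewrite SE iter_adE_F //.
have [<-|mk] := eqVneq m k; last first.
  by rewrite (E_F_neq rels) // subrr mul0r iter_adE0.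
rewrite (E_F rels) addrAC subrr add0r sAl mulrBl (Ki_K rels) -scaleN1r.
rewrite iter_adEZ iter_adED iter_adEZ iter_adE_KK.
(* The factor for s = N-1 vanishes, because a_lm = 1 - N. *)
have -> : \prod_(s < N) (1 - q_ l ^ (2 * s%:Z + 2 * A l m)) = 0.
  have sN : (N.-1 < N)%N by rewrite prednK.
  rewrite (bigD1 (Ordinal sN)) //= NE.
  have -> : 2 * N.-1%:Z + 2 * (1 - N%:Z) = 0 by move: N0; clear; lia.
  by rewrite expr0z subrr mul0r.
rewrite scale0r add0r.
have -> : iter N (adE l) 1 = 0.
  by rewrite -(prednK N0) iterSr (adE1 rels) iter_adE0.
by rewrite !scaler0.
Qed.

End SerreCommutes.

(** * Evaluation of the free algebra *)

Section FreeLift.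
Context (F : fieldType) (n : nat) (R : algType F) (g : gen n -> R).

Definition lift_mon (m : {fmonom (gen n)}) : R := \prod_(x <- m) g x.

Fact lift_mon_morph : mmorphism lift_mon.
Proof.
split=> [x y|]; first by rewrite /lift_mon fmM big_cat.
by rewrite /lift_mon fm1 big_nil.
Qed.

HB.instance Definition _ :=
  monalg.isMultiplicative.Build {fmonom (gen n)} R lift_mon lift_mon_morph.

Definition lift (x : freeA F n) : R := mmap (GRing.in_alg R) lift_mon x.

Lemma lift0 : lift 0 = 0. Proof. exact: mmap0. Qed.
Lemma liftD x y : lift (x + y) = lift x + lift y. Proof. exact: mmapD. Qed.
Lemma liftB x y : lift (x - y) = lift x - lift y. Proof. exact: mmapB. Qed.
Lemma lift1 : lift 1 = 1. Proof. exact: mmap1. Qed.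

Lemma liftZ a x : lift (a *: x) = a *: lift x.
Proof. by rewrite [LHS]mmapZ /= -scalerAl mul1r. Qed.

Lemma liftM x y : lift (x * y) = lift x * lift y.
Proof.
apply: (commr_mmap_is_multiplicative (f := GRing.in_alg R) (h := lift_mon) _).1.
by move=> z m m'; rewrite /GRing.comm /= -scalerAl -scalerAr mul1r mulr1.
Qed.

Lemma lift_fgen x : lift (fgen F x) = g x.
Proof. by rewrite [LHS]mmapU /= scale1r mul1r /lift_mon fmU big_seq1. Qed.

Lemma liftX x m : lift (x ^+ m) = lift x ^+ m.
Proof. by elim: m => [|m IHm]; rewrite ?expr0 ?lift1 // !exprS liftM IHm. Qed.

Lemma lift_Fij q (A : 'M[int]_n) eps i j x y :
  lift (Fij q A eps i j x y) = serre (q ^+ eps i) `|1 - A i j|%N (lift x) (lift y).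
Proof.
rewrite /Fij (big_morph lift liftD lift0); apply: eq_bigr => l _.
by rewrite liftZ; congr (_ *: _); rewrite -!liftX -!liftM.
Qed.

Let liftMB x y z t : lift (x * y - z * t) = lift x * lift y - lift z * lift t.
Proof. by rewrite liftB; congr (_ - _); apply: liftM. Qed.
Let liftMB1 x y : lift (x * y - 1) = lift x * lift y - 1.
Proof. by rewrite liftB lift1; congr (_ - _); apply: liftM. Qed.
Let liftMZB a x y z t :
  lift (x * y - a *: (z * t)) = lift x * lift y - a *: (lift z * lift t).
Proof. by rewrite liftB liftZ; congr (_ - _ *: _); apply: liftM. Qed.

(** Serre relators are only evaluated here: on the module below, those in the E_l will be shown to
    vanish on a submodule only. *)
Lemma lift_relator q (A : 'M[int]_n) eps x :
  quantum_relations q A eps (g \o @GE n) (g \o @GF n) (g \o @GK n) (g \o @GKi n) ->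
  relator q A eps x ->
  [\/ lift x = 0,
     exists l m, l != m /\
       lift x = serre (q ^+ eps l) `|1 - A l m|%N (g (GE l)) (g (GE m))
   | exists l m, l != m /\
       lift x = serre (q ^+ eps l) `|1 - A l m|%N (g (GF l)) (g (GF m))].
Proof.
case=> KKi KiK KK KE KF EFn EF; case=> [l|l|l m|l m|l m|l m|l m lm|l m lm].
- by constructor 1; rewrite liftMB1 !lift_fgen; apply/eqP; rewrite subr_eq0; apply/eqP/KKi.
- by constructor 1; rewrite liftMB1 !lift_fgen; apply/eqP; rewrite subr_eq0; apply/eqP/KiK.
- by constructor 1; rewrite liftMB !lift_fgen; apply/eqP; rewrite subr_eq0; apply/eqP/KK.
- by constructor 1; rewrite liftMZB !lift_fgen; apply/eqP; rewrite subr_eq0; apply/eqP/KE.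
- by constructor 1; rewrite liftMZB !lift_fgen; apply/eqP; rewrite subr_eq0; apply/eqP/KF.
- constructor 1; rewrite liftB liftMB !lift_fgen; apply/eqP; rewrite subr_eq0; apply/eqP.
  have [<-|lm] := eqVneq l m.
    by have /= -> := EF l; rewrite liftZ liftB !lift_fgen addrAC subrr add0r.
  by have /= -> := EFn _ _ lm; rewrite lift0 subrr.
- by constructor 2; exists l, m; rewrite lift_Fij !lift_fgen.
- by constructor 3; exists l, m; rewrite lift_Fij !lift_fgen.
Qed.

End FreeLift.

(** * The algebra of linear operators on functions of words *)

Section LinearOperators.
Context (F : fieldType) (T : Type).
Local Notation V := (seq T -> F^o).

Record operator := Operator { operator_fun :> V -> V; operatorP : linear operator_fun }.

Lemma operator_eq (f g : operator) : (forall v w, f v w = g v w) -> f = g.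
Proof.
case: f g => f lf [g lg] /= fg; have efg : f = g by apply/funext => v; apply/funext => w.
by case: g / efg lg {fg} => lg; congr Operator; apply: Prop_irrelevance.
Qed.

HB.instance Definition _ := gen_eqMixin operator.
HB.instance Definition _ := gen_choiceMixin operator.

Lemma operatorD (f : operator) v w : f (v + w) = f v + f w.
Proof. by have := operatorP f 1 v w; rewrite !scale1r. Qed.

Lemma operator0 (f : operator) : f 0 = 0.
Proof. exact: (linear0E (operatorP f)). Qed.

Lemma operatorZ (f : operator) a v : f (a *: v) = a *: f v.
Proof. exact: (linear_scaleE _ _ (operatorP f)). Qed.

Fact op_zeroP : linear (fun _ : V => 0 : V).
Proof. by move=> a u v; rewrite scaler0 addr0. Qed.
Fact op_addP (f g : operator) : linear (fun v : V => f v + g v).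
Proof. by move=> a u v; rewrite !operatorD !operatorZ scalerDr addrACA. Qed.
Fact op_oppP (f : operator) : linear (fun v : V => - f v).
Proof. by move=> a u v; rewrite operatorD operatorZ scalerN opprD. Qed.
Fact op_oneP : linear (fun v : V => v).
Proof. by []. Qed.
Fact op_mulP (f g : operator) : linear (fun v : V => f (g v)).
Proof. by move=> a u v; rewrite !operatorD !operatorZ. Qed.
Fact op_scaleP (c : F) (f : operator) : linear (fun v : V => c *: f v).
Proof.
by move=> a u v; rewrite operatorD operatorZ scalerDr !scalerA mulrC.
Qed.

Definition op_zero := Operator op_zeroP.
Definition op_add f g := Operator (op_addP f g).
Definition op_opp f := Operator (op_oppP f).
Definition op_one := Operator op_oneP.
Definition op_mul f g := Operator (op_mulP f g).
Definition op_scale c f := Operator (op_scaleP c f).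

Fact op_addA : associative op_add.
Proof. by move=> f g h; apply: operator_eq => v w /=; rewrite addrA. Qed.
Fact op_addC : commutative op_add.
Proof. by move=> f g; apply: operator_eq => v w /=; rewrite addrC. Qed.
Fact op_add0 : left_id op_zero op_add.
Proof. by move=> f; apply: operator_eq => v w /=; rewrite add0r. Qed.
Fact op_addN : left_inverse op_zero op_opp op_add.
Proof. by move=> f; apply: operator_eq => v w /=; rewrite addNr. Qed.

HB.instance Definition _ :=
  Algebra.isZmodule.Build operator op_addA op_addC op_add0 op_addN.

Fact op_mulA : associative op_mul.
Proof. by move=> f g h; apply: operator_eq. Qed.
Fact op_mul1 : left_id op_one op_mul.
Proof. by move=> f; apply: operator_eq. Qed.
Fact op_mulr1 : right_id op_one op_mul.
Proof. by move=> f; apply: operator_eq. Qed.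
Fact op_mulDl : left_distributive op_mul +%R.
Proof. by move=> f g h; apply: operator_eq. Qed.
Fact op_mulDr : right_distributive op_mul +%R.
Proof. by move=> f g h; apply: operator_eq => v w /=; rewrite operatorD. Qed.
Fact op_1neq0 : op_one != 0.
Proof.
apply/eqP => /(congr1 (fun f : operator => f (fun=> 1) [::]))/=.
by move/eqP; rewrite oner_eq0.
Qed.

HB.instance Definition _ := GRing.Zmodule_isNzRing.Build operator
  op_mulA op_mul1 op_mulr1 op_mulDl op_mulDr op_1neq0.

Fact op_scaleA a b f : op_scale a (op_scale b f) = op_scale (a * b) f.
Proof. by apply: operator_eq => v w /=; rewrite scalerA. Qed.
Fact op_scale1 : left_id 1 op_scale.
Proof. by move=> f; apply: operator_eq => v w /=; rewrite scale1r. Qed.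
Fact op_scaleDr : right_distributive op_scale +%R.
Proof. by move=> a f g; apply: operator_eq => v w /=; rewrite scalerDr. Qed.
Fact op_scaleDl f : {morph op_scale^~ f : a b / a + b}.
Proof. by move=> a b; apply: operator_eq => v w /=; rewrite scalerDl. Qed.

HB.instance Definition _ := GRing.Zmodule_isLmodule.Build F operator
  op_scaleA op_scale1 op_scaleDr op_scaleDl.

Fact op_scaleAl (a : F) (f g : operator) : a *: (f * g) = a *: f * g.
Proof. exact: operator_eq. Qed.
HB.instance Definition _ := GRing.Lmodule_isLalgebra.Build F operator op_scaleAl.

Fact op_scaleAr (a : F) (f g : operator) : a *: (f * g) = f * (a *: g).
Proof. by apply: operator_eq => v w; rewrite -[RHS]/(f (a *: g v) w) operatorZ. Qed.
HB.instance Definition _ := GRing.Lalgebra_isAlgebra.Build F operator op_scaleAr.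

End LinearOperators.

(* Sequences index the monomials in the E_l: the space of all functions on
   them is the module dual to the free algebra on the E_l, whose cyclic
   submodule generated by [vacuum] is the irreducible module of highest weight
   rho. *)
Section FockModule.
Context (F : fieldType) (q : F) (n : nat) (A : 'M[int]_n) (eps : 'I_n -> nat).
Hypothesis q_neq0 : q != 0.
Hypothesis q_nroot : forall m, (0 < m)%N -> q ^+ m != 1.
Hypothesis two_neq0 : 2 != 0 :> F.
Hypothesis symA : forall i j, (eps i)%:Z * A i j = (eps j)%:Z * A j i.
Hypothesis eps_gt0 : forall i, (0 < eps i)%N.
Hypothesis diagA : forall i, A i i = 2.
Hypothesis offdiagA : forall i j, i != j -> A i j <= 0.

Local Notation q_ i := (q ^+ eps i).
Local Notation V := (seq 'I_n -> F^o).
Local Notation op := (operator F 'I_n).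

(** The K_l-eigenvalue in weight rho minus the simple roots listed in w; rho(h_l) = 1 accounts for
    the 1. *)
Definition chi l (w : seq 'I_n) : F := q_ l ^ (1 - \sum_(m <- w) A l m).

Lemma chi_cons l m w : chi l (m :: w) = q_ l ^ (- A l m) * chi l w.
Proof.
by rewrite /chi big_cons -expfzDr ?qi_neq0 // opprD addrCA.
Qed.

Lemma chi_neq0 l w : chi l w != 0.
Proof. by rewrite expfz_neq0 ?qi_neq0. Qed.

Definition bracket l w : F := (chi l w - (chi l w)^-1) / (q_ l - (q_ l)^-1).

(** Forced by the relations: (F_l v)(m :: w) is (E_m F_l v)(w), in which F_l is moved to the left.
    The value 0 at the empty word starts the recursion. *)
Fixpoint fockF_fun l (w : seq 'I_n) (v : V) : F :=
  if w is m :: w' then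
    fockF_fun l w' (fun u => v (m :: u)) + (if m == l then bracket l w' * v w' else 0)
  else 0.

Let mulr_lin (a b x y : F) : b * (a * x + y) = a * (b * x) + b * y.
Proof. by ring. Qed.

Let mulr_lin2 (a b x y u v : F) :
  a * x + y + b * (a * u + v) = a * (x + b * u) + (y + b * v).
Proof. by ring. Qed.

Let mulr_lin3 (b c x y u : F) : b * x + b * c * (y * u) = b * (x + y * (c * u)).
Proof. by ring. Qed.

Fact fockE_linear l : linear (fun (v : V) w => v (l :: w) : F^o).
Proof. by []. Qed.
Fact fockK_linear l : linear (fun (v : V) w => chi l w * v w : F^o).
Proof. by move=> a u v; apply/funext => w; exact: mulr_lin. Qed.
Fact fockKi_linear l : linear (fun (v : V) w => (chi l w)^-1 * v w : F^o).
Proof. by move=> a u v; apply/funext => w; exact: mulr_lin. Qed.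
Fact fockF_linear l : linear (fun (v : V) w => fockF_fun l w v : F^o).
Proof.
move=> a u v; apply/funext => w.
elim: w u v => [|m w IHw] u v; first by rewrite !fctE /= scaler0 addr0.
rewrite !fctE /= -![_ *: _]/(_ * _).
have := IHw (fun w => u (m :: w)) (fun w => v (m :: w)).
rewrite !fctE -![_ *: _]/(_ * _) => e.
rewrite [X in X + _ = _]e; case: (m == l); last by rewrite !addr0.
exact: mulr_lin2.
Qed.

Definition fockE l : op := Operator (fockE_linear l).
Definition fockF l : op := Operator (fockF_linear l).
Definition fockK l : op := Operator (fockK_linear l).
Definition fockKi l : op := Operator (fockKi_linear l).

Let mulE (f g : op) v w : (f * g) v w = f (g v) w. Proof. by []. Qed.
Let mulvE (f g : op) v : (f * g) v = f (g v). Proof. by []. Qed.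
Let addvE (f g : op) v : (f + g) v = f v + g v. Proof. by []. Qed.
Let scalevE a (f : op) v : (a *: f) v = a *: f v. Proof. by []. Qed.
Let scaleE a (f : op) v w : (a *: f) v w = a * f v w. Proof. by []. Qed.
Let addE (f g : op) v w : (f + g) v w = f v w + g v w. Proof. by []. Qed.
Let oppE (f : op) v w : (- f) v w = - f v w. Proof. by []. Qed.
Let oneE v w : (1 : op) v w = v w. Proof. by []. Qed.
Let EE l v w : fockE l v w = v (l :: w). Proof. by []. Qed.
Let KE l v w : fockK l v w = chi l w * v w. Proof. by []. Qed.
Let KiE l v w : fockKi l v w = (chi l w)^-1 * v w. Proof. by []. Qed.
Let F0 l v : fockF l v [::] = 0. Proof. by []. Qed.
Let FE l v m w : fockF l v (m :: w) =
  fockF l (fockE m v) w + (if m == l then bracket l w * v w else 0).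
Proof. by []. Qed.

Lemma fock_relations : quantum_relations q A eps fockE fockF fockK fockKi.
Proof.
have qz l z : q_ l ^ z != 0 by rewrite expfz_neq0 ?qi_neq0.
have KEE l m : fockK l * fockE m = q_ l ^ A l m *: (fockE m * fockK l).
  apply: operator_eq => v w; rewrite scaleE !mulE EE !KE chi_cons.
  by rewrite !mulrA -expfzDr ?qi_neq0 // subrr expr0z mul1r.
split=> [l|l|l m|l m|l m|l m lm|l] //; apply: operator_eq => v w.
- by rewrite mulE KE KiE oneE mulrA divff ?chi_neq0 ?mul1r.
- by rewrite mulE KiE KE oneE mulrA mulVf ?chi_neq0 ?mul1r.
- by rewrite !mulE !KE mulrCA.
- rewrite scaleE !mulE KE; elim: w v => [|k w IHw] v.
    by rewrite !F0 !mulr0.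
  rewrite !FE chi_cons.
  have -> : fockE k (fockK l v) = q_ l ^ (- A l k) *: fockK l (fockE k v).
    by apply/funext => u; rewrite EE KE chi_cons -mulrA.
  rewrite operatorZ -[(_ *: fockF m _) w]/(_ * fockF m _ w) mulrDr.
  rewrite -mulrA IHw KE; case: eqVneq => [->|_]; last by rewrite !mulr0 !addr0 mulrCA.
  exact: mulr_lin3.
- by rewrite !mulE EE FE (negPf lm) addr0.
- rewrite mulE addE scaleE addE oppE mulE EE FE eqxx KE KiE /bracket; congr (_ + _).
  by rewrite -mulrBl mulrA; congr (_ * _); rewrite mulrC.
Qed.

(** The element commutes with every E_k, and the E_k strip letters from words; this reduces its
    vanishing to the empty word, where each F_l gives 0. *)
Lemma fock_serre_F l m : l != m ->
  serre (q_ l) `|1 - A l m|%N (fockF l) (fockF m) = 0.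
Proof.
move=> lm; set S := serre _ _ _ _.
have SE k : S * fockE k = fockE k * S.
  exact: (serre_E_comm_F q_neq0 q_nroot two_neq0 symA eps_gt0 diagA offdiagA
    (quantum_relations_swap q_neq0 fock_relations) k lm).
have prodF0 (r : nat) (f : op) v : f v [::] = 0 -> (fockF l ^+ r * f) v [::] = 0.
  by case: r => [|r]; rewrite ?expr0 ?mul1r // exprS -mulrA mulE F0.
apply: operator_eq => v w; elim: w v => [|k w IHw] v; last first.
  by rewrite -EE -mulE -SE mulE IHw.
rewrite /S /serre -[RHS]/0.
by elim/big_rec: _ => [//|r f _ f0]; rewrite addE f0 addr0 scaleE -mulrA prodF0 ?mulr0.
Qed.

Definition vacuum : V := fun w => (w == [::])%:R.

Inductive in_fock : V -> Prop :=
| fock_vacuum : in_fock vacuum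
| fock_0 : in_fock 0
| fock_add u v : in_fock u -> in_fock v -> in_fock (u + v)
| fock_scale a v : in_fock v -> in_fock (a *: v)
| fock_F l v : in_fock v -> in_fock (fockF l v).

Let E_vacuum l : fockE l vacuum = 0.
Proof. by apply/funext => w. Qed.

Let K_vacuum l : fockK l vacuum = q_ l *: vacuum.
Proof.
apply/funext => -[|m w]; rewrite KE -[RHS]/(_ * _) /vacuum ?mulr0 //.
by rewrite /chi big_nil subr0 expr1z.
Qed.

Let Ki_vacuum l : fockKi l vacuum = (q_ l)^-1 *: vacuum.
Proof.
apply/funext => -[|m w]; rewrite KiE -[RHS]/(_ * _) /vacuum ?mulr0 //.
by rewrite /chi big_nil subr0 expr1z.
Qed.

Lemma fock_K l v : in_fock v -> in_fock (fockK l v).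
Proof.
elim=> {v}[||u v _ IHu _ IHv|a v _ IHv|m v _ IHv].
- by rewrite K_vacuum; apply/fock_scale/fock_vacuum.
- by rewrite operator0; apply: fock_0.
- by rewrite operatorD; apply: fock_add.
- by rewrite operatorZ; apply: fock_scale.
- by rewrite -[fockK l _]/((fockK l * fockF m) v) (K_F fock_relations);
    apply/fock_scale/fock_F.
Qed.

Lemma fock_Ki l v : in_fock v -> in_fock (fockKi l v).
Proof.
elim=> {v}[||u v _ IHu _ IHv|a v _ IHv|m v _ IHv].
- by rewrite Ki_vacuum; apply/fock_scale/fock_vacuum.
- by rewrite operator0; apply: fock_0.
- by rewrite operatorD; apply: fock_add.
- by rewrite operatorZ; apply: fock_scale.
- by rewrite -[fockKi l _]/((fockKi l * fockF m) v)
    (Ki_kwt q_neq0 fock_relations l (kwt_F fock_relations m)); apply/fock_scale/fock_F.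
Qed.

Lemma fock_E l v : in_fock v -> in_fock (fockE l v).
Proof.
elim=> {v}[||u v _ IHu _ IHv|a v _ IHv|m v fv IHv].
- by rewrite E_vacuum; apply: fock_0.
- by rewrite operator0; apply: fock_0.
- by rewrite operatorD; apply: fock_add.
- by rewrite operatorZ; apply: fock_scale.
- rewrite -[fockE l _]/((fockE l * fockF m) v); have [<-|lm] := eqVneq l m; last first.
    by rewrite (E_F_neq fock_relations) //; apply: fock_F.
  rewrite (E_F fock_relations) -scaleN1r; apply: fock_add; first exact: fock_F.
  by apply/fock_scale/fock_add; [apply: fock_K | apply/fock_scale/fock_Ki].
Qed.

(** The element kills [vacuum], as the E_l do, and commutes with the F_k, which generate the
    submodule from [vacuum]. *)
Lemma fock_serre_E l m v : l != m -> in_fock v ->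
  serre (q_ l) `|1 - A l m|%N (fockE l) (fockE m) v = 0.
Proof.
move=> lm; set S := serre _ _ _ _.
elim=> {v}[||u v _ IHu _ IHv|a v _ IHv|k v _ IHv].
- have prodE0 (r : nat) (f : op) : f vacuum = 0 -> (f * fockE l ^+ r) vacuum = 0.
    by move=> f0; elim: r => [|r IHr]; rewrite ?expr0 ?mulr1 // exprSr mulrA mulvE E_vacuum operator0.
  rewrite /S /serre; elim/big_rec: _ => [//|r f _ f0].
  by rewrite addvE f0 addr0 scalevE prodE0 ?scaler0 // mulvE E_vacuum operator0.
- by rewrite operator0.
- by rewrite operatorD IHu IHv addr0.
- by rewrite operatorZ IHv scaler0.
- rewrite -[S _]/((S * fockF k) v).
  rewrite (serre_E_comm_F q_neq0 q_nroot two_neq0 symA eps_gt0 diagA offdiagA fock_relations k lm).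
  by rewrite -[LHS]/(fockF k (S v)) IHv operator0.
Qed.

Definition fock_gen (g : gen n) : op :=
  match g with
  | GE l => fockE l | GF l => fockF l | GK l => fockK l | GKi l => fockKi l
  end.

Lemma lift_fock x v : in_fock v -> in_fock (lift fock_gen x v).
Proof.
move=> fv; have mon m : in_fock (lift_mon fock_gen m v).
  rewrite /lift_mon; elim: (fmonom_val m) => [|g w IHw]; first by rewrite big_nil.
  rewrite big_cons mulvE.
  by case: g => l; [apply: fock_E | apply: fock_F | apply: fock_K | apply: fock_Ki].
rewrite /lift /mmap; elim/big_rec: _ => [|m f _ ff]; first exact: fock_0.
have inE c (h : op) : GRing.in_alg op c * h = c *: h by rewrite /= -scalerAl mul1r.
rewrite addvE inE scalevE.
by apply: fock_add ff; apply: fock_scale.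
Qed.

Lemma lift_ideal x v : ideal q A eps x -> in_fock v -> lift fock_gen x v = 0.
Proof.
move=> Ix; elim: Ix v => {x}[x rx||x y _ IHx _ IHy|x y _ IHy|x y _ IHx] v fv.
- have [->//|[l [m [lm ->]]]|[l [m [lm ->]]]] := lift_relator (g := fock_gen) fock_relations rx.
    exact: fock_serre_E.
  by rewrite [serre _ _ _ _]fock_serre_F.
- by rewrite lift0.
- by rewrite liftD addvE IHx // IHy // addr0.
- by rewrite liftM mulvE IHy // operator0.
- by rewrite liftM mulvE IHx //; apply: lift_fock.
Qed.

(** Since rho(h_l) = 1, the product E_l F_l fixes [vacuum], whereas elements of the ideal act by
    0. *)
Lemma Ugen_E_neq0 l : Ugen q A eps (GE l) != 0.
Proof.
apply/eqP; rewrite UgenE -(raddf0 (@Uq_pi F q n A eps)) => /Uq_piP; rewrite subr0 => Il.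
have := lift_ideal Il (fock_F l fock_vacuum); rewrite lift_fgen.
rewrite -[fock_gen _ _]/((fockE l * fockF l) vacuum) (E_F fock_relations).
move/(congr1 (fun v : V => v [::])).
rewrite addE mulE F0 add0r scaleE addE oppE KE KiE /vacuum eqxx !mulr1 /chi big_nil.
rewrite subr0 expr1z mulVf; last by apply: qsubV_neq0; [exact: qi_neq0 | move=> k; exact: qi_nroot].
by move/eqP; rewrite oner_eq0.
Qed.

End FockModule.

(** * Commutators of iterated adjoint actions with the F_m *)

Section AdCommutators.
Context (F : fieldType) (q : F) (n : nat) (A : 'M[int]_n) (eps : 'I_n -> nat).
Hypothesis q_neq0 : q != 0.
Hypothesis q_nroot : forall m, (0 < m)%N -> q ^+ m != 1.
Hypothesis symA : forall i j, (eps i)%:Z * A i j = (eps j)%:Z * A j i.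
Hypothesis eps_gt0 : forall i, (0 < eps i)%N.
Hypothesis diagA : forall i, A i i = 2.
Context (R : algType F) (E F_ K Ki : 'I_n -> R).
Hypothesis rels : quantum_relations q A eps E F_ K Ki.
Implicit Types (x y u : R) (a : F).

Local Notation q_ i := (q ^+ eps i).
Local Notation Ki_K := (Ki_K rels).
Local Notation K_E := (K_E rels).
Local Notation E_F := (E_F rels).
Local Notation kwt := (kwt q A eps K).
Local Notation adE := (adE E K Ki).

Let sAl a x y : (a *: x) * y = a *: (x * y). Proof. by rewrite scalerAl. Qed.
Let sAr a x y : x * (a *: y) = a *: (x * y). Proof. by rewrite scalerAr. Qed.
Local Notation adw := (adw E K Ki).

Lemma adwB w x y : adw w (x - y) = adw w x - adw w y.
Proof. by elim: w => //= l w ->; rewrite adEB. Qed.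

Lemma adwZ w a x : adw w (a *: x) = a *: adw w x.
Proof. by elim: w => //= l w ->; rewrite adEZ. Qed.

Lemma adw0 w : adw w 0 = 0.
Proof. by elim: w => //= l w ->; rewrite adE0. Qed.

Lemma adw1 w : adw w 1 = (nilp w)%:R.
Proof.
elim: w => //= l w ->; case: (nilp w); first by rewrite (adE1 rels).
exact: adE0.
Qed.

Lemma adw_F w m x : m \notin w ->
  (adw w x * F_ m - F_ m * adw w x) * K m = adw w ((x * F_ m - F_ m * x) * K m).
Proof.
elim: w => //= l w IHw; rewrite in_cons negb_or => /andP[ml mw].
by rewrite -IHw // (adE_F q_neq0 symA rels) // eq_sym.
Qed.

Lemma adw_comm_F w m x : m \notin w -> x * F_ m = F_ m * x ->
  adw w x * F_ m = F_ m * adw w x.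
Proof.
move=> mw xF; have := adw_F x mw; rewrite xF subrr mul0r adw0.
by rewrite -(mul0r (K m)) => /(K_mulr_inj rels)/eqP; rewrite subr_eq0 => /eqP.
Qed.

(** The origin of Z_i: one half of [E_i, F_i] K_i gives ad(Z_i^+)(K_i^2), and the other half, a
    multiple of 1, is killed by any nonempty word. *)
Lemma adw_E_F w i : i \notin w ->
  (adw w (E i) * F_ i - F_ i * adw w (E i)) * K i =
  (q_ i - (q_ i)^-1)^-1 *: (adw w (K i * K i) - (nilp w)%:R).
Proof.
move=> iw; rewrite adw_F // E_F addrAC subrr add0r sAl mulrBl Ki_K.
by rewrite adwZ adwB adw1.
Qed.

(** x is a polynomial in the E_l with l in w; the third clause keeps what the centrality properties
    of Z_i require. *)
Lemma adw_KK w i : exists x, [/\ adw w (K i * K i) = x * (K i * K i),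
  kwt (wsum w) x, forall y, {in w, forall l, E l * y = y * E l} -> x * y = y * x
  & w = [::] -> x = 1].
Proof.
elim: w => [|l w [x [ex kx cx _]]].
  exists 1; split=> //; first by rewrite mul1r.
    by move=> l; rewrite /wsum big_nil root_at0 scale1r mulr1 mul1r.
  by move=> y _; rewrite mulr1 mul1r.
have kxK : kwt (wsum w) (x * (K i * K i)).
  rewrite -[wsum w]addr0; apply: (kwtM q_neq0) => //.
  by rewrite -[0]addr0; apply: (kwtM q_neq0); apply: (kwt_K rels).
have KKE : K i * K i * E l = (q_ i ^ A i l) ^+ 2 *: (E l * (K i * K i)).
  by rewrite -mulrA K_E sAr mulrA K_E sAl scalerA expr2 mulrA.
exists (E l * x - (q_ l ^ root_at A (wsum w) l * (q_ i ^ A i l) ^+ 2) *: (x * E l)); split=> //.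
- rewrite /= ex (adE_kwt rels l kxK) mulrBl sAl -!mulrA [x * (K i * (K i * _))]mulrA.
  rewrite -[x * K i * _]mulrA [K i * (K i * E l)]mulrA KKE sAr scalerA.
  by [].
- rewrite wsum_cons -scaleNr; apply: kwtD.
    by apply: (kwtM q_neq0) => //; apply: (kwt_E rels).
  by apply: kwtZ; rewrite addrC; apply: (kwtM q_neq0) => //; apply: (kwt_E rels).
- move=> y cy; have xy : x * y = y * x.
    by apply: cx => k kw; apply: cy; rewrite in_cons kw orbT.
  have Ey : E l * y = y * E l by apply: cy; rewrite mem_head.
  rewrite mulrBl mulrBr sAl sAr -!mulrA xy Ey; congr (_ - _ *: _).
    by rewrite !mulrA Ey.
  by rewrite !mulrA xy.
Qed.

End AdCommutators.

(** * Weights *)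
Section Weights.
Context (n : nat) (A : 'M[int]_n) (eps : 'I_n -> nat).
Hypothesis hA : symmetrizable_gcm A eps.
Context (X : {set 'I_n}) (tau : {perm 'I_n}) (wX : seq 'I_n).
Hypothesis hX : admissible_pair A X tau wX.
Implicit Types (b h : 'rV[int]_n) (l m : 'I_n) (w : seq 'I_n).

Let diagA := gcm_diag hA.

Lemma root_atZ (a : int) b l : root_at A (a *: b) l = a * root_at A b l.
Proof.
by rewrite /root_at mulr_sumr; apply: eq_bigr => j _; rewrite mxE mulrA.
Qed.

Lemma root_at_refl m b l : root_at A (refl A m b) l = root_at A b l - root_at A b m * A l m.
Proof. by rewrite /refl root_atD root_atN root_atZ root_at_simple. Qed.

Lemma weylD w b b' : weyl A w (b + b') = weyl A w b + weyl A w b'.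
Proof.
by elim: w => //= k w ->; rewrite /refl root_atD scalerDl opprD addrACA.
Qed.

Lemma weylN w b : weyl A w (- b) = - weyl A w b.
Proof.
by elim: w => //= k w ->; rewrite /refl root_atN scaleNr opprD.
Qed.

Lemma refl_invol m : involutive (refl A m).
Proof.
move=> b; rewrite {1}/refl root_at_refl diagA /refl.
have -> : root_at A b m - root_at A b m * 2 = - root_at A b m by ring.
by rewrite scaleNr opprK subrK.
Qed.

Lemma weyl_revK w : cancel (weyl A w) (weyl A (rev w)).
Proof.
elim: w => [|m w IHw] b; first by [].
by rewrite rev_cons /weyl foldr_rcons /= refl_invol -/(weyl A w b) -/(weyl A _ _) IHw.
Qed.

Lemma weyl_supp w b m : {subset w <= X} -> m \notin X -> weyl A w b 0 m = b 0 m.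
Proof.
move=> + mX; elim: w => //= l w IHw wX'; rewrite !mxE IHw; last first.
  by move=> k kw; apply: wX'; rewrite in_cons kw orbT.
have -> : (m == l) = false.
  by apply: contraNF mX => /eqP->; apply: wX'; rewrite mem_head.
by rewrite andbF mulr0 subr0.
Qed.

Definition pairing b h : int := \sum_i h 0 i * root_at A b i.

Lemma pairing_simple b l : pairing b (simple l) = root_at A b l.
Proof.
rewrite /pairing (bigD1 l) //= mxE !eqxx mul1r big1 ?addr0 // => k kl.
by rewrite mxE (negPf kl) andbF mul0r.
Qed.

Lemma pairing_refl m b h : pairing (refl A m b) (corefl A m h) = pairing b h.
Proof.
set s := simple_at A m h; set r := root_at A b m.
have -> : pairing (refl A m b) (corefl A m h) =
    pairing (refl A m b) h - s * pairing (refl A m b) (simple m).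
  rewrite /pairing mulr_sumr -sumrB; apply: eq_bigr => i _.
  by rewrite !mxE -/s; ring.
rewrite pairing_simple root_at_refl diagA -/r.
have -> : pairing (refl A m b) h = pairing b h - r * s.
  rewrite /pairing /s /simple_at mulr_sumr -sumrB; apply: eq_bigr => i _.
  by rewrite root_at_refl -/r; ring.
by ring.
Qed.

Lemma pairingN b h : pairing b (- h) = - pairing b h.
Proof.
by rewrite /pairing -sumrN; apply: eq_bigr => i _; rewrite mxE mulNr.
Qed.

Lemma pairing_weyl w b h : pairing (weyl A w b) (coweyl A w h) = pairing b h.
Proof. by elim: w => //= l w <-; rewrite pairing_refl. Qed.

Let tauX l : (tau l \in X) = (l \in X).
Proof.
by rewrite -{1}(adm_tauX hX) mem_imset //; apply: perm_inj.
Qed.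

(** w_X preserves the pairing and acts as -tau on the coroots of X. *)
Lemma root_at_weylX b l : l \in X -> root_at A (weyl A wX b) l = - root_at A b (tau l).
Proof.
move=> lX; rewrite -pairing_simple -{1}[l](adm_tauK hX).
rewrite (adm_coroot hX) ?tauX // pairingN; congr (- _).
by rewrite pairing_weyl pairing_simple.
Qed.

Lemma weyl_rev_simple l : l \in X -> weyl A (rev wX) (simple l) = - simple (tau l).
Proof.
move=> lX; rewrite -{1}[l](adm_tauK hX) (adm_root hX) ?tauX //.
by rewrite weylN weyl_revK.
Qed.

(** The Cartan submatrix of X has nonzero determinant, so eigenvalues do determine weights supported
    on X. *)
Lemma weight_unique b : (forall m, m \notin X -> b 0 m = 0) ->
  {in X, forall l, root_at A b l = 0} -> b = 0.
Proof.
move=> b0 br; pose u := \col_(k < #|X|) b 0 (enum_val k).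
have Mu : submatrix A X *m u = 0.
  apply/matrixP => k j; rewrite !mxE.
  transitivity (root_at A b (enum_val k)); last by rewrite br ?enum_valP.
  transitivity (\sum_(i in X) b 0 i * A (enum_val k) i).
    by rewrite [RHS]big_enum_val; apply: eq_bigr => i _; rewrite !mxE mulrC.
  rewrite /root_at [RHS](bigID (mem X)) /= [\sum_(i | i \notin X) _]big1 ?addr0 //.
  by move=> i /b0->; rewrite mul0r.
have d0 : \det (submatrix A X) != 0 by have := adm_finite_type hX (subxx X); case: ltgtP.
have u0 : u = 0.
  have adjMu : \adj (submatrix A X) *m (submatrix A X *m u) = 0 by rewrite Mu mulmx0.
  apply/matrixP => k j; rewrite mxE.
  move: adjMu => /matrixP/(_ k j)/eqP.
  by rewrite mulmxA mul_adj_mx mul_scalar_mx !mxE mulf_eq0 (negPf d0) => /eqP.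
apply/rowP => m; rewrite mxE; have [mX|/b0 //] := boolP (m \in X).
have := congr1 (fun z : 'cV_ _ => z (enum_rank_in mX m) 0) u0.
by rewrite !mxE enum_rankK_in.
Qed.

(** By symmetrizability the ratio of eps o tau to eps is constant along edges, hence constant by
    indecomposability; tau being an involution, its square is 1. *)
Lemma eps_tau l : eps (tau l) = eps l.
Proof.
pose S := [set i | eps (tau i) * eps (tau l) == eps i * eps l]%N.
have tS : tau l \in S by rewrite inE (adm_tauK hX) mulnC.
have ST : S = [set: 'I_n]%SET.
  apply/eqP/negPn/negP => ST.
  have S0 : S != finset.set0 by apply/set0Pn; exists (tau l).
  have [i [k [iS kS Aik]]] := gcm_indecomposable hA S0 ST.
  case/negP: kS; move: iS; rewrite !inE => /eqP iS.
  have e1 := gcm_sym hA i k; have := gcm_sym hA (tau i) (tau k).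
  rewrite !(adm_tauA hX) => e2.
  have Aki : A k i != 0 by apply: contra Aik => /eqP /(gcm_zero hA) ->.
  have : (eps i * eps (tau k) * eps (tau l))%:Z * A k i == (eps i * eps k * eps l)%:Z * A k i.
    have -> : (eps i * eps k * eps l)%:Z * A k i = (eps i * eps l)%:Z * (eps i * 1)%:Z * A i k.
      rewrite -mulrA muln1 e1 !PoszM; ring.
    rewrite -iS -mulrA muln1 mulrCA.
    have -> : (eps i * eps (tau k) * eps (tau l))%:Z * A k i
      = (eps i * eps (tau l))%:Z * ((eps (tau k))%:Z * A k i) by rewrite !PoszM; ring.
    by rewrite -e2 !PoszM; apply/eqP; ring.
  rewrite (inj_eq (mulIf Aki)) eqz_nat -!mulnA eqn_pmul2l //.
  exact: (gcm_eps_gt0 hA).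
have : l \in S by rewrite ST inE.
rewrite inE => /eqP; move: (eps (tau l)) (eps l) => x y; clear; nia.
Qed.

Section Symmetry.
Context (i j : 'I_n) (bi bj : 'rV[int]_n).
Hypothesis tau_i : tau i = i.
Hypothesis bi_supp : forall m, m \notin X -> bi 0 m = 0.
Hypothesis bj_supp : forall m, m \notin X -> bj 0 m = 0.
Hypothesis bi_root : {in X, forall l, root_at A bi l = - A l i - A l i}.
Hypothesis bj_root : {in X, forall l, root_at A bj l = - A l j - A l (tau j)}.

Let bi_tau l : bi 0 (tau l) = bi 0 l.
Proof.
pose b := \row_m bi 0 (tau m) - bi.
suff b0 : b = 0 by have := congr1 (fun z : 'rV_n => z 0 l) b0; rewrite !mxE => /eqP; rewrite subr_eq0 => /eqP.
apply: weight_unique => [m mX|m mX].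
  by rewrite !mxE !bi_supp ?subrr // tauX.
rewrite root_atD root_atN bi_root //.
have -> : root_at A (\row_m bi 0 (tau m)) m = root_at A bi (tau m).
  rewrite /root_at [RHS](reindex_inj (@perm_inj _ tau)); apply: eq_bigr => k _.
  by rewrite !mxE (adm_tauA hX).
by rewrite bi_root ?tauX // -{1 2}tau_i !(adm_tauA hX) subrr.
Qed.

(** The form (bi, bj) is computed in two ways, as -2 (bj, alpha_i) and as -(bi, alpha_j +
    alpha_tau(j)). The latter is -2 (bi, alpha_j), since bi is tau-invariant by uniqueness. *)
Lemma weight_symmetry : (eps i)%:Z * root_at A bj i = (eps j)%:Z * root_at A bi j.
Proof.
pose P b k := \sum_l b 0 l * ((eps l)%:Z * A l k).
have PE b k : (eps k)%:Z * root_at A b k = P b k.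
  rewrite /root_at mulr_sumr; apply: eq_bigr => l _.
  by rewrite mulrCA (gcm_sym hA).
have Ptau : P bi (tau j) = P bi j.
  rewrite /P (reindex_inj (@perm_inj _ tau)); apply: eq_bigr => k _ /=.
  by rewrite bi_tau eps_tau (adm_tauA hX).
rewrite !PE; pose G b b' := \sum_l b 0 l * ((eps l)%:Z * root_at A b' l).
have GC : G bj bi = G bi bj.
  rewrite /G /root_at.
  under eq_bigr => l _ do rewrite !mulr_sumr.
  rewrite exchange_big; apply: eq_bigr => l _; rewrite !mulr_sumr.
  apply: eq_bigr => k _.
  transitivity (bj 0 k * bi 0 l * ((eps k)%:Z * A k l)); first by ring.
  by rewrite (gcm_sym hA); ring.
have G1 : G bj bi = - P bj i - P bj i.
  rewrite /G /P -!sumrN -big_split; apply: eq_bigr => l _ /=.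
  have [lX|/bj_supp ->] := boolP (l \in X); last by rewrite !mul0r !oppr0 addr0.
  by rewrite bi_root //; ring.
have G2 : G bi bj = - P bi j - P bi (tau j).
  rewrite /G /P -!sumrN -big_split; apply: eq_bigr => l _ /=.
  have [lX|/bi_supp ->] := boolP (l \in X); last by rewrite !mul0r !oppr0 addr0.
  by rewrite bj_root //; ring.
move: GC; rewrite G1 G2 Ptau; move: (P _ _) (P _ _) => x y; clear; lia.
Qed.

End Symmetry.

End Weights.

(** * Transport of the Serre relation *)

Section SerreTransport.
Context (F : fieldType) (q : F).
Hypothesis q_neq0 : q != 0.
Hypothesis q_nroot : forall n, (0 < n)%N -> q ^+ n != 1.
Context (R : algType F).
Implicit Types (x y k : R) (N : nat).

Let sAl a x y : (a *: x) * y = a *: (x * y). Proof. by rewrite scalerAl. Qed.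
Let sAr a x y : x * (a *: y) = a *: (x * y). Proof. by rewrite scalerAr. Qed.

Lemma serre_scale N a b x y : serre q N (a *: x) (b *: y) = (a ^+ N * b) *: serre q N x y.
Proof.
rewrite /serre scaler_sumr; apply: eq_bigr => l _.
rewrite !exprZn !sAl !sAr !sAl !scalerA; congr (_ *: _).
have lN : (l <= N)%N by rewrite -ltnS.
by rewrite -exprD subnK //; ring.
Qed.

Lemma serre0r N x : serre q N x 0 = 0.
Proof. by rewrite /serre big1 // => l _; rewrite mulr0 mul0r scaler0. Qed.

Lemma serre0l N y : (0 < N)%N -> serre q N 0 y = 0.
Proof.
move=> N0; rewrite /serre big1 // => -[[|l] lN] _ /=.
  by rewrite subn0 expr0n gtn_eqF // !mul0r scaler0.
by rewrite [0 ^+ l.+1]expr0n mulr0 scaler0.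
Qed.

Let serre_chain0 x N y : bchain q x 0 N 0 y = y.
Proof. exact: chain0E. Qed.

Let serre_chainS x N r y :
  bchain q x 0 N r.+1 y = x * bchain q x 0 N r y - diag q N r *: (bchain q x 0 N r y * x).
Proof.
case: r => [|r]; first by rewrite /bchain chain1E chain0E.
by rewrite /bchain chainSS /(lmul 0) mul0r scaler0 subr0.
Qed.

(** Because the same be governs k with y and k' with x, the recurrence for x k and y k' is the one
    for x and y times k^r k', up to scalars. *)
Lemma serre_twist N al be x y k k' :
  k * x = al *: (x * k) -> k * y = be *: (y * k) -> k' * x = be *: (x * k') ->
  k * k' = k' * k -> serre q N x y = 0 -> serre q N (x * k) (y * k') = 0.
Proof.
move=> kx ky k'x kk'; rewrite -!serre_bchain // => xy0.
pose Y r := bchain q x 0 N r y.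
have kY r : k * Y r = (al ^+ r * be) *: (Y r * k).
  elim: r => [|r IHr]; first by rewrite /Y serre_chain0 expr0 mul1r ky.
  rewrite /Y serre_chainS -/(Y r) mulrBr mulrBl !(sAr, sAl) !mulrA kx IHr !sAl.
  rewrite -(mulrA x k) IHr -(mulrA (Y r) k x) kx !sAr !mulrA exprS.
  by move: (diag _ _ _) (al ^+ r) => d t; lmod F R; ring.
have kX r : k ^+ r * k' * x = (al ^+ r * be) *: (x * (k ^+ r * k')).
  elim: r => [|r IHr]; first by rewrite expr0 !mul1r k'x.
  rewrite exprS -!(mulrA k) IHr sAr (mulrA k x) kx sAl scalerA -!mulrA.
  by congr (_ *: _); rewrite exprS; ring.
have [g gE] : exists g : nat -> F, forall r,
    bchain q (x * k) 0 N r (y * k') = g r *: (Y r * (k ^+ r * k')).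
  exists (fun r => \prod_(s < r) (al ^+ s * be)) => r.
  elim: r => [|r IHr]; first by rewrite big_ord0 scale1r expr0 mul1r /Y !serre_chain0.
  rewrite serre_chainS IHr big_ord_recr /= [Y r.+1]serre_chainS -/(Y r).
  have kk'r : k * (k ^+ r * k') = k ^+ r.+1 * k' by rewrite mulrA exprS.
  have e1 : x * k * (Y r * (k ^+ r * k')) = (al ^+ r * be) *: (x * Y r * (k ^+ r.+1 * k')).
    by rewrite -!mulrA [k * (Y r * _)]mulrA kY sAl sAr -!mulrA kk'r.
  have e2 : Y r * (k ^+ r * k') * (x * k) = (al ^+ r * be) *: (Y r * x * (k ^+ r.+1 * k')).
    rewrite -[Y r * _ * _]mulrA [_ * k' * (x * k)]mulrA kX sAl sAr; congr (_ *: _).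
    by rewrite exprSr -!mulrA -kk'.
  rewrite sAr sAl e1 e2 mulrBl sAl; move: (\prod_(s < r) _) (diag _ _ _) (al ^+ r) => P d t.
  by lmod F R; ring.
by rewrite gE /Y xy0 mul0r scaler0.
Qed.

(** Each step multiplies by x up to a scalar, and in the last one [diag] is q^(N-1), the inverse of
    the commutation factor, so the two terms cancel. *)
Lemma serre_qcomm N x y : (0 < N)%N ->
  y * x = (q / q ^+ N) *: (x * y) -> serre q N x y = 0.
Proof.
move=> N0 yx; rewrite -serre_bchain //.
have yE r : exists c, bchain q x 0 N r y = c *: (x ^+ r * y).
  elim: r => [|r [c IHr]]; first by exists 1; rewrite serre_chain0 expr0 mul1r scale1r.
  exists (c - diag q N r * c * (q / q ^+ N)).
  rewrite serre_chainS IHr sAr sAl -(mulrA _ y) yx sAr !scalerA !mulrA -exprSr -exprS.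
  by rewrite -scalerBl.
have [c yN] := yE N.-1; rewrite -{2}(prednK N0) serre_chainS yN sAr sAl.
rewrite -(mulrA _ y) yx sAr !scalerA !mulrA -exprSr -exprS -scalerBl.
have -> : c - diag q N N.-1 * c * q / q ^+ N = 0; last by rewrite scale0r.
have qN : q ^+ N = q * q ^+ N.-1 by rewrite -exprS prednK.
rewrite /diag qN; have := expf_neq0 N.-1 q_neq0.
by move: (q ^+ N.-1) => t t0; field; rewrite q_neq0 t0.
Qed.

Lemma serre_rmorph (th : {lrmorphism R -> R}) N x y :
  th (serre q N x y) = serre q N (th x) (th y).
Proof.
rewrite /serre raddf_sum; apply: eq_bigr => l _.
by move: (_ * _ : F) => t; rewrite -[LHS]/(th (t *: _)) linearZZ !rmorphM !rmorphXn.
Qed.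

End SerreTransport.

(** * The automorphism theta_q *)
Section Theta.
Context (F : fieldType) (q : F) (n : nat) (A : 'M[int]_n) (eps : 'I_n -> nat).
Hypothesis q_neq0 : q != 0.
Hypothesis q_nroot : forall m, (0 < m)%N -> q ^+ m != 1.
Hypothesis two_neq0 : 2 != 0 :> F.
Hypothesis hA : symmetrizable_gcm A eps.
Context (X : {set 'I_n}) (tau : {perm 'I_n}) (wX : seq 'I_n).
Hypothesis hX : admissible_pair A X tau wX.
Context (sc : 'rV[int]_n -> F).
Hypothesis sc0 : sc 0 = 1.
Hypothesis sc_simple : forall i, i \notin X -> tau i = i -> sc (simple i) = 1.

Local Notation U := (Uq q A eps).
Context (omega tauU psi Ads : {lrmorphism U -> U}) (T : 'I_n -> {lrmorphism U -> U}).
Hypothesis h_omega : is_omega omega.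
Hypothesis h_tau : is_diagram_aut tau tauU.
Hypothesis h_psi : is_psi psi.
Hypothesis h_T : forall i, is_lusztig i (T i).
Hypothesis h_Ad : is_Ad sc Ads.
Local Notation theta := (theta_q Ads T wX psi tauU omega).

Local Notation E i := (Ugen q A eps (GE i)).
Local Notation F_ i := (Ugen q A eps (GF i)).
Local Notation K i := (Ugen q A eps (GK i)).
Local Notation Ki i := (Ugen q A eps (GKi i)).
Local Notation q_ i := (q ^+ eps i).
Local Notation rels := (Uq_relations q A eps).
Local Notation adE := (adE (fun l => E l) (fun l => K l) (fun l => Ki l)).
Local Notation adw := (adw (fun l => E l) (fun l => K l) (fun l => Ki l)).
Local Notation kwt := (kwt q A eps (fun l => K l)).

Let symA := gcm_sym hA.
Let diagA := gcm_diag hA.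
Let eps_gt0 := gcm_eps_gt0 hA.
Let offdiagA := gcm_offdiag hA.
Let wX_sub : {subset wX <= X}. Proof. by case: (adm_longest hX). Qed.

Lemma theta_lrmorphism : exists th : {lrmorphism U -> U}, forall u, theta u = th u.
Proof.
have [th hth] : exists th : {lrmorphism U -> U}, forall u, lusztig_word T wX u = th u.
  elim: wX => [|m w [th hth]]; first by exists idfun.
  by exists (T m \o th) => u; rewrite /= -hth.
by exists (Ads \o (th \o (psi \o (tauU \o omega)))) => u; rewrite /theta_q /= hth.
Qed.

Lemma theta_M x y : theta (x * y) = theta x * theta y.
Proof. by have [th thE] := theta_lrmorphism; rewrite !thE rmorphM. Qed.

Lemma theta_Z a x : theta (a *: x) = a *: theta x.
Proof. by have [th thE] := theta_lrmorphism; rewrite !thE linearZZ. Qed.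

Let inv_unique (x y z : U) : x * y = 1 -> y * z = 1 -> x = z.
Proof. by move=> xy yz; rewrite -[x]mulr1 -yz mulrA xy mul1r. Qed.

Let tauU_Ki l : tauU (Ki l) = Ki (tau l).
Proof.
have [_ _ tK] := h_tau l; apply: (@inv_unique _ (K (tau l))); last exact: (K_Ki rels).
by rewrite -tK -rmorphM (Ki_K rels) rmorph1.
Qed.

Let psi_Ki l : psi (Ki l) = Ki l.
Proof.
have [_ _ pK] := h_psi l; apply: (@inv_unique _ (K l)); last exact: (K_Ki rels).
by rewrite -[X in _ * X]pK -rmorphM (Ki_K rels) rmorph1.
Qed.

Let Kmon_single (b : 'rV[int]_n) l : (forall m, m != l -> b 0 m = 0) ->
  Kmon q A eps b = Kpow q A eps l (b 0 l).
Proof.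
move=> b0; rewrite /Kmon -[RHS](big_pred1_eq *%R l (fun m => Kpow q A eps m (b 0 m))).
rewrite [RHS]big_mkcond; apply: eq_bigr => m _.
by case: eqVneq => // /b0->; rewrite /= expr0.
Qed.

Lemma Kmon_simple l : Kmon q A eps (simple l) = K l.
Proof.
rewrite (@Kmon_single _ l) => [|m ml]; first by rewrite mxE !eqxx /= expr1.
by rewrite mxE (negPf ml) andbF.
Qed.

Lemma Kmon_simpleN l : Kmon q A eps (- simple l) = Ki l.
Proof.
rewrite (@Kmon_single _ l) => [|m ml]; first by rewrite !mxE !eqxx /= expr1.
by rewrite !mxE (negPf ml) andbF oppr0.
Qed.

Lemma has_weight_Kmon b : has_weight 0 (Kmon q A eps b).
Proof.
have wX0 (x : U) k : has_weight 0 x -> has_weight 0 (x ^+ k).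
  move=> x0; elim: k => [|k IHk]; first by rewrite expr0; apply: wt_1.
  by rewrite exprS -[0]addr0; apply: wt_M.
rewrite /Kmon; elim/big_ind: _ => [|x y x0 y0|l _]; first exact: wt_1.
  by rewrite -[0]addr0; apply: wt_M.
by rewrite /Kpow; case: (b 0 l) => k; apply: wX0; [apply: wt_K | apply: wt_Ki].
Qed.

(** On the torus theta_q acts as -w_X tau, which fixes alpha_l for l in X. *)
Lemma theta_K l : l \in X -> theta (K l) = K l.
Proof.
move=> lX; rewrite /theta_q; have [_ _ ->] := h_omega l.
rewrite tauU_Ki psi_Ki -Kmon_simpleN.
have -> b : lusztig_word T wX (Kmon q A eps b) = Kmon q A eps (weyl A wX b).
  by elim: wX => //= m w ->; have [_ _ -> _ _] := h_T m.
rewrite (h_Ad (has_weight_Kmon _)) sc0 scale1r weylN.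
have tlX : tau l \in X by rewrite -(adm_tauX hX) imset_f.
by rewrite -(adm_root hX tlX) (adm_tauK hX) Kmon_simple.
Qed.

Context (Zp : 'I_n -> seq 'I_n) (av v : 'I_n -> F).
Hypothesis hZ : Kolb_data X tau theta (lusztig_word T wX) Zp av v.

Let tauX l : (tau l \in X) = (l \in X).
Proof. by rewrite -{1}(adm_tauX hX) mem_imset //; apply: perm_inj. Qed.

Definition uvec i : U := adw (Zp (tau i)) (E (tau i)).
Definition uwt i : 'rV[int]_n := wsum (Zp (tau i)).

Lemma Zp_sub i : i \notin X -> {subset Zp i <= X}.
Proof. by move=> /hZ[]. Qed.

Lemma v_neq0 i : i \notin X -> v i != 0.
Proof. by move=> /hZ[]. Qed.

Lemma theta_FK i : i \notin X -> theta (F_ i * K i) = - v i *: uvec i.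
Proof. by move=> /hZ[_ _ _ ->]; rewrite /uvec -ad_wordE scaleNr. Qed.

Lemma kwt_uvec i : kwt (uwt i + simple (tau i)) (uvec i).
Proof. exact: (kwt_adw q_neq0 rels _ (kwt_E rels (tau i))). Qed.

Lemma uwt_supp i m : i \notin X -> m \notin X -> uwt i 0 m = 0.
Proof.
move=> iX mX; have tiX : tau i \notin X by rewrite tauX.
have := Zp_sub tiX; rewrite /uwt; elim: (Zp _) => [|l w IHw] wX'.
  by rewrite /wsum big_nil mxE.
rewrite wsum_cons mxE IHw ?addr0; last by move=> k kw; apply: wX'; rewrite in_cons kw orbT.
have -> : simple l 0 m = (m == l)%:R by rewrite mxE eqxx.
by case: eqVneq => // ml; case/negP: mX; rewrite ml; apply: wX'; rewrite mem_head.
Qed.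

(** The weight of the word is not given and has to be recovered: theta applied to the relation
    between K_l and F_i K_i yields the K_l-eigenvalue, which determines the exponent as q is not a
    root of unity. *)
Lemma uwt_root i l : i \notin X -> uvec i != 0 -> l \in X ->
  root_at A (uwt i) l = - A l i - A l (tau i).
Proof.
move=> iX u0 lX.
have : K l * (F_ i * K i) = q_ l ^ (- A l i) *: (F_ i * K i * K l).
  by rewrite mulrA (K_F rels) -scalerAl -!mulrA (K_K rels).
move=> /(congr1 theta); rewrite theta_Z !(theta_M (K l)) (theta_M _ (K l)) theta_K // theta_FK //.
rewrite -scalerAr -scalerAl scalerA mulrC -scalerA.
have v0 : - v i != 0 by rewrite oppr_eq0 v_neq0.
move=> /(scalerI v0).
rewrite (kwt_uvec i l) => /eqP; rewrite -subr_eq0 -scalerBl scaler_eq0 subr_eq0.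
case/orP=> [/eqP/(qi_expz_inj q_neq0 q_nroot eps_gt0)|/eqP uK]; last first.
  by case/eqP: u0; apply: (K_mulr_inj rels (i := l)); rewrite uK mul0r.
by rewrite root_atD root_at_simple => /(canRL (addrK _)).
Qed.

Lemma uwt_weyl i : i \notin X -> uvec i != 0 ->
  uwt i + simple (tau i) = weyl A wX (simple (tau i)).
Proof.
move=> iX u0; apply/eqP; rewrite -subr_eq0 -addrA; apply/eqP.
apply: (weight_unique hX) => [m mX|l lX].
  rewrite mxE uwt_supp // add0r [LHS]mxE [X in _ + X]mxE (weyl_supp A _ wX_sub mX).
  exact: subrr.
rewrite !root_atD root_atN root_at_simple uwt_root // (root_at_weylX hA hX) //.
by rewrite root_at_simple (adm_tauA hX) opprK; ring.
Qed.

Lemma adE_uvec i l : i \notin X -> l \in X -> adE l (uvec i) = 0.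
Proof.
move=> iX lX; have tiX : tau i \notin X by rewrite tauX.
have [->|u0] := eqVneq (uvec i) 0; first exact: adE0.
apply: (span_highest q_neq0 q_nroot symA eps_gt0 diagA rels offdiagA tiX
    (Uq_serre_E q A eps) (w := rev wX) (b := uwt i) (m := tau l)) => //.
- by move=> k; rewrite mem_rev => /wX_sub.
- by rewrite tauX.
- exact/span_word/Zp_sub.
- by rewrite uwt_weyl // (weyl_revK hA).
- exact: (weyl_rev_simple hA hX).
Qed.

Lemma E_uvec_Ki i l : i \notin X -> l \in X ->
  E l * (uvec i * Ki i) = uvec i * Ki i * E l.
Proof.
move=> iX lX; have [->|u0] := eqVneq (uvec i) 0; first by rewrite !mul0r mulr0.
have := adE_uvec iX lX; rewrite (adE_kwt rels l (kwt_uvec i)).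
rewrite root_atD root_at_simple uwt_root // subrK => /eqP; rewrite subr_eq0 => /eqP Eu.
rewrite mulrA Eu -mulrA (Ki_kwt q_neq0 rels i (kwt_E rels l)) root_at_simple.
by rewrite -scalerAr -scalerAl -!invr_expz (qi_pairing q symA) mulrA.
Qed.

Lemma adw_E_ns i (w : seq 'I_n) : {subset w <= X} -> w != [::] -> i \in I_ns A X tau ->
  adw w (E i) = 0.
Proof.
rewrite inE => wX' w0 /and3P[iX _ /forallP Ail].
case/lastP: w wX' w0 => // w l wX' _; rewrite /adw foldr_rcons.
have lX : l \in X by apply: wX'; rewrite mem_rcons mem_head.
have Ali : A l i = 0 by apply/(gcm_zero hA)/eqP; have := Ail l; rewrite lX.
have li : l != i by apply: contra iX => /eqP<-.
have -> : adE l (E i) = 0.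
  have := iter_adE_serre q_neq0 q_nroot eps_gt0 diagA rels offdiagA li.
  by rewrite Ali /= => ->; have := Uq_serre_E q A eps li; rewrite Ali.
exact: adw0.
Qed.

Lemma theta_FK_ns i : i \in I_ns A X tau -> theta (F_ i * K i) = - E i.
Proof.
rewrite inE => /and3P[iX /eqP ti /forallP Ail].
rewrite /theta_q; have [_ oF oK] := h_omega i.
have [tE _ _] := h_tau i; have [pE _ _] := h_psi i.
have -> : omega (F_ i * K i) = - (E i * Ki i) by rewrite rmorphM /= oF oK mulNr.
have -> : tauU (- (E i * Ki i)) = - (E i * Ki i).
  by rewrite rmorphN rmorphM /= tE tauU_Ki ti.
have -> : psi (- (E i * Ki i)) = - (E i * K i * Ki i).
  by rewrite rmorphN rmorphM /= pE psi_Ki.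
rewrite -mulrA (K_Ki rels) mulr1.
have -> : lusztig_word T wX (- E i) = - E i.
  elim: wX wX_sub => //= l w IHw wX'; rewrite IHw; last first.
    by move=> k kw; apply: wX'; rewrite in_cons kw orbT.
  have lX : l \in X by apply: wX'; rewrite mem_head.
  have Ali : A l i = 0 by apply/(gcm_zero hA)/eqP; have := Ail l; rewrite lX.
  have il : i != l by apply: contra iX => /eqP->.
  have [_ _ _ hE _] := h_T l; rewrite rmorphN /= hE // Ali big_ord1 /divpow.
  by rewrite subn0 /= !expr0 /qfact big_geq // !invr1 !scale1r mul1r !mulr1 scale1r mul1r.
by rewrite rmorphN /= (h_Ad (wt_E _ _ _ _)) sc_simple // scale1r.
Qed.

(** A letter from X would annihilate E_i, while theta(F_i K_i) = -E_i is nonzero; so the word is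
    empty and the scalars can be compared. *)
Lemma Zp_ns i : i \in I_ns A X tau -> Zp i = [::] /\ v i = 1.
Proof.
move=> ins; have := ins; rewrite inE => /and3P[iX /eqP ti _].
have := theta_FK iX; rewrite theta_FK_ns // scaleNr => /oppr_inj; rewrite /uvec ti => Ei.
have E0 : E i != 0 := Ugen_E_neq0 q_neq0 q_nroot two_neq0 symA eps_gt0 diagA offdiagA i.
have Z0 : Zp i = [::].
  apply/eqP/negPn/negP => Z0; case/eqP: E0.
  by rewrite Ei adw_E_ns ?scaler0 //; apply: Zp_sub.
split=> //; move: Ei; rewrite Z0 /= => /eqP; rewrite -[X in X == _]scale1r.
by rewrite -subr_eq0 -scalerBl scaler_eq0 (negPf E0) orbF subr_eq0 => /eqP.
Qed.

(** For an empty word [uwt] is 0, and [uwt_root] gives 2 a_li = 0 for all l in X. *)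
Lemma Zp_nonns i : i \notin X -> tau i = i -> i \notin I_ns A X tau -> Zp i != [::].
Proof.
move=> iX ti; rewrite inE iX ti eqxx /= => /forallPn[l]; rewrite negb_imply => /andP[lX Ail].
apply: contra Ail => /eqP Z0.
have ui : uvec i = E i by rewrite /uvec ti Z0.
have E0 : E i != 0 := Ugen_E_neq0 q_neq0 q_nroot two_neq0 symA eps_gt0 diagA offdiagA i.
have := uwt_root iX _ lX; rewrite ui => /(_ E0).
rewrite /uwt ti Z0 /wsum big_nil root_at0 => e; apply/eqP/(gcm_zero hA); move: e.
by move: (A l i) => t; clear; lia.
Qed.

Context (c s : 'I_n -> F).
Hypothesis hs : s_parameter A X tau s.
Context (i j : 'I_n).
Hypotheses (iX : i \notin X) (jX : j \notin X) (ij : i != j) (tau_i : tau i = i).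

Local Notation p := (q_ i).
Local Notation N := `|1 - A i j|%N.
Local Notation Zi := (calZ q A eps tau Zp v i).

Let p_neq0 : p != 0 := qi_neq0 eps q_neq0 i.
Let p_nroot m : (0 < m)%N -> p ^+ m != 1 := @qi_nroot _ _ _ _ q_nroot eps_gt0 i m.
Let d_neq0 : p - p^-1 != 0 := qsubV_neq0 p_neq0 p_nroot.
Let N_gt0 : (0 < N)%N.
Proof. by have := offdiagA ij; clear; lia. Qed.
Let AijE : A i j = 1 - N%:Z.
Proof. by have := offdiagA ij; clear; lia. Qed.
Let pA : p ^ A i j = p / p ^+ N.
Proof. by rewrite {1}AijE expfzDr // expr1z -invr_expz. Qed.
Let pAV : p ^ (- A i j) = p ^+ N / p.
Proof. by rewrite -invr_expz pA invf_div. Qed.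
Let qjA : q_ j ^ A j i = p / p ^+ N.
Proof. by rewrite -(qi_pairing q symA) pA. Qed.

Let sAl a (x y : U) : (a *: x) * y = a *: (x * y). Proof. by rewrite scalerAl. Qed.
Let sAr a (x y : U) : x * (a *: y) = a *: (x * y). Proof. by rewrite scalerAr. Qed.

Definition theta_part l : U := (- (c l * v l)) *: (uvec l * Ki l).
Local Notation w := (theta_part i).
Local Notation wj := (theta_part j).

Lemma BgenE l : l \notin X ->
  Bgen X c s theta l = F_ l + theta_part l + s l *: Ki l.
Proof.
move=> lX; rewrite /Bgen (negPf lX) theta_FK // /theta_part; congr (_ + _ + _).
by rewrite sAl scalerA mulrN.
Qed.

(** Outside I_ns, where s_i = 0, the value 0 lets the relation [wf] have the same shape in both
    cases: its k k-term survives exactly when the word of Z_i^+ is empty. *)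
Definition torus_part : U := if i \in I_ns A X tau then Ki i else 0.
Local Notation k := torus_part.

Lemma BgeniE : Bgen X c s theta i = F_ i + w + s i *: k.
Proof.
rewrite BgenE // /k; case: ifP => // /negP ins; congr (_ + _).
suff -> : s i = 0 by rewrite !scale0r.
by apply/eqP/negPn/negP => /(hs iX)[].
Qed.

Let uvec_ns : i \in I_ns A X tau -> uvec i = E i.
Proof. by move=> /Zp_ns[Z0 _]; rewrite /uvec tau_i Z0. Qed.

Let Ki_F l m : Ki l * F_ m = q_ l ^ A l m *: (F_ m * Ki l).
Proof. by rewrite (Ki_kwt q_neq0 rels l (kwt_F rels m)) root_atN root_at_simple opprK. Qed.

Let Ki_Ki l m : Ki l * Ki m = Ki m * Ki l.
Proof. by rewrite (Ki_kwt q_neq0 rels l (kwt_Ki rels m)) root_at0 oppr0 expr0z scale1r. Qed.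

Let A_ns l m : l \in I_ns A X tau -> m \in X -> A l m = 0 /\ A m l = 0.
Proof.
rewrite inE => /and3P[_ _ /forallP Alm] mX; have := Alm m; rewrite mX => /eqP e.
by split=> //; apply/(gcm_zero hA).
Qed.

Let uwt_ns l m : l \in I_ns A X tau -> m \notin X -> root_at A (uwt m) l = 0.
Proof.
move=> lns mX; rewrite /root_at big1 // => h _.
have [hX'|hX'] := boolP (h \in X); first by rewrite (A_ns lns hX').1 mulr0.
by rewrite uwt_supp // mul0r.
Qed.

Let Ki_uvec l m : Ki l * uvec m =
  q_ l ^ (- root_at A (uwt m + simple (tau m)) l) *: (uvec m * Ki l).
Proof. exact: (Ki_kwt q_neq0 rels l (kwt_uvec m)). Qed.

Let kf : k * F_ i = p ^+ 2 *: (F_ i * k).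
Proof.
rewrite /k; case: ifP => _; last by rewrite mul0r mulr0 scaler0.
by rewrite Ki_F diagA.
Qed.

Let kw : k * w = p ^- 2 *: (w * k).
Proof.
rewrite /k; case: ifP => ins; last by rewrite mul0r mulr0 scaler0.
rewrite /theta_part sAr sAl mulrA Ki_uvec root_atD uwt_ns // add0r tau_i root_at_simple diagA.
by rewrite !sAl -!mulrA scalerA [_ * p ^- 2]mulrC -scalerA.
Qed.

(** Normalized so that kap becomes q_i c_i Z_i; the factor q_i^2 comes from moving K_i^-1 past F_i
    in W_i F_i. *)
Let z : U := (c i * p ^+ 2 / (p - p^-1)) *: Zi.
Let del : F := c i * v i * p ^+ 2 / (p - p^-1).

Let kapE : (p^-1 * (p - p^-1)) *: z = (p * c i) *: Zi.
Proof.
rewrite /z scalerA; congr (_ *: _); move: p p_neq0 (p - p^-1) d_neq0 (c i) => P P0 D D0 C.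
by field; rewrite D0.
Qed.

Let Zi_spec : exists x, [/\ Zi = - v i *: x,
  adw (Zp i) (K i * K i) = x * (K i * K i),
  forall y, {in X, forall l, E l * y = y * E l} -> x * y = y * x
  & Zp i = [::] -> x = 1].
Proof.
have [x [xE _ xc x1]] := adw_KK q_neq0 rels (Zp i) i.
exists x; split=> //; last by move=> y yc; apply: xc => l /(Zp_sub iX)/yc.
rewrite /calZ tau_i ad_wordE expr2 xE scaleNr -!mulrA; congr (- (_ *: _)).
by rewrite (mulrA (K i) (Ki i)) (K_Ki rels) mul1r (K_Ki rels) mulr1.
Qed.

Let Zi_comm y : {in X, forall l, E l * y = y * E l} -> Zi * y = y * Zi.
Proof. by move=> yc; have [x [-> _ xc _]] := Zi_spec; rewrite sAl sAr xc. Qed.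

Let z_comm y : {in X, forall l, E l * y = y * E l} -> z * y = y * z.
Proof. by move=> /Zi_comm zy; rewrite /z sAl sAr zy. Qed.

Let E_F_X m l : m \notin X -> l \in X -> E l * F_ m = F_ m * E l.
Proof. by move=> mX lX; rewrite (E_F_neq rels) //; apply: contra mX => /eqP<-. Qed.

Let E_theta m l : m \notin X -> l \in X -> E l * theta_part m = theta_part m * E l.
Proof. by move=> mX lX; rewrite /theta_part sAl sAr E_uvec_Ki. Qed.

Let E_Ki m l : m \in I_ns A X tau -> l \in X -> E l * Ki m = Ki m * E l.
Proof.
move=> mns lX; rewrite (Ki_kwt q_neq0 rels m (kwt_E rels l)) root_at_simple.
by rewrite (A_ns mns lX).1 oppr0 expr0z scale1r.
Qed.

Let E_k l : l \in X -> E l * k = k * E l.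
Proof.
by move=> lX; rewrite /k; case: ifP => ins; rewrite ?mulr0 ?mul0r // E_Ki.
Qed.

Let wf : w * F_ i = p ^+ 2 *: (F_ i * w) + z + del *: (k * k).
Proof.
have [x [ZiE xE _ x1]] := Zi_spec.
have iZ : i \notin Zp i by apply: contra iX => /(Zp_sub iX).
have := adw_E_F q_neq0 symA rels iZ; rewrite xE.
have -> : adw (Zp i) (E i) = uvec i by rewrite /uvec tau_i.
move/(congr1 (fun t => t * Ki i)); rewrite -mulrA (K_Ki rels) mulr1 sAl mulrBl.
rewrite -!mulrA (K_Ki rels) mulr1 => /(canRL (subrK _)) uF.
(* The word [Zp i] is empty exactly for i in I_ns, so the unit term of the commutator contributes
   K_i^-2 = k k or nothing. *)
have -> : k * k = (nilp (Zp i))%:R *: (Ki i * Ki i).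
  rewrite /k; case: ifP => ins; first by have [-> _] := Zp_ns ins; rewrite scale1r.
  have := Zp_nonns iX tau_i (negbT ins); rewrite /nilp -size_eq0 => /negPf ->.
  by rewrite mulr0 scale0r.
have -> : w * F_ i = (- (c i * v i) * p ^+ 2) *: (uvec i * F_ i * Ki i).
  by rewrite /theta_part sAl -mulrA Ki_F diagA sAr scalerA mulrA.
have -> : F_ i * w = (- (c i * v i)) *: (F_ i * uvec i * Ki i).
  by rewrite /theta_part sAr mulrA.
rewrite uF mulrDl sAl mulrBl -(mulrA x) (K_Ki rels) mulr1 /z ZiE /del.
case: (nilp _); rewrite /= ?(mulr1n, mulr0n) ?(mul1r, mul0r) ?(scale1r, scale0r);
  move: (F_ i * uvec i * Ki i) (Ki i * Ki i) (p ^+ 2) ((p - p^-1)^-1) (c i) (v i)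
    => y y' P D C V; by lmod F (Uq q A eps); ring.
Qed.

Let zf : z * F_ i = F_ i * z. Proof. by apply: z_comm => l lX; apply: E_F_X. Qed.
Let zw : z * w = w * z. Proof. by apply: z_comm => l lX; apply: E_theta. Qed.
Let zk : z * k = k * z. Proof. by apply: z_comm => l lX; apply: E_k. Qed.

Local Notation relation Y :=
  (bchain p (Bgen X c s theta i) ((p * c i) *: Zi) N N Y = 0).

Lemma F_relation : relation (F_ j).
Proof.
have ji : j != i by rewrite eq_sym.
have iZ : j \notin Zp i by apply: contra jX => /(Zp_sub iX).
have FKi : F_ j * Ki i = (p ^+ N / p) *: (Ki i * F_ j).
  by rewrite Ki_F pA scalerA mulrA divfK // divff ?expf_neq0 // scale1r.
have uF : uvec i * F_ j = F_ j * uvec i.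
  rewrite /uvec tau_i; apply: (adw_comm_F q_neq0 symA rels) => //.
  exact: (E_F_neq rels).
rewrite -kapE BgeniE; apply: (lowest_relation p_neq0 p_nroot (s i) kf wf zf).
- by apply: z_comm => l lX; apply: E_F_X.
- by rewrite /theta_part sAr mulrA -uF -mulrA FKi !(sAr, sAl) !scalerA [_ * (_ / p)]mulrC !mulrA.
- by rewrite /k; case: ifP => _ //; rewrite mulr0 mul0r scaler0.
- exact: (Uq_serre_F q A eps ij).
Qed.

Let A_tau_j : A i (tau j) = A i j.
Proof. by rewrite -[in LHS]tau_i (adm_tauA hX). Qed.

(** This is (alpha_i, w_X alpha_tau(j)) = (alpha_j, w_X alpha_i), the common scalar that
    [serre_twist] asks for. *)
Let form_sym : uvec i != 0 -> uvec j != 0 ->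
  p ^ (- root_at A (uwt j + simple (tau j)) i) =
  q_ j ^ (- root_at A (uwt i + simple (tau i)) j).
Proof.
move=> ui uj; rewrite !exprnP !exprz_exp !root_atD !root_at_simple.
have /= e := weight_symmetry hA hX tau_i (fun m => @uwt_supp i m iX)
  (fun m => @uwt_supp j m jX) _ (fun l => @uwt_root j l jX uj).
rewrite !mulrN !mulrDr e; last by move=> l lX; rewrite uwt_root // tau_i.
congr (_ ^ (- (_ + _))).
by rewrite A_tau_j tau_i (gcm_sym hA).
Qed.

(** The relation of F_i and F_j is twisted to F_i K_i and F_j K_j, carried through theta, and
    twisted again by K_i^-1 and K_j^-1. *)
Let uvec_serre : serre p N (uvec i * Ki i) (uvec j * Ki j) = 0.
Proof.
have [->|ui] := eqVneq (uvec i) 0; first by rewrite mul0r serre0l.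
have [->|uj] := eqVneq (uvec j) 0; first by rewrite mul0r serre0r.
apply: (serre_twist p_neq0 p_nroot (Ki_uvec i i) (Ki_uvec i j) _ (Ki_Ki i j)).
  by rewrite form_sym //; apply: Ki_uvec.
have FK0 : serre p N (F_ i * K i) (F_ j * K j) = 0.
  apply: (serre_twist p_neq0 p_nroot (K_F rels i i) (K_F rels i j) _ (K_K rels i j)).
    by rewrite (K_F rels j i) -!invr_expz (qi_pairing q symA).
  exact: (Uq_serre_F q A eps ij).
have [th thE] := theta_lrmorphism.
have := serre_rmorph p th N (F_ i * K i) (F_ j * K j); rewrite FK0 raddf0.
rewrite -!thE !theta_FK // serre_scale => /esym/eqP.
by rewrite scaler_eq0 mulf_eq0 expf_eq0 !oppr_eq0 !(negPf (v_neq0 _)) // andbF => /eqP.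
Qed.

Lemma theta_relation : relation wj.
Proof.
have tji : tau j != i by rewrite eq_sym -{1}tau_i (inj_eq perm_inj).
have tjX : tau j \notin X by rewrite tauX.
have iZ : i \notin Zp (tau j) by apply: contra iX => /(Zp_sub tjX).
have uF : uvec j * F_ i = F_ i * uvec j.
  by apply: (adw_comm_F q_neq0 symA rels) => //; apply: (E_F_neq rels).
rewrite -kapE BgeniE; apply: (highest_relation p_neq0 p_nroot (s i) kw wf zf zw zk).
- by apply: z_comm => l lX; apply: E_theta.
- rewrite /theta_part !(sAl, sAr) -mulrA Ki_F qjA sAr !scalerA.
  by rewrite [uvec j * (F_ i * _)]mulrA uF -!mulrA; congr (_ *: _); rewrite [RHS]mulrA mulrC.
- rewrite /k; case: ifP => ins; last by rewrite mulr0 mul0r scaler0.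
  rewrite /theta_part !(sAl, sAr) [Ki i * (_ * _)]mulrA Ki_uvec root_atD uwt_ns // add0r.
  have -> : root_at A (simple (tau j)) i = A i j.
    by rewrite root_at_simple A_tau_j.
  rewrite pAV !sAl -!mulrA [Ki j * _]Ki_Ki !scalerA.
  by congr (_ *: _); field; rewrite p_neq0 expf_neq0.
- by rewrite serre_scale uvec_serre scaler0.
Qed.

(** With k = 0 the weight condition on k is void. K_j^-1 passes W_i as a lowest weight vector does,
    because roots of X pair to zero with h_j, and its Serre polynomial in F_i vanishes by
    q-commutation. *)
Let K_relation_lowest : j \in I_ns A X tau -> i \notin I_ns A X tau -> relation (Ki j).
Proof.
move=> jns ins; have k0 : k = 0 by rewrite /k (negPf ins).
rewrite -kapE BgeniE; apply: (lowest_relation p_neq0 p_nroot (s i) kf wf zf).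
- by apply: z_comm => l lX; apply: E_Ki.
- rewrite /theta_part !(sAl, sAr) mulrA Ki_uvec root_atD uwt_ns // add0r tau_i root_at_simple.
  have -> : q_ j ^ (- A j i) = p ^+ N / p by rewrite -invr_expz qjA invf_div.
  by rewrite !sAl -!mulrA Ki_Ki !scalerA mulrC.
- by rewrite k0 mulr0 mul0r scaler0.
- by apply: serre_qcomm => //; rewrite Ki_F qjA.
Qed.

Let Ki_K l m : Ki l * K m = K m * Ki l.
Proof. by rewrite (Ki_kwt q_neq0 rels l (kwt_K rels m)) root_at0 oppr0 expr0z scale1r. Qed.

Let Ki_E l m : Ki l * E m = q_ l ^ (- A l m) *: (E m * Ki l).
Proof. by rewrite (Ki_kwt q_neq0 rels l (kwt_E rels m)) root_at_simple. Qed.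

(** The Casimir element of the quantum sl2 generated by E_i, F_i and K_i, with F_i E_i normalized to
    coefficient 1. *)
Let casimir : U :=
  F_ i * E i + ((p - p^-1) * (p ^+ 2 - 1))^-1 *: (p ^+ 2 *: K i + Ki i).

Let p21 : p ^+ 2 - 1 != 0. Proof. by rewrite subr_eq0 p_nroot. Qed.

Let casimir_coef :
  ((p - p^-1) * (p ^+ 2 - 1))^-1 = (p - p^-1)^-1 / (p ^+ 2 - 1).
Proof. by rewrite invfM. Qed.

Let pm2 : p ^ (- 2) = p ^- 2. Proof. by rewrite -invr_expz. Qed.
Let p2 : p ^ 2 = p ^+ 2. Proof. by []. Qed.

Let casimir_F : casimir * F_ i = F_ i * casimir.
Proof.
rewrite /casimir; move: casimir_coef; move: (_ * _)^-1 => D DE.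
rewrite mulrDl mulrDr -mulrA (E_F rels); move: DE; move: (p - p^-1)^-1 => e DE.
rewrite !(mulrDl, mulrDr, mulrN, sAl, sAr) (K_F rels) Ki_F diagA.
rewrite pm2 p2 DE; move: (F_ i * (F_ i * E i)) (F_ i * K i) (F_ i * Ki i) => x y y'.
move: p21 p_neq0; move: (p) => P P1 P0.
by lmod F (Uq q A eps); field; rewrite ?P0 ?P1.
Qed.

Let casimir_E : casimir * E i = E i * casimir.
Proof.
rewrite /casimir; move: casimir_coef; move: (_ * _)^-1 => D DE.
rewrite mulrDl mulrDr [E i * (F_ i * _)]mulrA (E_F rels).
move: DE; move: (p - p^-1)^-1 => e DE.
rewrite !(mulrDl, mulrDr, mulNr, sAl, sAr) (K_E rels) Ki_E diagA.
rewrite pm2 p2 DE; move: (F_ i * E i * E i) (E i * K i) (E i * Ki i) => x y y'.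
move: p21 p_neq0; move: (p) => P P1 P0.
by lmod F (Uq q A eps); field; rewrite ?P0 ?P1.
Qed.

Let casimir_Ki l : casimir * Ki l = Ki l * casimir.
Proof.
rewrite /casimir; move: (_ * _)^-1 => D; rewrite !(mulrDl, mulrDr, sAl, sAr).
rewrite -Ki_K (Ki_Ki i l).
congr (_ + _); rewrite mulrA Ki_F sAl -!mulrA Ki_E sAr scalerA.
by rewrite -expfzDr ?qi_neq0 // subrr expr0z scale1r.
Qed.

(** Here W_i = -c_i E_i K_i^-1 and z is a scalar, so F_i W_i is expressed through C, which is -c_i
    times the Casimir element. *)
Let K_relation_weight_zero b : j \in I_ns A X tau -> i \in I_ns A X tau ->
  N = b.*2.+1 -> relation (Ki j).
Proof.
move=> jns ins Nb; have kE : k = Ki i by rewrite /k ins.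
have [Zp0 v1] := Zp_ns ins; have wE : w = - c i *: (E i * Ki i).
  by rewrite /theta_part uvec_ns // v1 mulr1.
have zE : z = - (c i * p ^+ 2 / (p - p^-1)) *: 1.
  have [x [ZiE _ _ x1]] := Zi_spec.
  by rewrite /z ZiE x1 // v1 scalerA mulrN1.
have delE : del = c i * p ^+ 2 / (p - p^-1) by rewrite /del v1 mulr1.
have z_central y : z * y = y * z by rewrite zE sAl sAr mul1r mulr1.
pose C : U := - c i *: casimir.
have Cw : C * w = w * C.
  have CE : casimir * (E i * Ki i) = E i * Ki i * casimir.
    by rewrite mulrA casimir_E -!mulrA casimir_Ki.
  by rewrite /C wE !(sAl, sAr) CE.
have fw : F_ i * w = C * k + (1 - p ^+ 2)^-1 *: z + (del / (p ^+ 2 * (p ^+ 2 - 1))) *: (k * k).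
  have -> : z = - (c i * p ^+ 2 / (p - p^-1)) *: (K i * Ki i) by rewrite (K_Ki rels).
  rewrite kE wE delE /C /casimir casimir_coef.
  set D := (_ / (_ - 1)); have DE : D = (p - p^-1)^-1 / (p ^+ 2 - 1) by [].
  move: D DE => D DE.
  rewrite !(mulrDl, sAl, sAr) mulrA DE.
  have p12 : 1 - p ^+ 2 != 0 by rewrite subr_eq0 eq_sym p_nroot.
  move: p_neq0 p21 p12; move: (F_ i * E i * Ki i) (Ki i * Ki i) (K i * Ki i) (p - p^-1)^-1 (p) (c i) => x y y' d P ci P0 P1 P2.
  by lmod F (Uq q A eps); field; rewrite ?P0 ?P1 ?P2.
have pb : p / p ^+ N = p ^- b.*2 by rewrite Nb exprS invfM mulrA divff // mul1r.
have pb' : p ^+ N / p = p ^+ b.*2 by rewrite Nb exprS mulrC mulKf.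
rewrite -kapE BgeniE Nb.
apply: (weight_zero_relation p_neq0 p_nroot two_neq0 (s i) kf kw wf zf zw zk fw).
- by rewrite /C sAl sAr casimir_F.
- exact: Cw.
- by rewrite kE /C sAl sAr casimir_Ki.
- by rewrite z_central.
- by rewrite /C sAl sAr casimir_Ki.
- by rewrite z_central.
- by rewrite Ki_F qjA pb.
- rewrite wE !(sAl, sAr) mulrA Ki_E sAl -mulrA Ki_Ki mulrA scalerA mulrC -scalerA.
  by rewrite -invr_expz qjA invf_div pb' !scalerA mulrC.
- by rewrite kE Ki_Ki.
Qed.

Lemma K_relation : s j != 0 -> relation (Ki j).
Proof.
move=> sj; have [jns sP] := hs jX sj.
have [ins|ins] := boolP (i \in I_ns A X tau); last exact: K_relation_lowest.
have [|m Am] := sP i; first by rewrite !inE ij; move: ins; rewrite inE.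
(* As s_j is nonzero, a_ij = -2(m+1), so N = 1 - a_ij = 2b + 1 with b = m + 1. *)
apply: (K_relation_weight_zero (b := m.+1)) => //.
by rewrite Am; clear; lia.
Qed.

Lemma Bgen_relation : relation (Bgen X c s theta j).
Proof.
have lin a Y Y' : relation Y -> relation Y' -> relation (a *: Y + Y').
  move=> Y0 Y'0; have := bchain_linear p (Bgen X c s theta i) ((p * c i) *: Zi) N N a Y Y'.
  by rewrite Y0 Y'0 scaler0 addr0.
have FW : relation (F_ j + wj).
  by rewrite -[F_ j]scale1r; apply: lin; [apply: F_relation | apply: theta_relation].
rewrite (BgenE jX); have [->|sj] := eqVneq (s j) 0; first by rewrite scale0r addr0.
by rewrite [_ + s j *: _]addrC; apply: lin => //; apply: K_relation.
Qed.

Lemma Fij_Bgen (sg : bool) :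
  Fij q A eps i j (Bgen X c s theta i) (Bgen X c s theta j) =
  \sum_(0 <= m < `|A i j|) \sum_(0 <= m' < `|A i j| - m)
    rho sg p (c i) (A i j) m m' *:
      (Zi ^+ halfexp (A i j) m m' * Bgen X c s theta i ^+ m
       * Bgen X c s theta j * Bgen X c s theta i ^+ m').
Proof.
have aN : `|A i j|%N = N.-1 by have := offdiagA ij; clear; lia.
have ZB : Zi * Bgen X c s theta i = Bgen X c s theta i * Zi.
  rewrite BgeniE; apply: Zi_comm => l lX.
  rewrite !(mulrDr, mulrDl) E_F_X // E_theta //; congr (_ + _).
  by rewrite sAr sAl E_k.
rewrite -[LHS]/(serre p N _ _).
rewrite (relation_of_bchain p_neq0 p_nroot sg ZB Bgen_relation) -AijE aN.
by [].
Qed.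

End Theta.

Lemma rho_indep (F : fieldType) (p c : F) (sg : bool) (a : int) (m m' : nat) :
  p != 0 -> (forall n, (0 < n)%N -> p ^+ n != 1) -> a <= 0 ->
  (m < `|a|)%N -> (m' < `|a| - m)%N ->
  rho sg p c a m m' = rho false p c a m m'.
Proof.
move=> p0 p_nroot a0 ma m'a; case: sg => //.
have -> : a = 1 - `|1 - a|%N%:Z by move: a0; clear; lia.
have mm' : (m + m' <= `|1 - a|)%N by move: a0 ma m'a; clear; lia.
rewrite !rhoE //; case: ifP => // /negbT ev.
by rewrite structure_sum_indep.
Qed.

(** * The indeterminate q in the field of rational functions *)

Section FunctionField.
Context (K : fieldType).
Local Notation q := (tofrac ('X : {poly K})).

Lemma tofracX_neq0 : q != 0.
Proof. by rewrite tofrac_eq0 polyX_eq0. Qed.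

Lemma tofracX_nroot m : (0 < m)%N -> q ^+ m != 1.
Proof.
move=> m0; rewrite -tofracXn -tofrac1 tofrac_eq; apply/eqP => /(congr1 (size \o polyseq)).
by rewrite /= size_polyXn size_poly1 => -[] m_eq0; rewrite m_eq0 in m0.
Qed.

Lemma fraction_two_neq0 : [pchar K] =i pred0 -> 2 != 0 :> {fraction {poly K}}.
Proof.
move=> charK; have -> : 2 = tofrac ((2 : K)%:P) by rewrite polyCMn tofracMn tofrac1.
by rewrite tofrac_eq0 polyC_eq0 ((pcharf0P K).1 charK).
Qed.

End FunctionField.

Theorem theorem4p7
  (K : closedFieldType) (charK : [pchar K] =i pred0) (im : K) (him : im ^+ 2 = -1)
  (n : nat) (A : 'M[int]_n) (eps : 'I_n -> nat) (hA : symmetrizable_gcm A eps)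
  (X : {set 'I_n}) (tau : {perm 'I_n}) (wX : seq 'I_n)
  (hX : admissible_pair A X tau wX)
  (c s : 'I_n -> {fraction {poly K}})
  (hc : c_parameter A eps X tau wX c) (hs : s_parameter A X tau s)
  (q := tofrac ('X : {poly K}))
  (omega tauU psi Ads : {lrmorphism Uq q A eps -> Uq q A eps})
  (T : 'I_n -> {lrmorphism Uq q A eps -> Uq q A eps})
  (h_omega : is_omega omega)
  (h_tau : is_diagram_aut tau tauU)
  (h_psi : is_psi psi)
  (h_T : forall i, is_lusztig i (T i))
  (h_Ad : is_Ad (fun b => tofrac ((s_char A im X tau b)%:P)) Ads)
  (theta := theta_q Ads T wX psi tauU omega)
  (Zp : 'I_n -> seq 'I_n) (av v : 'I_n -> {fraction {poly K}})
  (hZ : Kolb_data X tau theta (lusztig_word T wX) Zp av v)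
  (i j : 'I_n) (hi : i \notin X) (hj : j \notin X) (hij : i != j)
  (htau : tau i = i)
  (a := A i j) (B := Bgen X c s theta) (Z := calZ q A eps tau Zp v) :
  exists rho_ : nat -> nat -> {fraction {poly K}},
    (forall (sg : bool) (m m' : nat), (m < `|a|)%N -> (m' < `|a| - m)%N ->
       rho_ m m' = rho sg (q ^+ eps i) (c i) a m m') /\
    (forall m m' : nat, (m < `|a|)%N -> (m' < `|a| - m)%N ->
       eparity (a + m%:Z + m'%:Z) = 0 -> rho_ m m' = 0) /\
    Fij q A eps i j (B i) (B j) =
      \sum_(0 <= m < `|a|) \sum_(0 <= m' < `|a| - m)
        rho_ m m' *: (Z i ^+ halfexp a m m' * B i ^+ m * B j * B i ^+ m').
Proof.
have q_neq0 : q != 0 := tofracX_neq0 K.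
have q_nroot m : (0 < m)%N -> q ^+ m != 1 by apply: tofracX_nroot.
have two_neq0 := fraction_two_neq0 charK.
set sc := fun b => _ in h_Ad.
have sc0 : sc 0 = 1.
  by rewrite /sc /s_char big1 ?tofrac1 // => l _; rewrite mxE expr0z.
have sc_simple l : l \notin X -> tau l = l -> sc (simple l) = 1.
  move=> lX tl; rewrite /sc /s_char big1 ?tofrac1 // => m _; rewrite mxE eqxx /=.
  by case: eqVneq => [->|_]; rewrite ?expr0z // /s_simple tl eqxx orbT exp1rz.
(* Either parity would do; [rho_indep] covers the other one. *)
exists (rho false (q ^+ eps i) (c i) a); split; [|split] => [sg m m' ma m'a|m m' _ _ e|].
- have p_neq0 := qi_neq0 eps q_neq0 i.
  have p_nroot := fun k => @qi_nroot _ _ _ _ q_nroot (gcm_eps_gt0 hA) i k.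
  by rewrite (rho_indep (c i) sg p_neq0 p_nroot (gcm_offdiag hA hij) ma m'a).
- by rewrite /rho e !mul0r.
- exact: (Fij_Bgen q_neq0 q_nroot two_neq0 hA hX sc0 sc_simple h_omega h_tau h_psi
    h_T h_Ad hZ c hs hi hj hij htau false).
Qed.
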